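(* If $X$ is a subprojective Banach space with an unconditional basis and non-trivial cotype, then $Rad(X)$ is subprojective.
   Context: All Banach spaces are assumed infinite dimensional. A Banach space $X$ is subprojective if every closed infinite dimensional subspace $Y \subset X$ contains a closed infinite dimensional subspace $Z \subset Y$ that is complemented in $X$. Non-trivial cotype means cotype $q$ for some $q<\infty$. $Rad(X)$ is the completion of the space of finite sums $\sum_n r_nx_n$, where $r_1,r_2,\ldots$ are the Rademacher functions on $[0,1]$ and $x_1,x_2,\ldots\in X$, in the norm of $L_1([0,1];X)$ (equivalently, by the Khintchine–Kahane inequality, in the norm of $L_p([0,1];X)$, $1\le p<\infty$). *)

(* Defs.v *)
From HB Require Import structures.
From mathcomp Require Import all_boot all_order all_algebra.
From mathcomp Require Import all_classical all_reals all_analysis.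
From mathcomp Require Import complex.

Set Implicit Arguments.
Unset Strict Implicit.
Unset Printing Implicit Defensive.

Import Order.TTheory GRing.Theory Num.Theory.
Import numFieldNormedType.Exports.

Local Open Scope classical_set_scope.
Local Open Scope ring_scope.

(* The scalar field K is R or R[i].  The norm of a [normedModType K] takes its
   values in K; [re] brings them back to R, where powers and integrals live. *)
Inductive real_or_complex (R : realType) :
    forall K : numFieldType, (K -> R) -> Prop :=
  | real_scalars : @real_or_complex R R (fun a => a)
  | complex_scalars : @real_or_complex R R[i] (@complex.Re R).

Section Subprojective.
Context {K : numFieldType} {X : normedModType K}.
Implicit Types Y Z : set X.

Definition linear_subspace Y : Prop := submod_closed (mem Y).

Definition finite_dim Y : Prop :=
  exists (n : nat) (b : 'I_n -> X),
    forall y, Y y -> exists a : 'I_n -> K, y = \sum_(i < n) a i *: b i.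

Definition infinite_dim Y : Prop := ~ finite_dim Y.

Definition complemented Z : Prop :=
  exists P : {linear X -> X},
    [/\ continuous P, (forall x, P (P x) = P x) & range P = Z].

End Subprojective.

Definition subprojective (K : numFieldType) (X : normedModType K) : Prop :=
  forall Y : set X, linear_subspace Y -> closed Y -> infinite_dim Y ->
  exists Z : set X,
    [/\ linear_subspace Z, closed Z, infinite_dim Z, Z `<=` Y & complemented Z].

Section Basis.
Context {K : numFieldType} {X : normedModType K}.
Implicit Types e : nat -> X.

Definition schauder_basis e : Prop :=
  forall x : X, exists! a : nat -> K,
    series (fun n => a n *: e n) @ \oo --> x.

Definition unconditionally_convergent (u : nat -> X) : Prop :=
  forall s : nat -> nat, bijective s -> cvgn (series (fun n => u (s n))).

Definition unconditional_basis e : Prop :=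
  schauder_basis e /\
  forall (a : nat -> K) (x : X), series (fun n => a n *: e n) @ \oo --> x ->
    unconditionally_convergent (fun n => a n *: e n).

End Basis.

(* On [0, 1] this is the sign of sin (2 ^ n * pi * t) outside the dyadic
   points.  The Rademacher functions are those with n >= 1. *)
Definition rademacher (R : realType) (K : numFieldType) (n : nat) (t : R) : K :=
  (-1) ^+ `|Num.floor (2 ^+ n * t)|%N.

Section Rademacher.
Context {R : realType} {K : numFieldType} (re : K -> R).

Definition rsum (X : normedModType K) (n : nat) (x : 'I_n -> X) : R -> X :=
  fun t => \sum_(i < n) rademacher K i.+1 t *: x i.

Definition L1norm (X : normedModType K) (f : R -> X) : R :=
  (\int[lebesgue_measure]_(t in `[0%R, 1%R]) re `|f t|)%R.

Definition cotype (X : normedModType K) (q : R) : Prop :=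
  2 <= q /\
  exists C : R, forall (n : nat) (x : 'I_n -> X),
    (\sum_(i < n) (re `|x i|) `^ q) `^ q^-1 <= C * L1norm (rsum x).

Definition nontrivial_cotype (X : normedModType K) : Prop :=
  exists q : R, cotype X q.

Definition rad_sums (X : normedModType K) : set (R -> X) :=
  [set f | exists (n : nat) (x : 'I_n -> X), f = rsum x].

(* Z, with the canonical map J, is a completion of [rad_sums X] in the norm of
   L_1([0, 1]; X).  Completions are determined up to isometric isomorphism, and
   J is only constrained on [rad_sums X]. *)
Definition is_Rad (X : normedModType K) (Z : completeNormedModType K) : Prop :=
  exists J : (R -> X) -> Z,
    [/\ (forall (a : K) (f g : R -> X), rad_sums f -> rad_sums g ->
           J (a *: f + g) = a *: J f + J g),
        (forall f : R -> X, rad_sums f -> re `|J f| = L1norm f)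
      & dense (J @` @rad_sums X)].

End Rademacher.

(* Main.v *)
Require Import Defs.
From mathcomp Require Import all_boot all_order all_algebra.
From mathcomp Require Import all_classical all_reals all_analysis.
From HB Require Import structures.
From mathcomp Require Import measurable_realfun complex ring lra zify.

(** Rad(X) is, up to isomorphism, the space X(l_2) of matrices (a_in) normed by
    the norm of sum_i |a_i|_2 e_i in X, where (e_i) is the unconditional basis and
    |a_i|_2 is the l_2 norm of the i-th row; the matrix stands for
    sum_n r_n (sum_i a_in e_i).  One inequality ([square_function_lower]) is
    Khintchine's inequality in each coordinate, followed by convexity of the
    norm.  The other one ([square_function_upper]) needs cotype: it says that
    multiplying the coefficients by normalized Rademacher sums, possibly strongly
    dependent, is bounded on average.  Each such multiplier is cut into dyadic
    layers.  A layer of probability 1/m restricts a vector to a random sparse set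
    of coordinates; m independent copies of that set are almost disjoint, so the
    lower q-estimate given by cotype shows that the restriction divides the mean
    norm by m^(1/q) ([sparse_restriction]).  Since Rademacher sums have
    subgaussian tails, the layers can be summed.

    Let now Y be a closed infinite dimensional subspace of Rad(X), and let P_m be
    the projection onto the first m rows.  There are two cases.

    If some P_m is bounded below on Y, then Y is isomorphic to a Hilbert space,
    because m rows form l_2 up to isomorphism; the orthogonal projection for the
    form given by the first m rows complements Y itself
    ([bounded_below_rows_complemented]).

    Otherwise Y contains unit vectors y_j very close to matrices u_j supported in
    disjoint blocks of rows ([hump]).  Pairing every row with the normalized
    conjugate row of the u_j defines a bounded operator B from Rad(X) to X.
    By the upper square function estimate B is bounded below on the span of the
    u_j, hence, by perturbation, on the closed span of the y_j.  The image of that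
    span contains a subspace complemented in X, whose preimage is complemented in
    Rad(X) ([subprojective_transfer], [gliding_hump]).

    Unconditionality enters through a single inequality, [unconditional_lattice]:
    if |b_i| <= |a_i| for all i, then the norm of sum_i b_i e_i is at most C times
    that of sum_i a_i e_i.  It is proved from the convergence of all
    rearrangements by a category argument. *)

Set Implicit Arguments.
Unset Strict Implicit.
Unset Printing Implicit Defensive.

Import Order.TTheory GRing.Theory Num.Theory.
Import numFieldNormedType.Exports.

Local Open Scope classical_set_scope.
Local Open Scope ring_scope.

(** * Inequalities with a vanishing error *)

Lemma le_eps (R : realType) (c x y : R) : (forall d, 0 < d -> x <= y + c * d) -> x <= y.
Proof.
move=> h; apply/ler_addgt0Pl => d d0.
have c1 : 0 < `|c| + 1 by rewrite ltr_wpDl.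
have := h (d / (`|c| + 1)); rewrite divr_gt0 // => /(_ isT) /le_trans; apply.
rewrite addrC lerD2r mulrCA ler_piMr ?(ltW d0) // ler_pdivrMr // mul1r.
by apply: le_trans (ler_norm c) _; rewrite lerDl.
Qed.

Lemma exp2_small (R : realType) (e : R) : 0 < e -> exists N, forall n, (N <= n)%N -> 2^-1 ^+ n < e.
Proof.
move=> e0; exists (Num.truncn e^-1).+1 => n hn.
rewrite exprVn -(invrK e) ltf_pV2 ?posrE ?exprn_gt0 ?invr_gt0 //.
apply: lt_le_trans (truncnS_gt _) _.
rewrite -natrX ler_nat (leq_trans hn) // ltnW // ltn_expl //.
Qed.

Lemma inv_small (R : realType) (r : R) : 0 < r ->
  exists N, forall m, (N <= m)%N -> (m.+1%:R : R)^-1 < r.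
Proof.
move=> r0; exists (Num.truncn r^-1) => m hm.
rewrite -[ltRHS]invrK ltf_pV2 ?posrE ?invr_gt0 //.
by apply: lt_le_trans (truncnS_gt _) _; rewrite ler_nat.
Qed.

(** * Scalars and real-valued norms *)

(** Norms over K take their values in K, which is only partially ordered when
    K = R[i].  These fields are what the argument uses of the two scalar
    fields: the order embedding [ofr] of R, which contains all norms, and the
    decomposition x = re x + i im x, with i replaced by 0 when K = R. *)
Record scalar_parts (R : realType) (K : numFieldType) (re : K -> R) :=
  ScalarParts {
  ofr : {rmorphism R -> K};
  im : K -> R;
  iunit : K;
  ofr_le : {mono ofr : x y / x <= y};
  reK : cancel ofr re;
  ofr_re : forall x, 0 <= x -> ofr (re x) = x;
  reD : {morph re : x y / x + y};
  imD : {morph im : x y / x + y};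
  reZ : forall r x, re (ofr r * x) = r * re x;
  imZ : forall r x, im (ofr r * x) = r * im x;
  partsE : forall x, x = ofr (re x) + iunit * ofr (im x);
  norm_iunit : `|iunit| <= 1;
  norm_parts : forall x, re `|x| ^+ 2 = re x ^+ 2 + im x ^+ 2 }.

Lemma scalar_partsP (R : realType) (K : numFieldType) (re : K -> R) :
  real_or_complex re -> inhabited (scalar_parts re).
Proof.
case=> {K re}.
- constructor; apply: (@ScalarParts R R (fun a => a) idfun (fun=> 0) 0) => //=.
  + by move=> x y; rewrite addr0.
  + by move=> r x; rewrite mulr0.
  + by move=> x; rewrite mulr0 addr0.
  + by rewrite normr0 ler01.
  + by move=> x; rewrite expr0n addr0 real_normK ?num_real.
- constructor; apply: (@ScalarParts R R[i] (@complex.Re R)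
    (real_complex R) (@complex.Im R) 'i%C) => //=.
  + by move=> x y; rewrite lecR.
  + by move=> x /ger0_Im x0; case: x x0 => a b /= ->.
  + by case=> a b [c d].
  + by case=> a b [c d].
  + by move=> r [a b] /=; rewrite mul0r subr0.
  + by move=> r [a b] /=; rewrite mul0r addr0.
  + by case=> a b; apply/eqP; rewrite eq_complex /=; apply/andP; split; apply/eqP; ring.
  + rewrite (_ : `|_| = (Normc.normc ('i%C : R[i]))%:C%C) //=.
    by rewrite expr0n expr1n add0r sqrtr1.
  + by case=> a b /=; rewrite sqr_sqrtr // addr_ge0 ?sqr_ge0.
Qed.

Section Norm.
Context {R : realType} {K : numFieldType} (re : K -> R).

Definition nm (X : normedModType K) (x : X) : R := re `|x|.
Definition modulus (a : K) : R := re `|a|.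

End Norm.

Section NormTheory.
Context {R : realType} {K : numFieldType} {re : K -> R} (sc : scalar_parts re).
Local Notation nm := (nm re).
Local Notation modulus := (modulus re).
Implicit Types X Y : normedModType K.

Lemma normE X (x : X) : `|x| = ofr sc (nm x).
Proof. by rewrite ofr_re. Qed.

Lemma modE (a : K) : `|a| = ofr sc (modulus a).
Proof. by rewrite ofr_re. Qed.

Lemma ofr_lt x y : (ofr sc x < ofr sc y) = (x < y).
Proof. exact/(leW_mono (ofr_le sc)). Qed.

Lemma nm_ge0 X (x : X) : 0 <= nm x.
Proof. by rewrite -(ofr_le sc) -normE rmorph0. Qed.

Lemma nm0 X : nm (0 : X) = 0.
Proof. by rewrite /nm normr0 -(rmorph0 (ofr sc)) reK. Qed.

Lemma nm_eq0 X (x : X) : nm x = 0 -> x = 0.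
Proof. by move=> x0; apply: normr0_eq0; rewrite normE x0 rmorph0. Qed.

Lemma nm_gt0 X (x : X) : x != 0 -> 0 < nm x.
Proof.
move=> x0; rewrite lt_neqAle nm_ge0 andbT eq_sym.
by apply: contra x0 => /eqP/nm_eq0 ->.
Qed.

Lemma nmD X (x y : X) : nm (x + y) <= nm x + nm y.
Proof. by rewrite -(ofr_le sc) rmorphD -!normE ler_normD. Qed.

Lemma nmN X (x : X) : nm (- x) = nm x.
Proof. by rewrite /nm normrN. Qed.

Lemma nmBC X (x y : X) : nm (x - y) = nm (y - x).
Proof. by rewrite -opprB nmN. Qed.

Lemma nmB X (x y : X) : nm (x - y) <= nm x + nm y.
Proof. by rewrite -(nmN y) nmD. Qed.

Lemma nm_tri X (y x z : X) : nm (x - z) <= nm (x - y) + nm (y - z).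
Proof. by rewrite -[x - z](subrKA y) nmD. Qed.

Lemma nm_leB X (x y : X) : nm x <= nm (x - y) + nm y.
Proof. by rewrite -{1}(subrK y x) nmD. Qed.

Lemma nmZ X (a : K) (x : X) : nm (a *: x) = modulus a * nm x.
Proof. by apply: (can_inj (reK sc)); rewrite rmorphM -modE -!normE normrZ. Qed.

Lemma nm_sum X I (r : seq I) (P : pred I) (F : I -> X) :
  nm (\sum_(i <- r | P i) F i) <= \sum_(i <- r | P i) nm (F i).
Proof.
elim/big_rec2: _ => [|i y x _ h]; first by rewrite nm0.
by rewrite (le_trans (nmD _ _)) // lerD2l.
Qed.

Lemma mod_ge0 a : 0 <= modulus a.
Proof. by rewrite -(ofr_le sc) -modE rmorph0. Qed.

Lemma mod0 : modulus 0 = 0.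
Proof. by rewrite /modulus normr0 -(rmorph0 (ofr sc)) reK. Qed.

Lemma mod_eq0 a : modulus a = 0 -> a = 0.
Proof. by move=> x0; apply: normr0_eq0; rewrite modE x0 rmorph0. Qed.

Lemma modD x y : modulus (x + y) <= modulus x + modulus y.
Proof. by rewrite -(ofr_le sc) rmorphD -!modE ler_normD. Qed.

Lemma modN x : modulus (- x) = modulus x.
Proof. by rewrite /modulus normrN. Qed.

Lemma modM x y : modulus (x * y) = modulus x * modulus y.
Proof. by apply: (can_inj (reK sc)); rewrite rmorphM -!modE normrM. Qed.

Lemma modV x : modulus x^-1 = (modulus x)^-1.
Proof. by apply: (can_inj (reK sc)); rewrite fmorphV -!modE normfV. Qed.

Lemma mod_ofr r : modulus (ofr sc r) = `|r|.
Proof.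
apply: (can_inj (reK sc)); rewrite -modE.
have [r0|r0] := leP 0 r.
  by rewrite !ger0_norm // -(rmorph0 (ofr sc)) ofr_le.
by rewrite !ltr0_norm ?rmorphN // -(rmorph0 (ofr sc)) ofr_lt.
Qed.

Lemma mod1 : modulus 1 = 1.
Proof. by rewrite -(rmorph1 (ofr sc)) mod_ofr normr1. Qed.

Lemma mod_sum I (r : seq I) (P : pred I) (F : I -> K) :
  modulus (\sum_(i <- r | P i) F i) <= \sum_(i <- r | P i) modulus (F i).
Proof.
elim/big_rec2: _ => [|i y x _ h]; first by rewrite mod0.
by rewrite (le_trans (modD _ _)) // lerD2l.
Qed.

Lemma mod_iunit : modulus (iunit sc) <= 1.
Proof. by rewrite -(ofr_le sc) -modE rmorph1 norm_iunit. Qed.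

Lemma mod_sq x : modulus x ^+ 2 = re x ^+ 2 + im sc x ^+ 2.
Proof. exact: norm_parts. Qed.

Lemma re_le_mod x : `|re x| <= modulus x.
Proof.
rewrite -(@ler_pXn2r _ 2) // ?nnegrE ?mod_ge0 // mod_sq real_normK ?num_real //.
by rewrite lerDl sqr_ge0.
Qed.

Lemma im_le_mod x : `|im sc x| <= modulus x.
Proof.
rewrite -(@ler_pXn2r _ 2) // ?nnegrE ?mod_ge0 // mod_sq real_normK ?num_real //.
by rewrite lerDr sqr_ge0.
Qed.

Lemma re0 : re 0 = 0.
Proof. by rewrite -(rmorph0 (ofr sc)) reK. Qed.

Lemma im0 : im sc 0 = 0.
Proof. by have := imD sc 0 0; rewrite addr0 => h; lra. Qed.

Lemma re_sum I (r : seq I) (P : pred I) (F : I -> K) :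
  re (\sum_(i <- r | P i) F i) = \sum_(i <- r | P i) re (F i).
Proof. exact: (big_morph re (reD sc) re0). Qed.

Lemma im_sum I (r : seq I) (P : pred I) (F : I -> K) :
  im sc (\sum_(i <- r | P i) F i) = \sum_(i <- r | P i) im sc (F i).
Proof. exact: (big_morph (im sc) (imD sc) im0). Qed.

(** The topological notions are restated with real epsilons, so that
    from here on only real inequalities occur. *)

Definition nm_lim X (u : nat -> X) (l : X) :=
  forall e, 0 < e -> exists N, forall n, (N <= n)%N -> nm (u n - l) < e.

Definition nm_cauchy X (u : nat -> X) :=
  forall e, 0 < e -> exists N, forall m n, (N <= m)%N -> (N <= n)%N ->
    nm (u m - u n) < e.

Lemma epsK (P : R -> Prop) (e : K) : 0 < e ->
  (forall e, 0 < e -> P e) -> P (re e) /\ ofr sc (re e) = e.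
Proof.
move=> e0 h; have ee := ofr_re sc (ltW e0).
by split=> //; apply: h; rewrite -ofr_lt ee rmorph0.
Qed.

Lemma cvg_nmP X (u : nat -> X) (l : X) : u @ \oo --> l <-> nm_lim u l.
Proof.
split.
- move=> /cvgrPdist_lt ul e e0.
  have : 0 < ofr sc e by rewrite -(rmorph0 (ofr sc)) ofr_lt.
  case/ul => N _ hN; exists N => n Nn.
  by rewrite -ofr_lt -normE distrC; exact: hN.
- move=> ul; apply/cvgrPdist_lt => e e0.
  have [[N hN] ee] := epsK e0 ul.
  by exists N => // n /= Nn; rewrite -ee distrC normE ofr_lt; exact: hN.
Qed.

Lemma nm_complete (X : completeNormedModType K) (u : nat -> X) :
  nm_cauchy u -> exists l, nm_lim u l.
Proof.
move=> hu; suff /cvg_ex [l /cvg_nmP] : cvg (u @ \oo) by exists l.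
apply: cauchy_cvg; apply: cauchy_exP => e e0.
have [[N hN] ee] := epsK e0 hu.
exists (u N); exists N => // n /= Nn; rewrite -ball_normE /ball_ /=.
by rewrite -ee normE ofr_lt; exact: hN.
Qed.

Lemma closed_nmP X (A : set X) : closed A <->
  forall x, (forall e, 0 < e -> exists2 y, A y & nm (x - y) < e) -> A x.
Proof.
split.
- move=> cA x hx; apply: cA => B /nbhs_ballP [e /= e0 eB].
  have [[y Ay xy] ee] := epsK e0 hx.
  exists y; split => //; apply: eB; rewrite -ball_normE /ball_ /=.
  by rewrite -ee normE ofr_lt.
- move=> h x cx; apply: h => e e0.
  have e0' : 0 < ofr sc e by rewrite -(rmorph0 (ofr sc)) ofr_lt.
  have [y [Ay]] := cx _ (nbhsx_ballx x _ e0').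
  rewrite -ball_normE /ball_ /= normE ofr_lt => xy; by exists y.
Qed.

Lemma dense_nm X (A : set X) : dense A ->
  forall x e, 0 < e -> exists2 y, A y & nm (x - y) < e.
Proof.
move=> dA x e e0.
have e0' : 0 < ofr sc e by rewrite -(rmorph0 (ofr sc)) ofr_lt.
have [|y [xy Ay]] := dA _ _ (@open_interior _ (ball x (ofr sc e))).
  by exists x; apply: nbhsx_ballx.
exists y => //; move: xy => /interior_subset; rewrite -ball_normE /ball_ /=.
by rewrite normE ofr_lt.
Qed.

Lemma bounded_continuous X Y (f : {linear X -> Y}) (C : R) :
  (forall x, nm (f x) <= C * nm x) -> continuous f.
Proof.
move=> hf x; apply/cvgrPdist_lt => e e0.
have ee := ofr_re sc (ltW e0).
have re0 : 0 < re e by rewrite -ofr_lt ee rmorph0.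
have C0 : 0 < `|C| + 1 by rewrite ltr_pwDr.
near=> y; rewrite -linearB normE -ee ofr_lt.
have : nm (x - y) < re e / (`|C| + 1).
  rewrite -ofr_lt -normE; near: y; apply: cvgr_dist_lt => //.
  by rewrite -(rmorph0 (ofr sc)) ofr_lt divr_gt0.
rewrite ltr_pdivlMr // mulrC; apply: le_lt_trans; apply: le_trans (hf _) _.
by rewrite ler_wpM2r ?nm_ge0 // (le_trans (ler_norm _)) // lerDl.
Unshelve. all: by end_near. Qed.

Lemma continuous_bounded X Y (f : {linear X -> Y}) :
  continuous f -> exists2 C, 0 <= C & forall x, nm (f x) <= C * nm x.
Proof.
move=> /(_ 0) /cvgrPdist_lt /(_ 1 ltr01) /nbhs_ballP [d /= d0 hd].
have dd := ofr_re sc (ltW d0).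
have rd0 : 0 < re d by rewrite -ofr_lt dd rmorph0.
exists (2 / re d); first by rewrite divr_ge0 // ltW.
move=> x; have [->|x0] := eqVneq x 0; first by rewrite linear0 !nm0 mulr0.
have nx := nm_gt0 x0.
have : nm (f (ofr sc (re d / 2 / nm x) *: x)) < 1.
  rewrite -ofr_lt -normE rmorph1.
  have /= := hd (ofr sc (re d / 2 / nm x) *: x).
  rewrite linear0 sub0r normrN; apply.
  rewrite -ball_normE /ball_ /= sub0r normrN normE -{2}dd ofr_lt nmZ mod_ofr.
  rewrite ger0_norm; last by rewrite !divr_ge0 // ltW.
  by rewrite divfK ?gt_eqF // ltr_pdivrMr // ltr_pMr // ltr1n.
rewrite linearZ nmZ mod_ofr ger0_norm; last by rewrite !divr_ge0 // ltW.
move=> /ltW; rewrite -ler_pdivlMl; last by rewrite !divr_gt0.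
by rewrite mulr1 !invf_div [nm x * _]mulrC.
Qed.

Lemma mod_complete (u : nat -> K) :
  (forall d, 0 < d -> exists N, forall m n, (N <= m)%N -> (N <= n)%N ->
     modulus (u m - u n) < d) ->
  exists l, forall d, 0 < d -> exists N, forall n, (N <= n)%N ->
     modulus (u n - l) < d.
Proof.
move=> hu.
have real (v : nat -> R) : (forall m n, `|v m - v n| <= modulus (u m - u n)) ->
    exists l, forall d, 0 < d -> exists N, forall n, (N <= n)%N -> `|v n - l| < d.
  move=> hv; suff /cvg_ex [l /cvgrPdist_lt hl] : cvgn v.
    exists l => d /hl [N _ hN]; exists N => n Nn.
    by rewrite distrC; exact: hN.
  apply: cauchy_cvg; apply: cauchy_exP => d d0; have [N hN] := hu d d0.
  exists (v N); exists N => // n /= Nn; rewrite -ball_normE /ball_ /=.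
  exact: le_lt_trans (hv _ _) (hN _ _ _ _).
have reB x y : re (x - y) = re x - re y.
  by rewrite reD // -mulN1r -(rmorph1 (ofr sc)) -rmorphN reZ mulN1r.
have imB x y : im sc (x - y) = im sc x - im sc y.
  by rewrite imD // -mulN1r -(rmorph1 (ofr sc)) -rmorphN imZ mulN1r.
have [|l1 h1] := real (fun n => re (u n)).
  by move=> m n; rewrite -reB re_le_mod.
have [|l2 h2] := real (fun n => im sc (u n)).
  by move=> m n; rewrite -imB im_le_mod.
exists (ofr sc l1 + iunit sc * ofr sc l2) => d d0.
have [|N1 hN1] := h1 (d / 2); first by rewrite divr_gt0.
have [|N2 hN2] := h2 (d / 2); first by rewrite divr_gt0.
exists (maxn N1 N2) => n; rewrite geq_max => /andP [n1 n2].
have a1 := hN1 _ n1; have a2 := hN2 _ n2.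
have -> : u n - (ofr sc l1 + iunit sc * ofr sc l2) =
   ofr sc (re (u n) - l1) + iunit sc * ofr sc (im sc (u n) - l2).
  by rewrite {1}(partsE sc (u n)) !rmorphB; ring.
apply: le_lt_trans (modD _ _) _; rewrite modM !mod_ofr (splitr d).
apply: ltr_leD => //; apply: le_trans (ltW a2).
by rewrite ler_piMl ?mod_iunit.
Qed.

End NormTheory.

Arguments nm_lim {R K} re {X}.
Arguments nm_cauchy {R K} re {X}.

(** * Rademacher averages as finite means *)

(** The value of the Rademacher function of index n+1 on the k-th dyadic
    interval of length 2^-N, for n < N: it is read off the binary digit of k of
    weight 2^(N-1-n). *)
Definition sgn (T : pzRingType) (N k n : nat) : T :=
  (-1) ^+ (k %/ 2 ^ (N.-1 - n)).

Definition avg (R : realType) (N : nat) (F : nat -> R) : R :=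
  (2 ^+ N)^-1 * \sum_(k < 2 ^ N) F k.

Section StepIntegral.
Context {R : realType}.
Local Notation mu := (@lebesgue_measure R).

Lemma step_integral (d : R) (h : nat -> R) (g : R -> R) (m : nat) :
  0 < d ->
  (forall k t, (k < m)%N -> t \in `[k%:R / d, k.+1%:R / d[ -> g t = h k) ->
  mu.-integrable `[0, m%:R / d[ (EFin \o g) /\
  \int[mu]_(t in `[0, m%:R / d[) g t = d^-1 * \sum_(k < m) h k.
Proof.
move=> d0; elim: m => [|m IH] hg.
  rewrite mul0r set_itvco0 big_ord0 mulr0 Rintegral_set0; split=> //.
  exact: integrable_set0.
have [|I1 E1] := IH; first by move=> k t km; apply: hg; rewrite ltnS ltnW.
have le1 : m%:R / d <= m.+1%:R / d by rewrite ler_pM2r ?invr_gt0 // ler_nat.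
have mge : 0 <= m%:R / d by rewrite divr_ge0 // ltW.
have mulast : mu `[m%:R / d, m.+1%:R / d[ = (d^-1)%:E.
  rewrite lebesgue_measure_itv /= lte_fin ltr_pM2r ?invr_gt0 // ltr_nat ltnSn.
  by rewrite -EFinB -mulrBl -natrB // subSnn mul1r.
have I2 : mu.-integrable `[m%:R / d, m.+1%:R / d[ (EFin \o g).
  apply: (@eq_integrable _ _ _ mu _ _ (fun _ => (h m)%:E)) => //.
    by move=> t; rewrite inE /= => ht; rewrite (hg m).
  apply/integrableP; split; first exact: measurable_cst.
  by rewrite integral_cst //= mulast -EFinM ltry.
have E2 : \int[mu]_(t in `[m%:R / d, m.+1%:R / d[) g t = d^-1 * h m.
  rewrite (@eq_Rintegral _ _ _ mu _ (fun=> h m)); last first.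
    by move=> t; rewrite inE /= => ht; rewrite (hg m).
  by rewrite Rintegral_cst //= mulast /= mulrC.
have splitI : [set` `[0, m.+1%:R / d[] =
    [set` `[0, m%:R / d[] `|` [set` `[m%:R / d, m.+1%:R / d[] :> set R.
  by rewrite (@itv_bndbnd_setU _ _ _ (BLeft (m%:R / d))) // bnd_simp.
have dis : [disjoint [set` `[0, m%:R / d[] & [set` `[m%:R / d, m.+1%:R / d[] : set R].
  apply/disj_setPS => t [] /=; rewrite !in_itv /= => /andP [_ h1] /andP [h2 _].
  by have := le_lt_trans h2 h1; rewrite ltxx.
have IU : mu.-integrable ([set` `[0, m%:R / d[] `|` [set` `[m%:R / d, m.+1%:R / d[])
    (EFin \o g).
  have /integrableP [M1 J1] := I1; have /integrableP [M2 J2] := I2.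
  have MU := proj2 (measurable_funU _ (measurable_itv _) (measurable_itv _))
    (conj M1 M2).
  apply/integrableP; split=> //.
  rewrite ge0_integral_setU //; first by rewrite lte_add_pinfty.
  exact: measurableT_comp.
rewrite splitI; split=> //.
by rewrite Rintegral_setU // E1 E2 big_ord_recr mulrDr.
Qed.
End StepIntegral.

Lemma rademacherE (R : realType) (K : numFieldType) (N k i : nat) (t : R) :
  (i < N)%N -> t \in `[k%:R / 2 ^+ N, k.+1%:R / 2 ^+ N[ ->
  rademacher K i.+1 t = sgn K N k i.
Proof.
move=> iN; rewrite in_itv /= => /andP [t1 t2].
have p2 : 0 < 2 ^+ N :> R by rewrite exprn_gt0.
move: t1 t2; rewrite ler_pdivrMr // ltr_pdivlMr // => t1 t2.
rewrite /rademacher /sgn; congr (_ ^+ _).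
have -> : (N.-1 - i = N - i.+1)%N by lia.
set d := (N - i.+1)%N; have Nd : N = (i.+1 + d)%N by rewrite /d; lia.
have q2 : 0 < 2 ^+ d :> R by rewrite exprn_gt0.
suff -> : Num.floor (2 ^+ i.+1 * t) = (k %/ 2 ^ d)%N :> int by [].
apply: Num.Theory.floor_def; rewrite -(ler_pM2r q2) -(ltr_pM2r q2).
have -> : 2 ^+ i.+1 * t * 2 ^+ d = t * 2 ^+ N by rewrite Nd exprD; ring.
have dm := divn_eq k (2 ^ d); have lt := ltn_mod k (2 ^ d).
set u := (k %/ 2 ^ d)%N in dm *.
have e1 : (u%:Z)%:~R * 2 ^+ d = (u * 2 ^ d)%:R :> R by rewrite natrM natrX.
have e2 : (u%:Z + 1)%:~R * 2 ^+ d = (u.+1 * 2 ^ d)%:R :> R.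
  by rewrite rmorphD natrM natrX -[u.+1]addn1 natrD rmorph1.
rewrite e1 e2; apply/andP; split.
  by apply: le_trans t1; rewrite ler_nat; lia.
apply: lt_le_trans t2 _; rewrite ler_nat mulSn; move: lt; rewrite expn_gt0 /=; lia.
Qed.

Lemma L1norm_rsum (R : realType) (K : numFieldType) (re : K -> R)
    (X : normedModType K) (N : nat) (x : 'I_N -> X) :
  L1norm re (rsum x) = avg N (fun k => nm re (\sum_(i < N) sgn K N k i *: x i)).
Proof.
have p2 : 0 < 2 ^+ N :> R by rewrite exprn_gt0.
pose g := fun t : R => re `|rsum x t|.
have [|I E] := @step_integral R (2 ^+ N)
  (fun k => nm re (\sum_(i < N) sgn K N k i *: x i)) g (2 ^ N) p2.
  move=> k t _ kt; rewrite /g /nm /rsum; congr (re `|_|).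
  by apply: eq_bigr => i _; rewrite (rademacherE _ _ kt).
rewrite /L1norm /avg -E; move: I E; rewrite natrX mulfV ?gt_eqF // => I E.
by rewrite Rintegral_itv_bndo_bndc.
Qed.

(** * Khintchine inequalities *)

Section Average.
Context {R : realType}.
Implicit Types F G : nat -> R.

Lemma eq_avg N F G : F =1 G -> avg N F = avg N G.
Proof. by move=> FG; congr (_ * _); apply: eq_bigr => k _. Qed.

Lemma avgD N F G : avg N (fun k => F k + G k) = avg N F + avg N G.
Proof. by rewrite /avg big_split mulrDr. Qed.

Lemma avgZ N c F : avg N (fun k => c * F k) = c * avg N F.
Proof. by rewrite /avg -mulr_sumr mulrCA. Qed.

Lemma le_avg N F G : (forall k, F k <= G k) -> avg N F <= avg N G.
Proof.
by move=> FG; rewrite ler_wpM2l ?invr_ge0 ?exprn_ge0 //; apply: ler_sum.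
Qed.

Lemma avg_cst N c : avg N (fun=> c) = c :> R.
Proof.
rewrite /avg sumr_const card_ord -[c *+ _]mulr_natl natrX mulKf // expf_neq0.
Qed.

Lemma avg_ge0 N F : (forall k, 0 <= F k) -> 0 <= avg N F.
Proof. by move=> F0; rewrite -(avg_cst N 0); apply: le_avg. Qed.

Lemma avg_sum N m (F : nat -> nat -> R) :
  avg N (fun k => \sum_(i < m) F i k) = \sum_(i < m) avg N (F i).
Proof. by rewrite /avg exchange_big mulr_sumr. Qed.

(** The cells k = 2j and k = 2j+1 are the two halves of the j-th cell of the
    coarser partition: the last sign is independent of the others.  Together with
    the next two lemmas, this is the induction step for every moment estimate. *)
Lemma avgS N F :
  avg N.+1 F = avg N (fun j => (F (2 * j)%N + F (2 * j).+1) / 2).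
Proof.
rewrite /avg exprSr invfM -mulrA; congr (_ * _).
rewrite -mulr_suml mulrC; congr (_ / _).
rewrite expnS; elim: (2 ^ N)%N => [|m IH]; first by rewrite muln0 !big_ord0.
by rewrite mulnS addnC addn2 !big_ord_recr /= IH addrA.
Qed.

Lemma sgnS T N j b n : (n < N)%N -> (b < 2)%N ->
  sgn T N.+1 (2 * j + b) n = sgn T N j n.
Proof.
move=> nN b2; rewrite /sgn; congr (_ ^+ _).
have -> : (N.+1.-1 - n = (N.-1 - n).+1)%N by lia.
by rewrite expnS divnMA [(2 * j)%N]mulnC divnMDl // (divn_small b2) addn0.
Qed.

Lemma sgnS_last T N j b :
  sgn T N.+1 (2 * j + b) N = (-1) ^+ b.
Proof.
rewrite /sgn subnn expn0 divn1 -signr_odd oddD mul2n odd_double /=.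
by rewrite signr_odd.
Qed.

End Average.

Section Khintchine.
Context {R : realType}.
Implicit Type c : nat -> R.

Definition rads (N : nat) c (k : nat) : R := \sum_(n < N) sgn R N k n * c n.

Lemma radsS N c j b : (b < 2)%N ->
  rads N.+1 c (2 * j + b) = rads N c j + (-1) ^+ b * c N.
Proof.
move=> b2; rewrite /rads big_ord_recr /= sgnS_last; congr (_ + _).
by apply: eq_bigr => i _; rewrite sgnS.
Qed.

Lemma avg_radsS N c (f : R -> R) :
  avg N.+1 (fun k => f (rads N.+1 c k)) =
  avg N (fun j => (f (rads N c j + c N) + f (rads N c j - c N)) / 2).
Proof.
rewrite avgS; apply: eq_avg => j.
have := radsS N c j (isT : 0 < 2)%N; rewrite addn0 mul1r => ->.
by have := radsS N c j (isT : 1 < 2)%N; rewrite addn1 mulN1r => ->.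
Qed.

Lemma rads0 c k : rads 0 c k = 0.
Proof. by rewrite /rads big_ord0. Qed.

Lemma avg_rads_sq N c : avg N (fun k => rads N c k ^+ 2) = \sum_(n < N) c n ^+ 2.
Proof.
elim: N => [|N IH].
  rewrite big_ord0 -[RHS](avg_cst 0); apply: eq_avg => k.
  by rewrite rads0 expr0n.
rewrite (avg_radsS N c (fun x => x ^+ 2)) big_ord_recr /= -IH.
rewrite -[in RHS](avg_cst N (c N ^+ 2)) -avgD; by apply: eq_avg => j /=; field.
Qed.

(** Both exponentials are below a geometric series, since
    exp y <= 1/(1-y); the two series add up to 2/(1-x^2). *)
Lemma cosh_le (x : R) : x ^+ 2 <= 1 / 2 -> (expR x + expR (- x)) / 2 <= expR (2 * x ^+ 2).
Proof.
move=> x2; apply: le_trans (expR_ge1Dx _).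
have xl : `|x| < 1 by rewrite -(@ltr_pXn2r _ 2) ?nnegrE // real_normK ?num_real //; lra.
have {xl} [xl xr] : - 1 < x /\ x < 1 by apply/andP; rewrite -ltr_norml.
have hinv (y : R) : -1 < y -> y < 1 -> expR y <= (1 - y)^-1.
  move=> y1 y2; rewrite -(invrK (expR y)) lef_pV2 ?posrE ?invr_gt0 ?expR_gt0 //; last lra.
  by rewrite -expRN expR_ge1Dx.
have h1 := hinv x xl xr; have h2 : expR (- x) <= (1 + x)^-1.
  by rewrite -{2}[x]opprK; apply: hinv; lra.
have -> : 1 + 2 * x ^+ 2 = (1 + 2 * x ^+ 2) * (1 - x ^+ 2) / (1 - x ^+ 2).
  by rewrite mulfK //; apply: lt0r_neq0; lra.
apply: (@le_trans _ _ (((1 - x)^-1 + (1 + x)^-1) / 2)); first lra.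
have -> : ((1 - x)^-1 + (1 + x)^-1) / 2 = 1 / (1 - x ^+ 2).
  field; apply/and3P; split; apply: lt0r_neq0; lra.
rewrite ler_pM2r ?invr_gt0; last lra.
nra.
Qed.

Lemma avg_exp_rads N c : \sum_(n < N) c n ^+ 2 <= 1 / 2 ->
  avg N (fun k => expR (rads N c k)) <= expR (2 * \sum_(n < N) c n ^+ 2).
Proof.
elim: N => [|N IH] hc.
  rewrite big_ord0 mulr0 -[leRHS](avg_cst 0); apply: le_avg => k.
  by rewrite rads0.
have s0 : 0 <= \sum_(n < N) c n ^+ 2 by apply: sumr_ge0 => i _; exact: sqr_ge0.
move: hc; rewrite big_ord_recr /= => hc.
have c0 := sqr_ge0 (c N).
rewrite avg_radsS mulrDr expRD.
apply: le_trans (_ : _ <= avg N (fun k => expR (2 * c N ^+ 2) * expR (rads N c k))) _.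
  apply: le_avg => k; rewrite !expRD -mulrDr -mulrA mulrC.
  by rewrite ler_wpM2r ?expR_ge0 // cosh_le //; lra.
rewrite avgZ mulrC ler_wpM2r ?expR_ge0 // IH //; lra.
Qed.

Lemma expR1_le4 : expR 1 <= 4 :> R.
Proof.
have h : expR (2^-1) <= 2 :> R.
  rewrite -(invrK (expR _)) -expRN -[leRHS]invrK lef_pV2 ?posrE ?expR_gt0 //.
  by apply: le_trans (expR_ge1Dx _); lra.
have -> : expR 1 = expR (2^-1) * expR (2^-1) :> R by rewrite -expRD; congr expR; field.
have := expR_ge0 (2^-1 : R); nra.
Qed.

Lemma radsN N c k : rads N (fun n => - c n) k = - rads N c k.
Proof. by rewrite /rads -sumrN; apply: eq_bigr => i _; rewrite mulrN. Qed.

Lemma radsZ N t c k : rads N (fun n => t * c n) k = t * rads N c k.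
Proof. by rewrite /rads mulr_sumr; apply: eq_bigr => i _; rewrite mulrCA. Qed.

Lemma avg_exp_norm N c : \sum_(n < N) c n ^+ 2 <= 1 / 2 ->
  avg N (fun k => expR `|rads N c k|) <= 8.
Proof.
move=> hc; apply: le_trans
  (_ : _ <= avg N (fun k => expR (rads N c k) + expR (rads N (fun n => - c n) k))) _.
  apply: le_avg => k; rewrite radsN.
  by case: (ger0P (rads N c k)) => _; rewrite ?lerDl ?lerDr expR_ge0.
have h (d : nat -> R) : \sum_(n < N) d n ^+ 2 <= 1 / 2 ->
    avg N (fun k => expR (rads N d k)) <= 4.
  move=> hd; apply: le_trans (avg_exp_rads hd) _.
  by apply: le_trans expR1_le4; rewrite ler_expR; lra.
rewrite avgD (_ : 8 = 4 + 4); last by ring.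
apply: lerD; apply: h => //.
by apply: le_trans hc; apply: ler_sum => i _; rewrite sqrrN.
Qed.

Lemma expn_le_expR (x : R) n : 0 <= x -> x ^+ n <= n`!%:R * expR x.
Proof.
case: n => [|n] x0; first by rewrite expr0 fact0 mul1r; apply: le_trans (expR_ge1Dx _); lra.
have := expR_ge1Dxn n x0 => h.
rewrite -ler_pdivrMl ?ltr0n ?fact_gt0 // mulrC; lra.
Qed.

(** Chebyshev's inequality for the exponential moment.  Decay faster than every
    power is what allows the dyadic layers of a Rademacher sum to be added up. *)
Lemma rads_tail N c (y : R) p : \sum_(n < N) c n ^+ 2 <= 1 / 2 -> 0 < y ->
  avg N (fun k => ((y <= `|rads N c k|)%R : nat)%:R) <= 8 * p`!%:R / y ^+ p.
Proof.
move=> hc y0.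
apply: le_trans (_ : _ <= avg N (fun k => (p`!%:R / y ^+ p) * expR `|rads N c k|)) _.
  apply: le_avg => k; case: (leP y) => h /=; last first.
    by rewrite mulr_ge0 ?expR_ge0 // divr_ge0 // exprn_ge0 // ltW.
  rewrite mulrAC ler_pdivlMr ?exprn_gt0 // mul1r.
  apply: le_trans (expn_le_expR p (normr_ge0 _)).
  by rewrite lerXn2r ?nnegrE // ltW.
rewrite avgZ [leLHS]mulrC -[leRHS]mulrA; apply: ler_wpM2r; last exact: avg_exp_norm.
by rewrite divr_ge0 // exprn_ge0 // ltW.
Qed.

(** The second moment is known exactly and the fourth is bounded, so the first
    moment cannot be small: interpolate with y^2 <= t y + y^4/t^2. *)
Lemma khintchine_lower N c :
  Num.sqrt (\sum_(n < N) c n ^+ 2) <= 160 * avg N (fun k => `|rads N c k|).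
Proof.
set s := \sum_(n < N) _.
have s0 : 0 <= s by apply: sumr_ge0 => i _; exact: sqr_ge0.
have m0 : 0 <= avg N (fun k => `|rads N c k|) by apply: avg_ge0.
have [->|sn0] := eqVneq s 0; first by rewrite sqrtr0 mulr_ge0.
have sp : 0 < s by rewrite lt_neqAle eq_sym sn0.
set q := Num.sqrt s.
have q0 : 0 < q by rewrite sqrtr_gt0.
have qs : q ^+ 2 = s by rewrite sqr_sqrtr.
(* Scaled to square sum 1/4, the coefficients satisfy the hypothesis of the
   exponential bound. *)
pose u := q^-1 / 2; pose d n := u * c n.
have hd : \sum_(n < N) d n ^+ 2 = 4^-1.
  under eq_bigr => n _ do rewrite exprMn.
  by rewrite -mulr_sumr -/s -qs /u; field; rewrite gt_eqF.
have h4 : avg N (fun k => `|rads N d k| ^+ 4) <= 192.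
  apply: le_trans (_ : _ <= avg N (fun k => 24 * expR `|rads N d k|)) _.
    by apply: le_avg => k; have := expn_le_expR 4 (normr_ge0 (rads N d k)).
  rewrite avgZ; have := @avg_exp_norm N d; rewrite hd => h.
  have : (avg N (fun k => expR `|rads N d k|)) <= 8 by apply: h; lra.
  lra.
(* The value t = 40 makes the fourth moment contribute 192/40^2 < 1/4. *)
have key : 4^-1 <= 40 * avg N (fun k => `|rads N d k|) + 40^-2 * 192.
  rewrite -hd -avg_rads_sq.
  apply: le_trans (_ : _ <= avg N (fun k => 40 * `|rads N d k| + 40^-2 * `|rads N d k| ^+ 4)) _.
    apply: le_avg => k; rewrite -(real_normK (num_real (rads N d k))).
    set y := `|_|; have y0 : 0 <= y by exact: normr_ge0.
    have [yl|yl] := leP y 40.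
      have : 0 <= 40^-2 * y ^+ 4 by rewrite mulr_ge0 // exprn_ge0.
      nra.
    have : 0 <= 40 * y by nra.
    have : y ^+ 2 <= 40 ^- 2 * y ^+ 4.
      rewrite ler_pdivlMl ?exprn_gt0 //.
      have -> : y ^+ 4 = y ^+ 2 * y ^+ 2 by rewrite -exprD.
      by rewrite ler_wpM2r ?sqr_ge0 // lerXn2r ?nnegrE // ltW.
    lra.
  by rewrite avgD !avgZ lerD2l ler_wpM2l // invr_ge0.
have : avg N (fun k => `|rads N d k|) = u * avg N (fun k => `|rads N c k|).
  rewrite -avgZ; apply: eq_avg => k; rewrite radsZ normrM ger0_norm //.
  by rewrite divr_ge0 // invr_ge0 ltW.
move=> e; rewrite e /u in key.
set m := avg _ _ in key *.
have : q * (4^-1 - 40^-2 * 192) <= q * (40 * (q^-1 / 2 * m)).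
  by rewrite ler_pM2l //; lra.
have -> : q * (40 * (q^-1 / 2 * m)) = 20 * m by field; rewrite gt_eqF.
lra.
Qed.

End Khintchine.

(** * Unconditionally convergent series *)

(** Rearranging each interval [n, nxt n) separately gives a permutation of nat.
    This turns finite sets far out on which a series does not become small
    into a divergent rearrangement. *)
Section BlockPermutation.
Context (nxt : nat -> nat) (blk : nat -> seq nat).
Context (nxt_gt : forall n, (n < nxt n)%N).
Context (blkP : forall n, perm_eq (blk n) (iota n (nxt n - n))).

Let p k := iter k nxt 0%N.
Let L k := flatten [seq blk (p i) | i <- iota 0 k].

Lemma block_end_ge k : (k <= p k)%N.
Proof. by elim: k => //= k IH; exact: leq_ltn_trans IH (nxt_gt _). Qed.

Lemma blocksS k : L k.+1 = L k ++ blk (p k).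
Proof. by rewrite /L -addn1 iotaD map_cat flatten_cat /= cats0. Qed.

Lemma blocks_perm k : perm_eq (L k) (iota 0 (p k)).
Proof.
elim: k => // k IH; rewrite blocksS /p iterS -/(p k).
have -> : iota 0 (nxt (p k)) = iota 0 (p k) ++ iota (p k) (nxt (p k) - p k).
  by rewrite -{2}[p k]add0n -iotaD subnKC // ltnW.
exact: perm_cat.
Qed.

Lemma blocks_size k : size (L k) = p k.
Proof. by rewrite (perm_size (blocks_perm k)) size_iota. Qed.

Lemma blocks_prefix k l : (k <= l)%N -> prefix (L k) (L l).
Proof.
move=> /subnK <-; elim: (l - k)%N => [|m IH]; first exact: prefix_refl.
rewrite addSn blocksS; apply: prefix_trans IH _; exact: prefix_prefix.
Qed.

Definition block_perm j := nth 0%N (L j.+1) j.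

Lemma block_permE k j : (j < p k)%N -> block_perm j = nth 0%N (L k) j.
Proof.
move=> jk; have [kj|kj] := leqP k j.+1.
  have /prefixP [t e] := blocks_prefix kj.
  by rewrite /block_perm e nth_cat blocks_size jk.
have /prefixP [t e] := blocks_prefix (ltnW kj).
by rewrite e nth_cat blocks_size (leq_trans _ (block_end_ge _)).
Qed.

Lemma block_perm_bij : bijective block_perm.
Proof.
have pinj : injective block_perm.
  move=> i j; pose k := (maxn i j).+1.
  have ik : (i < p k)%N by rewrite (leq_trans _ (block_end_ge _)) // ltnS leq_maxl.
  have jk : (j < p k)%N by rewrite (leq_trans _ (block_end_ge _)) // ltnS leq_maxr.
  rewrite (block_permE ik) (block_permE jk) => /eqP.
  rewrite nth_uniq ?blocks_size // => [/eqP //|].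
  by rewrite (perm_uniq (blocks_perm k)) iota_uniq.
have psurj v : exists j, block_perm j = v.
  have vL : v \in L v.+1.
    by rewrite (perm_mem (blocks_perm _)) mem_iota add0n block_end_ge.
  exists (index v (L v.+1)).
  by rewrite (@block_permE v.+1) ?nth_index // -blocks_size index_mem.
have [g hg] := choice psurj.
by exists g => // x; apply: pinj; rewrite hg.
Qed.

Lemma block_perm_sum (V : nmodType) (u : nat -> V) k i s :
  blk (p k) = i ++ s ->
  \sum_(0 <= j < p k + size i) u (block_perm j) =
  \sum_(0 <= j < p k) u (block_perm j) + \sum_(j <- i) u j.
Proof.
move=> e.
have hL m : (m <= p k.+1)%N ->
    \sum_(0 <= j < m) u (block_perm j) = \sum_(j <- take m (L k.+1)) u j.
  move=> mk; rewrite [RHS](big_nth 0%N) size_take blocks_size.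
  have -> : (if (m < p k.+1)%N then m else p k.+1) = m.
    by case: ltnP => // h; apply/eqP; rewrite eqn_leq mk h.
  apply: eq_big_nat => j /andP [_ jm]; rewrite nth_take // -block_permE //.
  exact: leq_trans mk.
have sk : p k.+1 = (p k + size i + size s)%N.
  by rewrite -addnA -size_cat -e -!blocks_size blocksS size_cat !blocks_size. 
have eL : L k.+1 = (L k ++ i) ++ s by rewrite blocksS e catA.
rewrite !hL ?sk -?addnA ?leq_addr //; last by rewrite leq_add2l leq_addr.
rewrite eL -(blocks_size k) -size_cat take_size_cat // -catA take_size_cat //.
by rewrite big_cat.
Qed.

End BlockPermutation.

Section UnconditionalCauchy.
Context {R : realType} {K : numFieldType} {re : K -> R} (sc : scalar_parts re).
Local Notation nm := (nm re).
Context {X : normedModType K}.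

(** Otherwise there are finite sets further and further out whose sums stay
    large; a permutation that lists each of them consecutively makes the
    rearranged series violate the Cauchy criterion. *)
Lemma unconditional_cauchy (u : nat -> X) : unconditionally_convergent u ->
  forall d, 0 < d -> exists n, forall M (A : pred nat),
    (forall i, A i -> (n <= i)%N) -> nm (\sum_(i < M | A i) u i) < d.
Proof.
move=> hu d d0; apply: contrapT => hn.
have H n : exists MA : nat * pred nat,
    (forall i, MA.2 i -> (n <= i)%N) /\ d <= nm (\sum_(i < MA.1 | MA.2 i) u i).
  apply: contrapT => hMA; apply: hn; exists n => M A hA.
  rewrite ltNge; apply/negP => hd; apply: hMA; by exists (M, A).
have [g hg] := choice H.
pose nxt n := maxn (g n).1 n.+1.
pose r n := iota n (nxt n - n).
pose Ab n := [seq i <- r n | (i < (g n).1)%N && (g n).2 i].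
pose blk n := Ab n ++ [seq i <- r n | ~~ ((i < (g n).1)%N && (g n).2 i)].
have nxt_gt n : (n < nxt n)%N by rewrite leq_maxr.
have blkP n : perm_eq (blk n) (iota n (nxt n - n)) by rewrite perm_filterC.
have := hu _ (block_perm_bij nxt_gt blkP).
move=> /cvg_ex [l /(cvg_nmP sc) /(_ (d / 2))] [|N hN]; first by rewrite divr_gt0.
pose k := N; set p := iter k nxt 0%N.
have pN : (N <= p)%N by exact: block_end_ge.
have := block_perm_sum nxt_gt blkP (k := k) u (erefl (blk p)).
rewrite -/p => e.
have h1 := hN p pN; have h2 := hN (p + size (Ab p))%N (leq_trans pN (leq_addr _ _)).
have [_] := hg p; rewrite leNgt => /negP; apply.
have -> : \sum_(i < (g p).1 | (g p).2 i) u i = \sum_(j <- Ab p) u j.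
  rewrite big_filter /r.
  have -> : \sum_(i < (g p).1 | (g p).2 i) u i =
      \sum_(i < nxt p | (i < (g p).1)%N && (g p).2 i) u i.
    rewrite (big_ord_widen_cond (nxt p) (fun i => (g p).2 i) u) ?leq_maxl //.
    by apply: eq_bigl => i; rewrite andbC.
  rewrite -(big_mkord (fun i => (i < (g p).1)%N && (g p).2 i)).
  rewrite (@big_cat_nat _ _ _ p) //=; last exact: ltnW.
  rewrite [X in X + _]big_nat_cond big1 ?add0r //.
  move=> i /andP [/andP [_ ip] /andP [_ /(proj1 (hg p))]].
  by rewrite leqNgt ip.
have := e; rewrite /series /= => /eqP; rewrite addrC -subr_eq => /eqP <-.
rewrite (splitr d); apply: le_lt_trans (nm_tri sc l _ _) _.
by rewrite ltrD // nmBC.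
Qed.

Lemma unconditional_bounded (u : nat -> X) : unconditionally_convergent u ->
  exists C, forall M (A : pred nat), nm (\sum_(i < M | A i) u i) <= C.
Proof.
move=> hu; have [n hn] := unconditional_cauchy hu (@ltr01 R).
exists (\sum_(i < n) nm (u i) + 1) => M A.
rewrite (bigID (fun i : 'I_M => (i < n)%N)) /=.
apply: le_trans (nmD sc _ _) _; apply: lerD.
  apply: le_trans (nm_sum sc _ _ _) _.
  apply: (@le_trans _ _ (\sum_(i < maxn M n | (i < n)%N) nm (u i))).
    rewrite (big_ord_widen_cond (maxn M n) (fun i => A i && (i < n)%N) (fun i => nm (u i)))
       ?leq_maxl //.
    rewrite big_mkcond [leRHS]big_mkcond /=; apply: ler_sum => i _.
    by case: (A i); case: (i < n)%N; case: (i < M)%N => //=; rewrite nm_ge0.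
  by rewrite -(big_ord_widen _ (fun i => nm (u i))) // leq_maxr.
apply: ltW; apply: (hn M (fun i => A i && ~~ (i < n)%N)).
by move=> i /andP [_]; rewrite -leqNgt.
Qed.

End UnconditionalCauchy.

(** * The unconditional basis constant *)

Section Baire.
Context {R : realType} {K : numFieldType} {re : K -> R} (sc : scalar_parts re).
Local Notation nm := (nm re).
Context {X : completeNormedModType K}.

Lemma nm_lim_le (u : nat -> X) l x c N : nm_lim re u l ->
  (forall n, (N <= n)%N -> nm (u n - x) <= c) -> nm (l - x) <= c.
Proof.
move=> ul h; apply/ler_addgt0Pl => e e0; have [M hM] := ul e e0.
apply: le_trans (nm_tri sc (u (maxn M N)) _ _) _; apply: lerD.
  by rewrite nmBC ltW // hM // leq_maxl.
by apply: h; rewrite leq_maxr.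
Qed.

(** The category theorem in the form of the open mapping argument.  If every
    ball contained a ball disjoint from F n, then nested balls would shrink to
    a point outside all the F n. *)
Lemma baire_dense_ball (F : nat -> set X) : (forall x, exists n, F n x) ->
  exists n x0 r, 0 < r /\ forall x, nm (x - x0) < r ->
    forall d : R, 0 < d -> exists2 y, F n y & nm (x - y) < d.
Proof.
move=> cov; apply: contrapT => hn.
have H (s : nat * (X * {posnum R})) : exists t : X * {posnum R},
    [/\ nm (t.1 - s.2.1) + t.2%:num <= s.2.2%:num, t.2%:num <= s.2.2%:num / 2 &
     forall y, F s.1 y -> t.2%:num < nm (y - t.1)].
  case: s => n [x0 r] /=; apply: contrapT => hs; apply: hn.
  exists n, x0, r%:num; split => // x xr d d0; apply: contrapT => hd; apply: hs.
  have r1 : 0 < Num.min d (r%:num - nm (x - x0)) / 2.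
    by rewrite divr_gt0 // lt_min d0 subr_gt0.
  have hm1 := ge_min d d (r%:num - nm (x - x0)).
  have hm2 := ge_min (r%:num - nm (x - x0)) d (r%:num - nm (x - x0)).
  rewrite lexx in hm1; rewrite lexx orbT in hm2.
  have nn := nm_ge0 sc (x - x0).
  exists (x, PosNum r1) => /=; split; [lra|lra|] => y Fy.
  have : d <= nm (y - x).
    by rewrite leNgt nmBC; apply/negP => hy; apply: hd; exists y.
  lra.
have [g hg] := choice H.
pose fix b n := if n is m.+1 then g (m, b m) else (0 : X, PosNum (@ltr01 R)).
have hb n : [/\ nm ((b n.+1).1 - (b n).1) + (b n.+1).2%:num <= (b n).2%:num,
  (b n.+1).2%:num <= (b n).2%:num / 2 &
     forall y, F n y -> (b n.+1).2%:num < nm (y - (b n.+1).1)] by exact: (hg (n, b n)).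
have hr n : (b n).2%:num <= 2^-1 ^+ n.
  elim: n => [|n IH]; first by rewrite expr0.
  by have [_ h _] := hb n; rewrite exprSr; apply: le_trans h _; rewrite ler_wpM2r.
have hd n k : nm ((b (n + k)%N).1 - (b n).1) + (b (n + k)%N).2%:num <= (b n).2%:num.
  elim: k => [|k IH]; first by rewrite addn0 subrr nm0 // add0r.
  have [h _ _] := hb (n + k)%N; rewrite addnS.
  have := nm_tri sc (b (n + k)%N).1 (b (n + k).+1).1 (b n).1; lra.
have hd' n m : (n <= m)%N -> nm ((b m).1 - (b n).1) <= (b n).2%:num.
  move=> /subnKC <-; have := hd n (m - n)%N.
  have : 0 <= (b (n + (m - n))%N).2%:num by [].
  lra.
have [|l hl] := nm_complete sc (u := fun n => (b n).1).
  move=> e e0; have [|N hN] := @exp2_small _ (e / 2); first by rewrite divr_gt0.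
  exists N => m n Nm Nn.
  have h1 := hd' _ _ Nm; have h2 := hd' _ _ Nn; have h3 := hr N; have h4 := hN N (leqnn N).
  have := nm_tri sc (b N).1 (b m).1 (b n).1; rewrite (nmBC (b N).1 (b n).1); lra.
have [n Fn] := cov l.
have [_ _ /(_ l Fn)] := hb n; rewrite ltNge => /negP; apply.
by apply: (nm_lim_le (N := n.+1) hl) => m nm1; exact: hd'.
Qed.

End Baire.

Lemma basis_dense (R : realType) (K : numFieldType) (re : K -> R)
    (sc : scalar_parts re) (X : normedModType K) (e : nat -> X) :
  schauder_basis e -> forall (x : X) d, 0 < d -> exists M (a : nat -> K),
   nm re (x - \sum_(i < M) a i *: e i) < d.
Proof.
move=> he x d d0; have [a [/(cvg_nmP sc) /(_ d d0) [N hN] _]] := he x.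
by exists N, a; have := hN N (leqnn N); rewrite /series /= big_mkord nmBC.
Qed.

Lemma basis_neq0 (R : realType) (K : numFieldType) (re : K -> R)
    (sc : scalar_parts re) (X : normedModType K) (e : nat -> X) :
  schauder_basis e -> forall i, e i != 0.
Proof.
move=> he i; apply/eqP => ei; have [a [_ au]] := he 0.
have h (b : nat -> K) : (forall j, b j *: e j = 0) -> a = b.
  move=> b0; apply: au; apply/(cvg_nmP sc) => d d0; exists 0%N => n _.
  by rewrite /series /= big1 ?subr0 ?nm0.
have a0 : a = fun=> 0 by apply: h => j; rewrite scale0r.
have a1 : a = fun j => (j == i)%:R.
  by apply: h => j; case: eqP => [->|_]; rewrite ?ei ?scaler0 ?scale0r.
by have := congr1 (@^~ i) a1; rewrite a0 eqxx => /esym/eqP; rewrite oner_eq0.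
Qed.

(** The coordinate functionals are not known to be continuous in advance.  As
    in the open mapping theorem, a set where all the partial sums are bounded by
    n is dense in some ball, and successive approximations remove the closure. *)
Section UnconditionalConstant.
Context {R : realType} {K : numFieldType} {re : K -> R} (sc : scalar_parts re).
Local Notation nm := (nm re).
Context {X : completeNormedModType K} (e : nat -> X).
Context (he : unconditional_basis e).

Let coord_ex : forall x : X, exists a : nat -> K, series (fun n => a n *: e n) @ \oo --> x.
Proof. by move=> x; have [a [h _]] := he.1 x; exists a. Qed.

Let coord := projT1 (choice coord_ex).
Let coordP x : series (fun n => coord x n *: e n) @ \oo --> x.
Proof. exact: (projT2 (choice coord_ex) x). Qed.

Let coord_uniq (x : X) (a : nat -> K) :
  nm_lim re (fun n => \sum_(i < n) a i *: e i) x -> a = coord x.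
Proof.
move=> ha; have [b [_ ub]] := he.1 x; rewrite -(ub a) ?(ub (coord x)) //.
apply/(cvg_nmP sc) => d d0; have [N hN] := ha d d0; exists N => n /hN.
by rewrite /series /= big_mkord.
Qed.

Let coord_lim x : nm_lim re (fun n => \sum_(i < n) coord x i *: e i) x.
Proof.
move=> d d0; have /(cvg_nmP sc)/(_ d d0) [N hN] := @coordP x; exists N => n /hN.
by rewrite /series /= big_mkord.
Qed.

Let psum (x : X) M (A : pred nat) := \sum_(i < M | A i) coord x i *: e i.

Let coord_lin (a : K) (x y : X) : coord (a *: x + y) = fun i => a * coord x i + coord y i.
Proof.
apply/esym/coord_uniq => d d0.
have d1 : 0 < d / 2 / (modulus re a + 1).
  by rewrite !divr_gt0 // ltr_wpDl // mod_ge0.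
have d2 : 0 < d / 2 by rewrite divr_gt0.
have [N1 h1] := coord_lim x d1; have [N2 h2] := coord_lim y d2.
exists (maxn N1 N2) => n; rewrite geq_max => /andP [/h1 k1 /h2 k2].
under eq_bigr => i _ do rewrite scalerDl -scalerA.
rewrite big_split /= -scaler_sumr opprD addrACA -scalerBr.
apply: le_lt_trans (nmD sc _ _) _; rewrite nmZ //.
move: k1; rewrite ltr_pdivlMr ?ltr_wpDl ?mod_ge0 // => k1.
have := nm_ge0 sc (\sum_(i < n) coord x i *: e i - x).
rewrite mulrDr mulr1 in k1; rewrite mulrC; lra.
Qed.

Let psum_lin (a : K) (x y : X) M A : psum (a *: x + y) M A = a *: psum x M A + psum y M A.
Proof.
rewrite /psum coord_lin scaler_sumr -big_split; apply: eq_bigr => i _ /=.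
by rewrite scalerDl scalerA.
Qed.

Let psum0 M A : psum 0 M A = 0.
Proof.
have := psum_lin (-1) 0 0 M A; rewrite scaler0 add0r scaleN1r addNr; exact.
Qed.

Let psumB x y M A : psum (x - y) M A = psum x M A - psum y M A.
Proof. by rewrite addrC -scaleN1r psum_lin scaleN1r addrC. Qed.

Let half_approximation : exists2 C, 0 <= C & forall x : X, exists z, nm (x - z) <= nm x / 2 /\
  forall M A, nm (psum z M A) <= C * nm x.
Proof.
pose F n := [set x : X | forall M A, nm (psum x M A) <= n%:R].
have [|n [x0 [r [r0 hr]]]] := baire_dense_ball sc (F := F).
  move=> x; have [C hC] := unconditional_bounded sc (he.2 _ _ (@coordP x)).
  exists (Num.truncn C).+1 => M A; apply: le_trans (hC M A) _.
  by rewrite ltW // truncnS_gt.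
have hr2 x : nm x < r -> forall d, 0 < d -> exists z,
    nm (x - z) < d /\ forall M A, nm (psum z M A) <= n%:R + n%:R.
  move=> xr d d0; have d2 : 0 < d / 2 by rewrite divr_gt0.
  have [|f Ff xf] := hr (x0 + x) _ _ d2; first by rewrite addrC addKr.
  have [|g Fg xg] := hr x0 _ _ d2; first by rewrite subrr nm0.
  exists (f - g); split.
    have -> : x - (f - g) = (x0 + x - f) - (x0 - g).
      rewrite [x0 + x]addrC -[x + x0 - f]addrA -[RHS]addrA; congr (x + _).
      by rewrite !opprB [x0 - f]addrC -addrA [x0 + _]addrC subrK addrC.
    by apply: le_lt_trans (nmB sc _ _) _; rewrite (splitr d) ltrD.
  by move=> M A; rewrite psumB; apply: le_trans (nmB sc _ _) _; rewrite lerD.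
exists (4 * n%:R / r); first by rewrite divr_ge0 ?mulr_ge0 // ltW.
move=> x; have [->|xn0] := eqVneq x 0.
  exists 0; rewrite subrr nm0 // mul0r; split=> // M A.
  by rewrite psum0 nm0 // mulr0.
have x0' := nm_gt0 sc xn0.
pose t := r / 2 / nm x.
have t0 : 0 < t by rewrite !divr_gt0.
have r4 : 0 < r / 4 by rewrite divr_gt0.
have [|z [xz hz]] := hr2 (ofr sc t *: x) _ _ r4; last first.
- exists (ofr sc t^-1 *: z); split.
    have -> : x - ofr sc t^-1 *: z = ofr sc t^-1 *: (ofr sc t *: x - z).
      by rewrite scalerBr scalerA -rmorphM mulVf ?gt_eqF // rmorph1 scale1r.
    rewrite nmZ // mod_ofr ger0_norm ?invr_ge0; last exact: ltW.
    rewrite ler_pdivrMl //; apply: le_trans (ltW xz) _.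
    rewrite /t (_ : _ / _ / _ * _ = r / 4) //; by field; rewrite !gt_eqF.
  move=> M A; have -> : psum (ofr sc t^-1 *: z) M A = ofr sc t^-1 *: psum z M A.
    by rewrite -[_ *: z]addr0 psum_lin psum0 addr0.
  rewrite nmZ // mod_ofr ger0_norm ?invr_ge0; last exact: ltW.
  rewrite ler_pdivrMl //; apply: le_trans (hz M A) _.
  rewrite /t (_ : _ / _ / _ * _ = n%:R + n%:R) //; by field; rewrite !gt_eqF.
- rewrite nmZ // mod_ofr ger0_norm ?(ltW t0) // divfK ?gt_eqF //.
  by rewrite ltr_pdivrMr // ltr_pMr // ltr1n.
Qed.

Lemma psum_bounded : exists2 C, 0 <= C &
  forall (x : X) M (A : pred nat), nm (psum x M A) <= C * nm x.
Proof.
have [C C0 hC] := half_approximation; have [zf hz] := choice hC.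
exists (2 * C); first by rewrite mulr_ge0.
move=> x; pose fix r k := if k is l.+1 then r l - zf (r l) else x.
have rk k : nm (r k) <= 2^-1 ^+ k * nm x.
  elim: k => [|k IH] /=; first by rewrite mul1r.
  have [h _] := hz (r k); apply: le_trans h _; rewrite exprS -mulrA mulrC.
  by rewrite ler_wpM2l // invr_ge0.
(* [w k] is the sum of the first k approximants; its coordinates converge, and
   the limits are the coordinates of x because expansions are unique. *)
pose w k := x - r k.
have wS k : w k.+1 = w k + zf (r k) by rewrite /w /= opprB addrA addrAC.
have hw k m M A : nm (psum (w (k + m)%N - w k) M A) <= 2 * C * 2^-1 ^+ k * nm x.
  suff : nm (psum (w (k + m)%N - w k) M A) <=
      2 * C * (2^-1 ^+ k - 2^-1 ^+ (k + m)) * nm x.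
    move=> h; apply: le_trans h _; rewrite ler_wpM2r ?nm_ge0 //.
    by rewrite ler_wpM2l ?mulr_ge0 // gerBl exprn_ge0 // invr_ge0.
  elim: m => [|m IH]; first by rewrite addn0 !subrr psum0 nm0 // mulr0 mul0r.
  rewrite addnS wS addrAC -[w _ - w k]scale1r psum_lin scale1r.
  apply: le_trans (nmD sc _ _) _; apply: le_trans (lerD IH (proj2 (hz _) M A)) _.
  have := rk (k + m)%N; rewrite [in X in _ -> X]exprS; move: (2^-1 ^+ (k + m)) => q hq.
  have : C * nm (r (k + m)%N) <= C * (q * nm x) by rewrite ler_wpM2l.
  move=> h; nra.
have hw' k l M A : (k <= l)%N -> nm (psum (w l - w k) M A) <= 2 * C * 2^-1 ^+ k * nm x.
  by move=> /subnKC <-.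
have small d : 0 < d -> exists N, forall k, (N <= k)%N -> (2 * C * 2^-1 ^+ k * nm x < d).
  move=> d0; have c0 : 0 < 2 * C * nm x + 1 by rewrite ltr_wpDl // !mulr_ge0 ?nm_ge0.
  have [|N hN] := @exp2_small _ (d / (2 * C * nm x + 1)); first by rewrite divr_gt0.
  exists N => k /hN; rewrite ltr_pdivlMr //; have : 0 < 2^-1 ^+ k :> R by rewrite exprn_gt0.
  nra.
have e0 := basis_neq0 sc he.1.
have one i k l : (k <= l)%N ->
    modulus re (coord (w l) i - coord (w k) i) * nm (e i) <= 2 * C * 2^-1 ^+ k * nm x.
  move=> kl; have := hw' k l i.+1 (pred1 i) kl.
  rewrite /psum (big_pred1 ord_max) /=; last by move=> j; rewrite /= -val_eqE.
  rewrite nmZ //; congr (_ * _ <= _); congr (modulus re).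
  have := coord_lin (-1) (w k) (w l); rewrite scaleN1r addrC => ->.
  by rewrite mulN1r addrC.
have acvg i : exists a, forall d, 0 < d -> exists N, forall n, (N <= n)%N ->
    modulus re (coord (w n) i - a) < d.
  apply: (mod_complete sc) => d d0; have ne := nm_gt0 sc (e0 i).
  have [|N hN] := small (d / 2 * nm (e i)); first by rewrite mulr_gt0 // divr_gt0.
  exists N => m n Nm Nn.
  have h1 := le_lt_trans (one i _ _ Nm) (hN N (leqnn N)).
  have h2 := le_lt_trans (one i _ _ Nn) (hN N (leqnn N)).
  rewrite !ltr_pM2r // in h1 h2.
  rewrite -(subrKA (coord (w N) i)) (splitr d).
  apply: le_lt_trans (modD sc _ _) _; apply: ltrD => //.
  by rewrite -modN opprB.
have [a ha] := choice acvg.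
have plim M (A : pred nat) (d : R) : 0 < d -> exists N, forall n, (N <= n)%N ->
    nm (\sum_(i < M | A i) a i *: e i - psum (w n) M A) < d.
  move=> d0; pose c := \sum_(i < M) nm (e i) + 1.
  have s0 : 0 <= \sum_(i < M) nm (e i) by apply: sumr_ge0 => i _; exact: nm_ge0.
  have c0 : 0 < c by rewrite ltr_wpDl.
  have dc : 0 < d / c by rewrite divr_gt0.
  have [Nf hNf] := choice (fun i => ha i _ dc).
  exists (\max_(i < M) Nf i) => n hn.
  rewrite -sumrB; apply: le_lt_trans (nm_sum sc _ _ _) _.
  apply: (@le_lt_trans _ _ (\sum_(i < M) d / c * nm (e i))).
    rewrite big_mkcond /=; apply: ler_sum => i _; case: ifP => _; last first.
      by rewrite mulr_ge0 ?nm_ge0 // ltW.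
    rewrite -scalerBl nmZ // ler_wpM2r ?nm_ge0 // -modN opprB ltW //.
    by apply: hNf; apply: leq_trans hn; exact: leq_bigmax.
  rewrite -mulr_sumr mulrAC ltr_pdivrMr // ltr_pM2l // /c; lra.
have tail k M (A : pred nat) : nm (\sum_(i < M | A i) a i *: e i - psum (w k) M A) <=
    2 * C * 2^-1 ^+ k * nm x.
  apply/ler_addgt0Pl => d d0; have [N hN] := plim M A d d0.
  have h1 := hN _ (leq_maxl N k); have h2 := hw' k _ M A (leq_maxr N k).
  rewrite psumB in h2.
  by apply: le_trans (nm_tri sc (psum (w (maxn N k)) M A) _ _) _; apply: lerD => //; exact: ltW.
have : a = coord x.
  apply: coord_uniq => d d0; have d3 : 0 < d / 3 by rewrite divr_gt0.
  have [N1 h1] := small _ d3.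
  have nx : 0 < nm x + 1 by rewrite ltr_wpDl // nm_ge0.
  have [|N2 h2] := @exp2_small _ (d / 3 / (nm x + 1)); first by rewrite divr_gt0.
  pose k := maxn N1 N2.
  have [N3 h3] := coord_lim (w k) d3.
  exists N3 => n /h3 h4.
  have h5 := tail k n xpredT; have h6 := h1 k (leq_maxl _ _).
  have h7 : nm (w k - x) < d / 3.
    rewrite /w addrAC subrr add0r nmN; apply: le_lt_trans (rk k) _.
    have := h2 k (leq_maxr _ _); rewrite ltr_pdivlMr //.
    have : 0 < 2^-1 ^+ k :> R by rewrite exprn_gt0.
    nra.
  have := nm_tri sc (psum (w k) n xpredT) (\sum_(i < n) a i *: e i) x.
  have := nm_tri sc (w k) (psum (w k) n xpredT) x.
  rewrite /psum in h5 *; lra.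
move=> ax M A; have := tail 0%N M A; rewrite /w /= subrr psum0 subr0 ax mulr1.
exact.
Qed.

Lemma suppression_constant : exists2 C, 0 <= C & forall M (A : pred nat) (a : nat -> K),
  nm (\sum_(i < M | A i) a i *: e i) <= C * nm (\sum_(i < M) a i *: e i).
Proof.
have [C C0 hC] := psum_bounded; exists C => // M A a.
set x := \sum_(i < M) _; have : (fun i => if (i < M)%N then a i else 0) = coord x.
  apply: coord_uniq => d d0; exists M => n Mn.
  rewrite (_ : \sum_(i < n) _ = x) ?subrr ?nm0 // /x.
  rewrite (big_ord_widen n (fun i => a i *: e i)) // [RHS]big_mkcond /=.
  by apply: eq_bigr => i _; case: ifP => // _; rewrite scale0r.
move=> cx; have := hC x M A; rewrite /psum -cx.
by under eq_bigr => i _ do rewrite ltn_ord.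
Qed.

End UnconditionalConstant.

(** * Coefficientwise domination *)

Section LatticeEstimate.
Context {R : realType} {K : numFieldType} {re : K -> R} (sc : scalar_parts re).
Local Notation nm := (nm re).
Local Notation modulus := (modulus re).
Context {X : normedModType K} (e : nat -> X).

(** A space with an unconditional basis is a Banach lattice for the coefficientwise
    order, up to this constant. *)
Definition lattice_const (C : R) := forall M (a b : nat -> K),
  (forall i, (i < M)%N -> modulus (b i) <= modulus (a i)) ->
  nm (\sum_(i < M) b i *: e i) <= C * nm (\sum_(i < M) a i *: e i).

Context (C : R).
Context (hC : forall M (A : pred nat) (a : nat -> K),
  nm (\sum_(i < M | A i) a i *: e i) <= C * nm (\sum_(i < M) a i *: e i)).

Definition wsum M (a : nat -> K) (c : nat -> R) : X :=
  \sum_(i < M) (ofr sc (c i) * a i) *: e i.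

Lemma wsumD M a (c d : nat -> R) : wsum M a (fun i => c i + d i) = wsum M a c + wsum M a d.
Proof.
by rewrite -big_split; apply: eq_bigr => i _; rewrite rmorphD mulrDl scalerDl.
Qed.

Lemma wsumZ M a r (c : nat -> R) : wsum M a (fun i => r * c i) = ofr sc r *: wsum M a c.
Proof.
by rewrite /wsum scaler_sumr; apply: eq_bigr => i _; rewrite rmorphM -mulrA scalerA.
Qed.

Lemma eq_wsum M a (c d : nat -> R) : (forall i, (i < M)%N -> c i = d i) -> wsum M a c = wsum M a d.
Proof. by move=> h; apply: eq_bigr => i _; rewrite h. Qed.

Lemma wsum1 M a : wsum M a (fun=> 1) = \sum_(i < M) a i *: e i.
Proof. by apply: eq_bigr => i _; rewrite rmorph1 mul1r. Qed.

Lemma wsum_sum M a (I : finType) (c : I -> nat -> R) (P : pred I) :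
  \sum_(k | P k) wsum M a (c k) = wsum M a (fun i => \sum_(k | P k) c k i).
Proof.
rewrite exchange_big; apply: eq_bigr => i _ /=.
by rewrite rmorph_sum mulr_suml scaler_suml.
Qed.

(** The norm is convex in each weight separately, so it is largest when all the
    weights are 0 or 1; the weights are replaced one at a time. *)
Lemma wsum01 M a (c : nat -> R) : (forall i, 0 <= c i <= 1) ->
  nm (wsum M a c) <= C * nm (\sum_(i < M) a i *: e i).
Proof.
move=> c01.
suff H m (d : nat -> R) : (forall i, 0 <= d i <= 1) ->
    (forall i, (m <= i)%N -> d i = 0 \/ d i = 1) ->
    nm (wsum M a d) <= C * nm (\sum_(i < M) a i *: e i).
  rewrite (@eq_wsum _ _ _ (fun i => if (i < M)%N then c i else 0)); last by move=> i ->.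
  apply: (H M) => i; first by case: ifP => // _; rewrite lexx ler01.
  by rewrite leqNgt => /negbTE ->; left.
elim: m d => [|m IH] d d01 dm.
  rewrite (_ : wsum M a d = \sum_(i < M | d i == 1) a i *: e i).
    exact: (hC M (fun i => d i == 1)).
  rewrite big_mkcond; apply: eq_bigr => i _.
  by case: (dm i isT) => ->; rewrite ?eqxx ?rmorph1 ?mul1r // eq_sym oner_eq0 rmorph0 mul0r scale0r.
pose dd (x : R) i := if i == m then x else d i.
have ddP x : 0 <= x <= 1 -> x = 0 \/ x = 1 ->
    nm (wsum M a (dd x)) <= C * nm (\sum_(i < M) a i *: e i).
  move=> x01 x2; apply: IH => i; rewrite /dd; case: eqP => // im mi.
  by apply: dm; rewrite ltn_neqAle mi andbT eq_sym; apply/eqP.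
have -> : wsum M a d = ofr sc (d m) *: wsum M a (dd 1) + ofr sc (1 - d m) *: wsum M a (dd 0).
  rewrite -!wsumZ -wsumD; apply: eq_wsum => i _; rewrite /dd.
  by case: eqP => [->|_]; ring.
have /andP [d0 d1] := d01 m.
apply: le_trans (nmD sc _ _) _; rewrite !nmZ // !mod_ofr !ger0_norm ?subr_ge0 //.
have h1 := ddP 1; have h0 := ddP 0; rewrite !lexx ler01 in h1 h0.
have := ler_wpM2l d0 (h1 isT (or_intror erefl)).
have d1' : 0 <= 1 - d m by rewrite subr_ge0.
have := ler_wpM2l d1' (h0 isT (or_introl erefl)).
lra.
Qed.

Lemma wsum_norm1 M a (c : nat -> R) : (forall i, `|c i| <= 1) ->
  nm (wsum M a c) <= 2 * C * nm (\sum_(i < M) a i *: e i).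
Proof.
move=> c1; pose p i := Num.max (c i) 0; pose n i := Num.max (- c i) 0.
have -> : wsum M a c = wsum M a p - wsum M a n.
  rewrite -[- _]scaleN1r -(rmorph1 (ofr sc)) -rmorphN -wsumZ -wsumD.
  apply: eq_wsum => i _; rewrite /p /n; case: (leP (c i)) => h.
    by rewrite max_l ?oppr_ge0 //; ring.
  by rewrite max_r ?oppr_le0 ?ltW //; ring.
apply: le_trans (nmB sc _ _) _; rewrite -mulrA mulr_natl mulr2n.
apply: lerD; apply: wsum01 => i; have := c1 i; rewrite ler_norml => /andP [h1 h2].
  by rewrite /p le_max lexx orbT ge_max h2 ler01.
by rewrite /n le_max lexx orbT ge_max ler01 andbT lerNl.
Qed.

Lemma lattice_constP : lattice_const (4 * C).
Proof.
move=> M a b ab; pose l i := if (i < M)%N then b i / a i else 0.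
have l1 i : modulus (l i) <= 1.
  rewrite /l; case: ifP => [iM|_]; last by rewrite mod0.
  rewrite (modM sc) (modV sc).
  have [a0|a0] := eqVneq (a i) 0.
    have := ab i iM; rewrite a0 mod0 // => h.
    by rewrite invr0 mulr0.
  rewrite ler_pdivrMr ?mul1r ?ab // lt_neqAle mod_ge0 // andbT eq_sym.
  by apply: contra a0 => /eqP/(mod_eq0 sc) ->.
have -> : \sum_(i < M) b i *: e i =
   wsum M a (fun i => re (l i)) + iunit sc *: wsum M a (fun i => im sc (l i)).
  rewrite scaler_sumr -big_split; apply: eq_bigr => i _ /=.
  rewrite scalerA -scalerDl mulrA -mulrDl -(partsE sc) /l ltn_ord.
  have [a0|a0] := eqVneq (a i) 0; last by rewrite divfK.
  have := ab i (ltn_ord i); rewrite a0 mod0 // => h.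
  by rewrite mulr0 (mod_eq0 sc (a := b i)) //; apply/eqP; rewrite eq_le h mod_ge0.
apply: le_trans (nmD sc _ _) _; rewrite nmZ //.
have h1 : nm (wsum M a (fun i => re (l i))) <= 2 * C * nm (\sum_(i < M) a i *: e i).
  by apply: wsum_norm1 => i; apply: le_trans (l1 i); exact: re_le_mod.
have h2 : nm (wsum M a (fun i => im sc (l i))) <= 2 * C * nm (\sum_(i < M) a i *: e i).
  by apply: wsum_norm1 => i; apply: le_trans (l1 i); exact: im_le_mod.
have := ler_wpM2r (nm_ge0 sc (wsum M a (fun i => im sc (l i)))) (mod_iunit sc).
lra.
Qed.

End LatticeEstimate.

Lemma unconditional_lattice (R : realType) (K : numFieldType) (re : K -> R)
    (sc : scalar_parts re) (X : completeNormedModType K) (e : nat -> X) :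
  unconditional_basis e -> exists2 C, 1 <= C & lattice_const (re := re) e C.
Proof.
move=> he; have [C C0 hC] := suppression_constant sc he.
exists (4 * C + 1) => [|M a b ab]; first by rewrite lerDr mulr_ge0.
apply: le_trans (lattice_constP sc hC ab) _.
by rewrite ler_wpM2r ?nm_ge0 // lerDl.
Qed.

(** * Cotype and Rademacher multipliers *)

Section Cotype.
Context {R : realType} {K : numFieldType} {re : K -> R} (sc : scalar_parts re).
Local Notation nm := (nm re).
Local Notation modulus := (modulus re).
Context {X : normedModType K} (e : nat -> X) (Cu q Cq : R).
Context (Cu1 : 1 <= Cu) (hU : lattice_const (re := re) e Cu).
Context (q2 : 2 <= q) (hq : forall (n : nat) (x : 'I_n -> X),
    (\sum_(i < n) (nm (x i)) `^ q) `^ q^-1 <= Cq * L1norm re (rsum x)).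

Local Notation V := (wsum sc e).

Lemma wsum_mono M a (c d : nat -> R) : (forall i, (i < M)%N -> `|c i| <= `|d i|) ->
  nm (V M a c) <= Cu * nm (V M a d).
Proof.
move=> cd; rewrite /wsum; apply: (hU (b := fun i => ofr sc (c i) * a i)
  (a := fun i => ofr sc (d i) * a i)) => i iM; rewrite !(modM sc) !mod_ofr.
by rewrite ler_wpM2r ?mod_ge0 ?cd.
Qed.

Lemma sgn_ofr N k n : sgn K N k n = ofr sc (sgn R N k n).
Proof. by rewrite /sgn rmorphXn rmorphN1. Qed.

Lemma norm_sgn N k n : `|sgn R N k n| = 1.
Proof. by rewrite /sgn normrX normrN1 expr1n. Qed.

Let q0 : 0 < q. Proof. exact: lt_le_trans q2. Qed.
Let Cu0 : 0 < Cu. Proof. exact: lt_le_trans Cu1. Qed.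

Let C1 := `|Cq| * Cu + 1.

Let C1_gt0 : 0 < C1.
Proof. by rewrite /C1 ltr_wpDl // mulr_ge0 ?normr_ge0 // (le_trans ler01). Qed.

(** Cotype gives a lower q-estimate for disjointly supported vectors, because
    changing signs of disjoint pieces is a bounded coefficient multiplier. *)
Lemma lower_estimate M m a (D : 'I_m -> nat -> bool) :
  (forall i j j', D j i -> D j' i -> j = j') ->
  \sum_(j < m) (nm (V M a (fun i => (D j i)%:R))) `^ q <= (C1 * nm (V M a (fun=> 1))) `^ q.
Proof.
move=> disj; set b := fun j : 'I_m => V M a (fun i => (D j i)%:R).
set T := nm (V M a _) in |- *.
have s0 : 0 <= \sum_(j < m) (nm (b j)) `^ q by apply: sumr_ge0 => j _; exact: powR_ge0.
have T0 : 0 <= nm (V M a (fun=> 1)) by exact: nm_ge0.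
have L : L1norm re (rsum b) <= Cu * nm (V M a (fun=> 1)).
  rewrite L1norm_rsum -[leRHS](avg_cst m); apply: le_avg => k.
  under eq_bigr => j _ do rewrite sgn_ofr -wsumZ.
  rewrite wsum_sum; apply: wsum_mono => i _; rewrite normr1.
  case: (pickP (fun j => D j i)) => [j0 Dj0|D0].
    rewrite (bigD1 j0) //= big1 ?addr0 ?Dj0 ?mulr1 ?norm_sgn //.
    move=> j jj0; case Dj : (D j i); last by rewrite mulr0.
    by rewrite (disj i j j0) ?eqxx // in jj0.
  rewrite big1 ?normr0 ?ler01 // => j _; by rewrite D0 mulr0.
have -> : \sum_(j < m) (nm (b j)) `^ q = ((\sum_(j < m) (nm (b j)) `^ q) `^ q^-1) `^ q.
  by rewrite -powRrM mulVf ?gt_eqF // powRr1.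
apply: ge0_ler_powR; rewrite ?nnegrE ?powR_ge0 ?mulr_ge0 ?(ltW C1_gt0) ?(ltW q0) //.
apply: le_trans (hq b) _; apply: (@le_trans _ _ (`|Cq| * (Cu * nm (V M a (fun=> 1))))).
  apply: (@le_trans _ _ (`|Cq| * L1norm re (rsum b))).
    by rewrite ler_wpM2r ?ler_norm // L1norm_rsum avg_ge0 // => k; exact: nm_ge0.
  by rewrite ler_wpM2l.
by rewrite /C1 mulrDl mul1r mulrA lerDl.
Qed.

Lemma bernoulli_inequality (x : R) n : 0 <= x -> x <= 1 -> 1 - n%:R * x <= (1 - x) ^+ n.
Proof.
move=> x0 x1; elim: n => [|n IH]; first by rewrite mul0r subr0 expr0.
rewrite exprS -natr1; have : 0 <= n%:R * x * x by rewrite !mulr_ge0.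
have x1' : 0 <= 1 - x by lra.
have := ler_wpM2l x1' IH; lra.
Qed.

(** Restricting to a random set A(t) that contains each index with probability at
    most 1/(2m) divides the mean norm by m^(1/q).  Take m independent copies
    A(w_1), ..., A(w_m) and remove from each the union of the others.  The
    remaining sets are disjoint, so the lower q-estimate controls them
    together; and by the union bound an index of A(w_j) survives with
    probability at least 1/2, so by convexity the mean norm on each of them is
    at least a fixed fraction of the mean norm on A(t).  The number of copies is
    m.+1 below, and r stands for m^(1/q). *)
Lemma sparse_restriction M m a (r : R) (T : finType) (A : nat -> T -> bool) :
  0 < r -> r `^ q <= m.+1%:R ->
  (forall i, (i < M)%N -> 2 * m.+1%:R * \sum_t (A i t)%:R <= #|T|%:R :> R) ->
  \sum_t nm (V M a (fun i => (A i t)%:R)) <=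
    4 * Cu * C1 / r * #|T|%:R * nm (V M a (fun=> 1)).
Proof.
move=> r0 rq hA; set B := nm (V M a (fun=> 1)).
have B0 : 0 <= B by exact: nm_ge0.
have hmono (c : nat -> bool) : nm (V M a (fun i => (c i)%:R)) <= Cu * B.
  by apply: wsum_mono => i _; rewrite normr1; case: (c i); rewrite ?normr1 ?normr0.
have [Bz|Bn] := eqVneq B 0.
  rewrite Bz mulr0 big1 // => t _; apply/eqP; rewrite eq_le nm_ge0 // andbT.
  by have := hmono (fun i => A i t); rewrite Bz mulr0.
have Bp : 0 < B by rewrite lt_neqAle eq_sym Bn.
pose s := C1 * B / r.
have s0 : 0 < s by rewrite divr_gt0 // mulr_gt0.
pose W := {ffun 'I_m.+1 -> T}.
pose D (w : W) (j : 'I_m.+1) i := A i (w j) && [forall l, (l != j) ==> ~~ A i (w l)].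
have up (w : W) : \sum_j nm (V M a (fun i => (D w j i)%:R)) <= 2 * m.+1%:R * s.
  have disj i j j' : D w j i -> D w j' i -> j = j'.
    move=> /andP [Aj _] /andP [_ /forallP /(_ j)].
    by rewrite Aj implybF negbK => /eqP.
  have h := lower_estimate M a disj; rewrite -/B in h.
  (* With t <= s + s (t/s)^q, a bound on the sum of the q-th powers yields one
     on the sum of the norms. *)
  apply: (@le_trans _ _ (\sum_(j < m.+1) (s + s * (s^-1 * nm (V M a (fun i => (D w j i)%:R))) `^ q))).
    apply: ler_sum => j _; set t := nm _; have t0 : 0 <= t by exact: nm_ge0.
    have [ts|ts] := leP t s.
      by rewrite (le_trans ts) // lerDl mulr_ge0 ?powR_ge0 // ltW.
    apply: (@le_trans _ _ (s * (s^-1 * t))); first by rewrite mulrA mulfV ?gt_eqF // mul1r.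
    apply: le_trans (_ : s * (s^-1 * t) `^ q <= _); last by rewrite lerDr ltW.
    rewrite ler_pM2l //.
    have s1 : 1 <= s^-1 * t by rewrite ler_pdivlMl // mulr1 ltW.
    rewrite -[leLHS](powRr1 (le_trans ler01 s1)).
    by apply: ler_powR => //; apply: le_trans q2; rewrite ler1n.
  rewrite big_split /= sumr_const card_ord -mulr_sumr.
  have -> : s *+ m.+1 = m.+1%:R * s by rewrite -[LHS]mulr_natl.
  have : \sum_(j < m.+1) (s^-1 * nm (V M a (fun i => (D w j i)%:R))) `^ q <= m.+1%:R.
    apply: le_trans rq.
    under eq_bigr => j _ do rewrite powRM ?nm_ge0 ?invr_ge0 ?(ltW s0) //.
    rewrite -mulr_sumr.
    apply: le_trans (ler_wpM2l (powR_ge0 _ _) h) _.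
    rewrite -powRM ?invr_ge0 ?(ltW s0) ?mulr_ge0 ?(ltW C1_gt0) ?(ltW Cu0) ?(ltW r0) //.
    rewrite (_ : s^-1 * (C1 * B) = r) // /s; field.
    by rewrite !gt_eqF.
  move/(ler_wpM2l (ltW s0)); lra.
pose N : R := #|T|%:R.
have [T0|T0] := posnP #|T|.
  rewrite big_pred0 ?mulr_ge0 ?invr_ge0 ?ler0n ?(ltW C1_gt0) ?(ltW Cu0) ?(ltW r0) //.
  by move=> t; have := fintype0 t T0.
have N0 : 0 < N by rewrite ltr0n.
have count i (j : 'I_m.+1) t : (i < M)%N -> A i t ->
    N ^+ m / 2 <= \sum_(w : W | w j == t) (D w j i)%:R.
  move=> iM Ait; pose F (l : 'I_m.+1) t' : R := if l == j then (t' == t)%:R else (~~ A i t')%:R.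
  have -> : \sum_(w : W | w j == t) (D w j i)%:R = \prod_l \sum_t' F l t'.
    rewrite bigA_distr_bigA /= big_mkcond; apply: eq_bigr => w _.
    rewrite (bigD1 j) //= {1}/F eqxx; case: eqP => [wj|_]; last by rewrite mul0r.
    rewrite mul1r /D wj Ait /=; case: forallP => h.
      rewrite big1 // => l lj; rewrite /F (negbTE lj).
      by have := h l; rewrite lj /= => ->.
    have /existsP [l] : [exists l, ~~ ((l != j) ==> ~~ A i (w l))].
      by rewrite -negb_forall; apply/forallP.
    rewrite negb_imply negbK => /andP [lj Al].
    by rewrite (bigD1 l) //= /F (negbTE lj) Al mul0r.
  rewrite (bigD1 j) //= {1}/F eqxx (bigD1 t) //= eqxx big1 ?addr0 ?mul1r; last first.
    by move=> t' /negbTE ->.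
  pose x := (\sum_t (A i t)%:R) / N.
  have hx : 2 * m.+1%:R * x <= 1 by rewrite mulrA ler_pdivrMr // mul1r hA.
  have x0 : 0 <= x by rewrite divr_ge0 ?sumr_ge0 // ltW.
  have x1 : x <= 1.
    have : 0 <= m%:R * x by rewrite mulr_ge0.
    rewrite -natr1 in hx; lra.
  have -> : \prod_(l < m.+1 | l != j) \sum_t' F l t' = (N * (1 - x)) ^+ m.
    rewrite (eq_bigr (fun=> N * (1 - x))); last first.
      move=> l lj; rewrite /F (negbTE lj) mulrBr mulr1 /x mulrCA mulfV ?gt_eqF // mulr1.
      rewrite /N -sum1_card natr_sum -sumrB; apply: eq_bigr => t' _.
      by case: (A i t'); rewrite ?subrr ?subr0.
    rewrite prodr_const; congr (_ ^+ _).
    have h := cardC1 j; rewrite card_ord /= in h; rewrite -[RHS]h.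
    by apply: eq_card => l; rewrite !inE.
  rewrite exprMn ler_pM2l ?exprn_gt0 //.
  apply: le_trans (bernoulli_inequality m x0 x1); rewrite -natr1 in hx.
  lra.
(* Average over all the copies but the j-th; the weights become
   P(i survives) times the indicator of A(w_j). *)
have low (j : 'I_m.+1) : N ^+ m / 2 * \sum_t nm (V M a (fun i => (A i t)%:R)) <=
    Cu * \sum_(w : W) nm (V M a (fun i => (D w j i)%:R)).
  rewrite (partition_big (fun w : W => w j) xpredT) //= !mulr_sumr.
  apply: ler_sum => t _.
  apply: (@le_trans _ _ (Cu * nm (\sum_(w : W | w j == t) V M a (fun i => (D w j i)%:R)))); last first.
    by rewrite ler_wpM2l ?(ltW Cu0) // nm_sum.
  rewrite wsum_sum.
  have -> : N ^+ m / 2 * nm (V M a (fun i => (A i t)%:R)) =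
     nm (V M a (fun i => N ^+ m / 2 * (A i t)%:R)).
    by rewrite wsumZ nmZ // mod_ofr ger0_norm // divr_ge0 // exprn_ge0 // ltW.
  apply: wsum_mono => i iM.
  have p0 : 0 <= N ^+ m / 2 by rewrite divr_ge0 // exprn_ge0 // ltW.
  rewrite !ger0_norm ?mulr_ge0 ?sumr_ge0 ?exprn_ge0 ?(ltW N0) //.
  case Ait : (A i t); last by rewrite mulr0 sumr_ge0.
  by rewrite mulr1 count.
pose S := \sum_t nm (V M a (fun i => (A i t)%:R)).
rewrite -/S in low *; have : \sum_(j < m.+1) (N ^+ m / 2 * S) <=
    \sum_(j < m.+1) (Cu * \sum_(w : W) nm (V M a (fun i => (D w j i)%:R))).
  by apply: ler_sum => j _; exact: low.
rewrite sumr_const card_ord -mulr_sumr exchange_big /= => h1.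
have h2 : \sum_(w : W) \sum_(j < m.+1) nm (V M a (fun i => (D w j i)%:R)) <=
   N ^+ m.+1 * (2 * m.+1%:R * s).
  apply: le_trans (ler_sum _ (fun w _ => up w)) _.
  by rewrite sumr_const card_ffun card_ord -[leLHS]mulr_natl natrX.
have := le_trans h1 (ler_wpM2l (ltW Cu0) h2).
rewrite -[leLHS]mulr_natl => h3.
have P0 : 0 < m.+1%:R * N ^+ m / 2 by rewrite divr_gt0 // mulr_gt0 // exprn_gt0.
rewrite -(ler_pM2l P0); apply: le_trans (_ : _ <= Cu * (N ^+ m.+1 * (2 * m.+1%:R * s))) _.
  by apply: le_trans h3; rewrite !mulrA.
rewrite /s exprS -/N le_eqVlt; apply/orP; left; apply/eqP; field.
by rewrite gt_eqF.
Qed.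

Lemma dyadic_layers (L y : R) N : 0 <= y -> y <= L * 2 ^+ N ->
  y <= L * (1 + \sum_(l < N) 2 ^+ l * ((L * 2 ^+ l <= y)%R : nat)%:R).
Proof.
move=> y0 yN; have L0 : 0 <= L.
  by have := le_trans y0 yN; rewrite pmulr_lge0 // exprn_gt0.
elim: N yN => [|N IH] yN; first by rewrite big_ord0 addr0; move: yN; rewrite expr0.
have [yl|yl] := leP y (L * 2 ^+ N).
  apply: le_trans (IH yl) _; rewrite ler_wpM2l // lerD2l big_ord_recr /= lerDl.
  by rewrite mulr_ge0 // exprn_ge0.
apply: le_trans yN _; rewrite ler_wpM2l //.
rewrite (eq_bigr (fun l : 'I_N.+1 => 2 ^+ l : R)); last first.
  move=> l _; rewrite (_ : (L * 2 ^+ l <= y)%R = true) ?mulr1 //.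
  apply: le_trans (ltW yl); rewrite ler_wpM2l // ler_weXn2l ?ler1n //.
  by rewrite -ltnS.
elim: N.+1 => [|n {}IH]; first by rewrite big_ord0 addr0 expr0.
rewrite big_ord_recr /= addrA exprS; lra.
Qed.

(** Multiplying the i-th coefficient by a normalized Rademacher sum v_i, without
    any relation between the different v_i, is bounded on average.  This is
    where cotype is indispensable: in c_0 it fails, since the supremum of
    many independent v_i is unbounded.  Cut |v_i| into the dyadic layers
    {|v_i| >= L 2^l}.  The l-th layer has probability O(4^(-pl)) for
    every integer p; if p >= q, then [sparse_restriction] gains a factor 4^l, which
    beats the height 2^l. *)
Lemma real_multiplier_bound : exists2 C2, 0 <= C2 &
  forall M N (a : nat -> K) (c : nat -> nat -> R),
  (forall i, (i < M)%N -> \sum_(n < N) c i n ^+ 2 <= 1 / 2) ->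
  avg N (fun k => nm (V M a (fun i => rads N (c i) k))) <= C2 * nm (V M a (fun=> 1)).
Proof.
pose p := (Num.truncn q).+1; have qp : q <= p%:R by rewrite ltW // truncnS_gt.
(* This scale makes the tail bound at most 4^(-pl) / 2 for every l. *)
pose L : R := 16 * (2 * p)`!%:R.
have f1 : 1 <= (2 * p)`!%:R :> R by rewrite ler1n fact_gt0.
have L1 : 1 <= L by rewrite /L; lra.
have L0 : 0 <= L by apply: le_trans L1.
have Cu0' := Cu0; have C1_gt0' := C1_gt0.
exists (Cu * L * (1 + 8 * Cu * C1)).
  by rewrite !mulr_ge0 ?addr_ge0 ?mulr_ge0 ?(ltW Cu0) ?(ltW C1_gt0).
move=> M N a c hc; set B := nm (V M a (fun=> 1)).
have B0 : 0 <= B by exact: nm_ge0.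
pose A l i (k : nat) := (L * 2 ^+ l <= `|rads N (c i) k|)%R.
have c1 i k : (i < M)%N -> `|rads N (c i) k| <= L * 2 ^+ N.
  move=> iM; apply: (@le_trans _ _ N%:R); last first.
    apply: (@le_trans _ _ (2 ^+ N)); first by rewrite -natrX ler_nat ltnW // ltn_expl.
    by rewrite ler_peMl // exprn_ge0.
  apply: le_trans (ler_norm_sum _ _ _) _.
  rewrite -[N in N%:R]card_ord -sum1_card natr_sum; apply: ler_sum => n _.
  rewrite normrM norm_sgn mul1r -(@ler_pXn2r _ 2) // ?nnegrE // expr1n real_normK ?num_real //.
  apply: le_trans (_ : _ <= \sum_(n < N) c i n ^+ 2) _.
    by rewrite (bigD1 n) //= lerDl sumr_ge0 // => j _; exact: sqr_ge0.
  by apply: le_trans (hc i iM) _; lra.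
have avg_layer l : avg N (fun k => nm (V M a (fun i => (A l i k)%:R))) <=
    4 * Cu * C1 / 4 ^+ l * B.
  pose m := (4 ^ (p * l)).-1.
  have mE : m.+1 = (4 ^ (p * l))%N by rewrite prednK // expn_gt0.
  have r0 : 0 < 4 ^+ l :> R by rewrite exprn_gt0.
  have := @sparse_restriction M m a (4 ^+ l) 'I_(2 ^ N) (fun i k => A l i k) r0.
  rewrite card_ord -/B => H.
  have four : (2 ^+ l) ^+ (2 * p) = 4 ^+ (p * l) :> R.
    by rewrite -exprM mulnC -mulnA exprM (_ : 2 ^+ 2 = 4) //; ring.
  rewrite /avg ler_pdivrMl ?exprn_gt0 //.
  apply: le_trans (H _ _) _; last 1 first.
  - by rewrite natrX le_eqVlt; apply/orP; left; apply/eqP; ring.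
  - rewrite mE natrX mulnC exprM -[leRHS]powR_mulrn ?(ltW r0) //.
    by apply: ler_powR => //; rewrite exprn_ege1 // ler1n.
  - move=> i iM; have y0 : 0 < L * 2 ^+ l by rewrite mulr_gt0 ?exprn_gt0 // (lt_le_trans _ L1).
    have := rads_tail (2 * p) (hc i iM) y0; rewrite /avg ler_pdivrMl ?exprn_gt0 //.
    rewrite exprMn four => h.
    have m0 : 0 <= 2 * (4 ^ (p * l))%:R :> R by rewrite mulr_ge0.
    rewrite mE; apply: le_trans (ler_wpM2l m0 h) _.
    rewrite !natrX; set x := 4 ^+ (p * l); have x0 : 0 < x by rewrite exprn_gt0.
    set y := L ^+ (2 * p); have Ly : L <= y.
      by rewrite /y mulSn addSn exprS ler_peMr // exprn_ege1.
    have yp : 0 < y by apply: lt_le_trans Ly; exact: lt_le_trans L1.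
    set z := 2 ^+ N; have z0 : 0 < z by rewrite exprn_gt0.
    have -> : 2 * x * (z * (8 * (2 * p)`!%:R / (y * x))) = z * (L / y).
      by rewrite /L; field; rewrite !gt_eqF.
    by rewrite ler_piMr ?(ltW z0) // ler_pdivrMr // mul1r.
have point k : nm (V M a (fun i => rads N (c i) k)) <=
    Cu * L * (B + \sum_(l < N) 2 ^+ l * nm (V M a (fun i => (A l i k)%:R))).
  have bnd0 i : 0 <= L * (1 + \sum_(l < N) 2 ^+ l * (A l i k)%:R).
    by rewrite mulr_ge0 // addr_ge0 // sumr_ge0 // => l _; rewrite mulr_ge0 // exprn_ge0.
  apply: le_trans (wsum_mono (d := fun i => L * (1 + \sum_(l < N) 2 ^+ l * (A l i k)%:R)) a _) _.
    move=> i iM; rewrite [leRHS]ger0_norm //.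
    exact: dyadic_layers (normr_ge0 _) (c1 i k iM).
  rewrite -mulrA ler_pM2l // wsumZ nmZ // mod_ofr (ger0_norm L0) ler_wpM2l //.
  rewrite wsumD; apply: le_trans (nmD sc _ _) _; rewrite lerD2l.
  rewrite -(wsum_sum sc e M a (fun (l : 'I_N) i => 2 ^+ l * (A l i k)%:R) xpredT).
  apply: le_trans (nm_sum sc _ _ _) _; apply: ler_sum => l _.
  by rewrite wsumZ nmZ // mod_ofr ger0_norm // exprn_ge0.
apply: le_trans (le_avg _ point) _.
rewrite avgZ avgD avg_cst (avg_sum _ _ (fun l k => 2 ^+ l * nm (V M a (fun i => (A l i k)%:R)))).
rewrite -[leRHS]mulrA; apply: ler_wpM2l; first by rewrite mulr_ge0 // ltW.
rewrite mulrDl mul1r lerD2l.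
apply: le_trans (_ : _ <= \sum_(l < N) 4 * Cu * C1 * B * 2^-1 ^+ l) _.
  apply: ler_sum => l _; rewrite avgZ.
  apply: le_trans (ler_wpM2l _ (avg_layer l)) _; first by rewrite exprn_ge0.
  rewrite (_ : 4 ^+ l = 2 ^+ l * 2 ^+ l); last first.
    by rewrite -exprMn; congr (_ ^+ _); ring.
  rewrite exprVn le_eqVlt; apply/orP; left; apply/eqP; field.
  by rewrite expf_neq0.
rewrite -mulr_sumr.
have geo n : \sum_(l < n) 2^-1 ^+ l <= 2 - 2 * 2^-1 ^+ n :> R.
  elim: n => [|n IH]; first by rewrite big_ord0 expr0; lra.
  rewrite big_ord_recr /= exprS; have : 0 <= 2^-1 ^+ n :> R by rewrite exprn_ge0.
  lra.
have g2 : \sum_(l < N) 2^-1 ^+ l <= 2 :> R.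
  by apply: le_trans (geo N) _; rewrite gerBl mulr_ge0 // exprn_ge0.
have c0 : 0 <= 4 * Cu * C1 * B by rewrite !mulr_ge0 // ltW.
have := ler_wpM2l c0 g2; lra.
Qed.

(** Row by row, the Rademacher sum of the entries is the l_2 norm of the row times a
    normalized Rademacher sum, so the real and the imaginary parts are bounded by
    the multiplier estimate. *)
Lemma square_function_upper : exists2 C, 0 <= C &
  forall M N (g : nat -> nat -> K) (b : nat -> K),
  (forall i, (i < M)%N -> \sum_(n < N) modulus (g i n) ^+ 2 <= modulus (b i) ^+ 2) ->
  avg N (fun k => nm (\sum_(i < M) (\sum_(n < N) sgn K N k n * g i n) *: e i)) <=
  C * nm (\sum_(i < M) b i *: e i).
Proof.
have [C C0 hC] := real_multiplier_bound.
exists (4 * Cu * C); first by rewrite !mulr_ge0 // ltW.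
move=> M N g b gb.
pose cr i n := re (g i n) / (2 * modulus (b i)).
pose ci i n := im sc (g i n) / (2 * modulus (b i)).
have half i (f : nat -> R) : (i < M)%N -> (forall n, f n ^+ 2 <= modulus (g i n) ^+ 2) ->
    \sum_(n < N) (f n / (2 * modulus (b i))) ^+ 2 <= 1 / 2 /\
    forall n, (n < N)%N -> f n = 2 * (modulus (b i) * (f n / (2 * modulus (b i)))).
  move=> iM fg; have [b0|b0] := eqVneq (modulus (b i)) 0.
    rewrite b0 mulr0 invr0; split.
      by rewrite big1 => [|n _]; rewrite ?mulr0 ?expr0n //; lra.
    move=> n nN; rewrite !mulr0; apply/eqP; rewrite -sqrf_eq0 eq_le sqr_ge0 andbT.
    apply: le_trans (fg n) _; have := gb i iM; rewrite b0 expr0n /=; apply: le_trans.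
    by rewrite (bigD1 (Ordinal nN)) //= lerDl sumr_ge0 // => j _; exact: sqr_ge0.
  have bp : 0 < modulus (b i) by rewrite lt_neqAle eq_sym b0 mod_ge0.
  split; last by move=> n _; field.
  under eq_bigr => n _ do rewrite exprMn.
  rewrite -mulr_suml exprVn ler_pdivrMr ?exprn_gt0 ?mulr_gt0 //.
  apply: (@le_trans _ _ (\sum_(n < N) modulus (g i n) ^+ 2)).
    by apply: ler_sum => n _; exact: fg.
  apply: le_trans (gb i iM) _.
  by rewrite exprMn; have := sqr_ge0 (modulus (b i)); lra.
have sqle (x y : R) : `|x| <= y -> x ^+ 2 <= y ^+ 2.
  by move=> xy; rewrite -(real_normK (num_real x)) lerXn2r ?nnegrE // (le_trans _ xy).
have hr i (iM : (i < M)%N) := half i (fun n => re (g i n)) iM (fun n => sqle _ _ (re_le_mod sc _)).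
have hi i (iM : (i < M)%N) := half i (fun n => im sc (g i n)) iM (fun n => sqle _ _ (im_le_mod sc _)).
pose a i := ofr sc (modulus (b i)).
have aB : nm (V M a (fun=> 1)) <= Cu * nm (\sum_(i < M) b i *: e i).
  rewrite wsum1; apply: (hU (b := a)) => i iM.
  by rewrite /a mod_ofr ger0_norm ?mod_ge0.
have split k : \sum_(i < M) (\sum_(n < N) sgn K N k n * g i n) *: e i =
   ofr sc 2 *: (V M a (fun i => rads N (cr i) k) + iunit sc *: V M a (fun i => rads N (ci i) k)).
  rewrite /wsum [iunit sc *: _]scaler_sumr -big_split scaler_sumr; apply: eq_bigr => i _.
  rewrite /= scalerA -scalerDl scalerA; congr (_ *: _).
  rewrite mulrA -mulrDl /rads !rmorph_sum mulr_sumr -big_split mulr_suml mulr_sumr.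
  apply: eq_bigr => n _; rewrite [g i n](partsE sc) sgn_ofr /=.
  rewrite {1}(proj2 (hr i (ltn_ord i)) n (ltn_ord n)) {1}(proj2 (hi i (ltn_ord i)) n (ltn_ord n)).
  rewrite -/(cr i n) -/(ci i n) /a !rmorphM; ring.
have cu0 := Cu0.
apply: le_trans (_ : _ <= avg N (fun k => 2 * (nm (V M a (fun i => rads N (cr i) k)) +
    nm (V M a (fun i => rads N (ci i) k))))) _.
  apply: le_avg => k; rewrite split nmZ // mod_ofr ger0_norm // ler_pM2l //.
  apply: le_trans (nmD sc _ _) _; rewrite lerD2l nmZ // ler_piMl ?nm_ge0 //.
  exact: mod_iunit.
rewrite avgZ avgD.
have := hC M N a cr (fun i iM => proj1 (hr i iM)).
have := hC M N a ci (fun i iM => proj1 (hi i iM)).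
have := ler_wpM2l C0 aB; lra.
Qed.

End Cotype.

(** * The lower square function estimate *)

Section SquareLower.
Context {R : realType} {K : numFieldType} {re : K -> R} (sc : scalar_parts re).
Local Notation nm := (nm re).
Local Notation modulus := (modulus re).
Context {X : normedModType K} (e : nat -> X) (Cu : R).
Context (Cu1 : 1 <= Cu) (hU : lattice_const (re := re) e Cu).

Lemma khintchine_lower_scalar N (g : nat -> K) :
  Num.sqrt (\sum_(n < N) modulus (g n) ^+ 2) <=
  320 * avg N (fun k => modulus (\sum_(n < N) sgn K N k n * g n)).
Proof.
have sq0 (f : nat -> R) : 0 <= \sum_(n < N) f n ^+ 2.
  by apply: sumr_ge0 => n _; exact: sqr_ge0.
set a := \sum_(n < N) re (g n) ^+ 2; set b := \sum_(n < N) im sc (g n) ^+ 2.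
have -> : \sum_(n < N) modulus (g n) ^+ 2 = a + b.
  by rewrite -big_split; apply: eq_bigr => n _; rewrite (mod_sq sc).
have a0 : 0 <= a := sq0 (fun n => re (g n)).
have b0 : 0 <= b := sq0 (fun n => im sc (g n)).
have sa := sqrtr_ge0 a; have sb := sqrtr_ge0 b.
apply: (@le_trans _ _ (Num.sqrt a + Num.sqrt b)).
  rewrite -[leRHS]ger0_norm ?addr_ge0 // -sqrtr_sqr ler_wsqrtr //.
  rewrite sqrrD !sqr_sqrtr //; have : 0 <= Num.sqrt a * Num.sqrt b by rewrite mulr_ge0.
  by move=> h; rewrite -mulr_natl; lra.
have part (f : K -> R) : (forall r x, f (ofr sc r * x) = r * f x) ->
    (forall I (r : seq I) (F : I -> K), f (\sum_(i <- r) F i) = \sum_(i <- r) f (F i)) ->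
    (forall x, `|f x| <= modulus x) ->
    Num.sqrt (\sum_(n < N) f (g n) ^+ 2) <=
      160 * avg N (fun k => modulus (\sum_(n < N) sgn K N k n * g n)).
  move=> fZ fS fM; apply: le_trans (khintchine_lower N (fun n => f (g n))) _.
  rewrite ler_wpM2l //; apply: le_avg => k; apply: le_trans (fM _).
  rewrite fS /rads le_eqVlt; apply/orP; left; apply/eqP; congr (`|_|).
  by apply: eq_bigr => n _; rewrite (sgn_ofr sc) fZ.
have h1 := part re (reZ sc) (fun I r F => re_sum sc r xpredT F) (re_le_mod sc).
have h2 := part (im sc) (imZ sc) (fun I r F => im_sum sc r xpredT F) (im_le_mod sc).
rewrite -/a -/b in h1 h2; lra.
Qed.

(** By Khintchine's inequality the l_2 norm of each row is at most a constant times
    the mean modulus of its Rademacher sum; the mean comes out of the norm by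
    convexity. *)
Lemma square_function_lower M N (g : nat -> nat -> K) :
  nm (\sum_(i < M) ofr sc (Num.sqrt (\sum_(n < N) modulus (g i n) ^+ 2)) *: e i) <=
  320 * Cu ^+ 2 * avg N (fun k => nm (\sum_(i < M) (\sum_(n < N) sgn K N k n * g i n) *: e i)).
Proof.
have Cu0 : 0 < Cu by exact: lt_le_trans Cu1.
pose v i k := modulus (\sum_(n < N) sgn K N k n * g i n).
have v0 i k : 0 <= v i k by exact: mod_ge0.
apply: (@le_trans _ _ (Cu * nm (wsum sc e M (fun=> 1) (fun i => 320 * avg N (v i))))).
  apply: (hU (b := fun i => ofr sc (Num.sqrt (\sum_(n < N) modulus (g i n) ^+ 2)))
    (a := fun i => ofr sc (320 * avg N (v i)) * 1)) => i iM.
  have av0 : 0 <= avg N (v i) by exact: avg_ge0.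
  rewrite mulr1 !mod_ofr ger0_norm ?sqrtr_ge0 // ger0_norm; last by rewrite mulr_ge0.
  exact: khintchine_lower_scalar.
have -> : wsum sc e M (fun=> 1) (fun i => 320 * avg N (v i)) =
    ofr sc 320 *: wsum sc e M (fun=> 1) (fun i => avg N (v i)) by exact: wsumZ.
rewrite nmZ // mod_ofr ger0_norm //.
rewrite expr2 !mulrA [320 * Cu]mulrC -!mulrA ler_pM2l // ler_pM2l //.
have -> : wsum sc e M (fun=> 1) (fun i => avg N (v i)) =
    ofr sc (2 ^+ N)^-1 *: \sum_(k < 2 ^ N) wsum sc e M (fun=> 1) (fun i => v i k).
  by rewrite wsum_sum -wsumZ.
have p0 : 0 <= (2 ^+ N)^-1 :> R by rewrite invr_ge0 exprn_ge0.
rewrite nmZ // mod_ofr ger0_norm //. 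
rewrite mulrCA ler_wpM2l // mulr_sumr.
apply: le_trans (nm_sum sc _ _ _) _; apply: ler_sum => k _.
rewrite /wsum; apply: (hU (b := fun i => ofr sc (v i k) * 1)
  (a := fun i => \sum_(n < N) sgn K N k n * g i n)) => i iM.
by rewrite mulr1 mod_ofr ger0_norm.
Qed.

End SquareLower.

(** * Finite matrices in Rad(X) *)

Section RadSpace.
Context {R : realType} {K : numFieldType} {re : K -> R} (sc : scalar_parts re).
Local Notation nm := (nm re).
Local Notation modulus := (modulus re).
Context {X : normedModType K} {Z : completeNormedModType K} (e : nat -> X).
Context (e_dense : forall x d, 0 < d -> exists M (a : nat -> K),
   nm (x - \sum_(i < M) a i *: e i) < d).
Context (J : (R -> X) -> Z).
Context (J_lin : forall (a : K) (f g : R -> X), @rad_sums R K X f -> @rad_sums R K X g ->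
           J (a *: f + g) = a *: J f + J g).
Context (J_norm : forall f : R -> X, @rad_sums R K X f -> nm (J f) = L1norm re f).
Context (J_dense : dense (J @` @rad_sums R K X)).

(** Indexing by nat instead of 'I_N makes sums of different lengths comparable by
    padding with zeros. *)
Definition radseq N (x : nat -> X) : R -> X := rsum (fun n : 'I_N => x n).

Lemma radseq_rad N x : @rad_sums R K X (radseq N x).
Proof. by exists N, (fun n : 'I_N => x n). Qed.

Lemma radseq_lin N (c : K) x y : radseq N (fun n => c *: x n + y n) = c *: radseq N x + radseq N y.
Proof.
apply/funext => t; rewrite /radseq /rsum /= -[RHS]/(c *: _ + _) scaler_sumr -big_split.
by apply: eq_bigr => n _; rewrite scalerDr !scalerA mulrC.
Qed.

Lemma radseq_widen N N' x : (N <= N')%N ->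
  (forall n, (N <= n)%N -> x n = 0) -> radseq N' x = radseq N x.
Proof.
move=> NN x0; apply/funext => t; rewrite /radseq /rsum.
rewrite [RHS](big_ord_widen N' (fun n => rademacher K n.+1 t *: x n)) //.
rewrite [RHS]big_mkcond; apply: eq_bigr => n _; case: ltnP => // h.
by rewrite x0 // scaler0.
Qed.

Lemma J_radseq_lin N (c : K) x y :
  J (radseq N (fun n => c *: x n + y n)) = c *: J (radseq N x) + J (radseq N y).
Proof. by rewrite radseq_lin J_lin //; exact: radseq_rad. Qed.

Lemma J_radseq_norm N x :
  nm (J (radseq N x)) = avg N (fun k => nm (\sum_(n < N) sgn K N k n *: x n)).
Proof. by rewrite J_norm; [exact: L1norm_rsum | exact: radseq_rad]. Qed.

Lemma mod_sgn N k n : modulus (sgn K N k n) = 1.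
Proof. by rewrite (sgn_ofr sc) mod_ofr norm_sgn. Qed.

Lemma J_radseq_le N x : nm (J (radseq N x)) <= \sum_(n < N) nm (x n).
Proof.
rewrite J_radseq_norm -[leRHS](avg_cst N); apply: le_avg => k.
apply: le_trans (nm_sum sc _ _ _) _; apply: ler_sum => n _.
by rewrite nmZ // mod_sgn mul1r.
Qed.

Definition supported k (a : nat -> nat -> K) := forall i n, (k <= i)%N || (k <= n)%N -> a i n = 0.

(** The element sum_n r_n (sum_i a_in e_i) of Rad(X).  When [a] vanishes outside the
    square of side k, this element does not depend on k. *)
Definition radmx k (a : nat -> nat -> K) : Z := J (radseq k (fun n => \sum_(i < k) a i n *: e i)).

Lemma supported_widen k l a : (k <= l)%N -> supported k a -> supported l a.
Proof.
move=> kl ha i n /orP [h|h]; apply: ha; first by rewrite (leq_trans kl h).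
by rewrite (leq_trans kl h) orbT.
Qed.

Lemma supported_lin k c a b : supported k a -> supported k b ->
  supported k (fun i n => c * a i n + b i n).
Proof. by move=> ha hb i n h; rewrite ha // hb // mulr0 addr0. Qed.

Lemma nm_radmx k a : nm (radmx k a) =
  avg k (fun j => nm (\sum_(i < k) (\sum_(n < k) sgn K k j n * a i n) *: e i)).
Proof.
rewrite /radmx J_radseq_norm; apply: eq_avg => j; congr (nm _).
under eq_bigr => n _ do rewrite scaler_sumr.
rewrite exchange_big; apply: eq_bigr => i _; rewrite scaler_suml.
by apply: eq_bigr => n _; rewrite scalerA.
Qed.

Lemma radmx_lin k c a b : radmx k (fun i n => c * a i n + b i n) = c *: radmx k a + radmx k b.
Proof.
rewrite /radmx -J_radseq_lin; congr (J (radseq _ _)); apply/funext => n.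
rewrite scaler_sumr -big_split; apply: eq_bigr => i _.
by rewrite scalerDl scalerA.
Qed.

Lemma radmx_widen k l a : (k <= l)%N -> supported k a -> radmx l a = radmx k a.
Proof.
move=> kl ha; rewrite /radmx.
have -> : (fun n => \sum_(i < l) a i n *: e i) = (fun n => \sum_(i < k) a i n *: e i).
  apply/funext => n; rewrite [RHS](big_ord_widen l (fun i => a i n *: e i)) //.
  rewrite [RHS]big_mkcond; apply: eq_bigr => i _; case: ltnP => // h.
  by rewrite ha ?h // scale0r.
rewrite (radseq_widen kl) // => n kn; rewrite big1 // => i _.
by rewrite ha ?kn ?orbT // scale0r.
Qed.

Lemma radmx_dense (F : Z) (d : R) : 0 < d -> exists k a, supported k a /\ nm (F - radmx k a) < d.
Proof.
move=> d0; have d2 : 0 < d / 2 by rewrite divr_gt0.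
have [_ [_ [N [x0 ->]] <-] hF] := dense_nm sc J_dense F d2.
pose x n := if insub n is Some o then x0 o else 0.
have xE : rsum x0 = radseq N x.
  by apply/funext => t; apply: eq_bigr => n _; rewrite /x valK.
have dN : 0 < d / 2 / N.+1%:R by rewrite divr_gt0.
have [M0 hM0] := choice (fun n => e_dense (x n) dN).
have [a0 ha0] := choice hM0.
pose k := maxn N (\max_(n < N) M0 n).
pose a i n := if (n < N)%N && (i < M0 n)%N then a0 n i else 0.
have Mk n : (n < N)%N -> (M0 n <= k)%N.
  move=> nN; apply: leq_trans (leq_maxr _ _).
  exact: (leq_bigmax (Ordinal nN)).
have ha : supported k a.
  move=> i n h; rewrite /a; case: ifP => // /andP [nN iM].
  case/orP: h => h.
    by have := leq_trans (leq_trans iM (Mk n nN)) h; rewrite ltnn.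
  by have := leq_trans (leq_trans nN (leq_maxl _ _)) h; rewrite ltnn.
exists k, a; split=> //; rewrite (splitr d).
apply: le_lt_trans (nm_tri sc (J (rsum x0)) _ _) _; apply: ltrD => //.
have -> : rsum x0 = radseq k x.
  rewrite xE (@radseq_widen N k) ?leq_maxl // => n Nn.
  by rewrite /x insubF // ltnNge Nn.
rewrite -[- _]scaleN1r addrC /radmx -J_radseq_lin.
apply: le_lt_trans (J_radseq_le _ _) _.
apply: (@le_lt_trans _ _ (\sum_(n < k | (n < N)%N) d / 2 / N.+1%:R)).
  rewrite [leRHS]big_mkcond; apply: ler_sum => n _.
  rewrite scaleN1r addrC; case: ifP => nN.
    rewrite (_ : \sum_(i < k) _ = \sum_(i < M0 n) a0 n i *: e i); first exact: ltW (ha0 n).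
    rewrite [RHS](big_ord_widen k (fun i => a0 n i *: e i)) ?Mk // [RHS]big_mkcond.
    by apply: eq_bigr => i _; rewrite /a nN /=; case: ifP; rewrite ?scale0r.
  rewrite /x insubF // big1 ?subrr ?nm0 // => i _; by rewrite /a nN scale0r.
rewrite -(big_ord_widen k (fun=> d / 2 / N.+1%:R)) ?leq_maxl //.
rewrite sumr_const card_ord -[ltLHS]mulr_natr -mulrA gtr_pMr //.
by rewrite mulrC ltr_pdivrMr // mul1r ltr_nat.
Qed.

(** Finite matrices are dense, so a bounded linear map on them extends to the whole
    space.  The value at F is characterized by its distance to the values on matrices,
    from which linearity and boundedness follow. *)
Lemma bounded_extension (W : normedModType K)
    (hW : forall u : nat -> W, nm_cauchy re u -> exists l, nm_lim re u l)
    (T0 : nat -> (nat -> nat -> K) -> W) (C : R) :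
  0 <= C ->
  (forall k c a b, supported k a -> supported k b ->
    T0 k (fun i n => c * a i n + b i n) = c *: T0 k a + T0 k b) ->
  (forall k l a, (k <= l)%N -> supported k a -> T0 l a = T0 k a) ->
  (forall k a, supported k a -> nm (T0 k a) <= C * nm (radmx k a)) ->
  exists T : Z -> W,
    [/\ forall c x y, T (c *: x + y) = c *: T x + T y,
        forall x, nm (T x) <= C * nm x &
        forall k a, supported k a -> T (radmx k a) = T0 k a].
Proof.
move=> C0 T0lin T0wid T0bd.
have T0diff k a l b : supported k a -> supported l b ->
    nm (T0 k a - T0 l b) <= C * nm (radmx k a - radmx l b).
  move=> ha hb; have km := leq_maxl k l; have lm := leq_maxr k l.
  have ha' := supported_widen km ha; have hb' := supported_widen lm hb.
  rewrite -(T0wid _ _ _ km ha) -(T0wid _ _ _ lm hb) -(radmx_widen km ha) -(radmx_widen lm hb).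
  rewrite addrC -[- T0 _ b]scaleN1r -T0lin //.
  rewrite [X in _ <= C * nm X]addrC -[- radmx _ b]scaleN1r -radmx_lin.
  by apply: T0bd; exact: supported_lin.
have H F : exists l, forall k a, supported k a -> nm (l - T0 k a) <= C * nm (F - radmx k a).
  have dm (m : nat) : 0 < (m.+1%:R : R)^-1 by rewrite invr_gt0.
  have [kk hk] := choice (fun m => radmx_dense F (dm m)).
  have [aa haa] := choice hk.
  have [|l hl] := hW (fun m => T0 (kk m) (aa m)).
    move=> d d0; have c1 : 0 < 2 * C + 1 by rewrite ltr_wpDl // mulr_ge0.
    have [|N hN] := inv_small (r := d / (2 * C + 1)); first by rewrite divr_gt0.
    exists N => m n Nm Nn.
    apply: le_lt_trans (T0diff _ _ _ _ (proj1 (haa m)) (proj1 (haa n))) _.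
    have h1 := lt_trans (proj2 (haa m)) (hN m Nm).
    have h2 := lt_trans (proj2 (haa n)) (hN n Nn).
    have h3 := nm_tri sc F (radmx (kk m) (aa m)) (radmx (kk n) (aa n)).
    rewrite (nmBC _ F) in h3.
    rewrite ltr_pdivlMr // in h1; rewrite ltr_pdivlMr // in h2.
    have := ler_wpM2l C0 h3.
    have := nm_ge0 sc (F - radmx (kk m) (aa m)); have := nm_ge0 sc (F - radmx (kk n) (aa n)).
    nra.
  exists l => k a ha; apply: (le_eps (c := 1 + C)) => d d0.
  have [N1 h1] := hl d d0; have [N2 h2] := inv_small d0.
  pose m := maxn N1 N2.
  have g1 := h1 m (leq_maxl _ _).
  have g2 := lt_trans (proj2 (haa m)) (h2 m (leq_maxr _ _)).
  have g3 := nm_tri sc (T0 (kk m) (aa m)) l (T0 k a).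
  rewrite (nmBC l (T0 (kk m) (aa m))) in g3.
  have g4 := T0diff _ _ _ _ (proj1 (haa m)) ha.
  have g5 := nm_tri sc F (radmx (kk m) (aa m)) (radmx k a).
  rewrite (nmBC _ F) in g5.
  have := ler_wpM2l C0 g5; have := ler_wpM2l C0 (ltW g2).
  lra.
have [T hT] := choice H; exists T; split.
- move=> c x y; apply/eqP; rewrite -subr_eq0; apply/eqP/(nm_eq0 sc).
  apply/eqP; rewrite eq_le nm_ge0 // andbT.
  apply: (le_eps (c := 2 * C * (modulus c + 1))) => d d0; rewrite add0r.
  have [k [a [ha xa]]] := radmx_dense x d0; have [l [b [hb yb]]] := radmx_dense y d0.
  pose m := maxn k l; have km : (k <= m)%N := leq_maxl _ _.
  have lm : (l <= m)%N := leq_maxr _ _.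
  have ha' := supported_widen km ha; have hb' := supported_widen lm hb.
  rewrite -(radmx_widen km ha) in xa; rewrite -(radmx_widen lm hb) in yb.
  have h1 := hT (c *: x + y) m _ (supported_lin c ha' hb').
  have h2 := hT x m _ ha'; have h3 := hT y m _ hb'.
  rewrite T0lin // radmx_lin in h1.
  have h4 : nm (c *: x + y - (c *: radmx m a + radmx m b)) <= modulus c * d + d.
    rewrite opprD addrACA -scalerBr; apply: le_trans (nmD sc _ _) _.
    by rewrite nmZ // lerD ?(ltW yb) // ler_wpM2l ?mod_ge0 // ltW.
  have -> : T (c *: x + y) - (c *: T x + T y) =
     (T (c *: x + y) - (c *: T0 m a + T0 m b)) - (c *: (T x - T0 m a) + (T y - T0 m b)).
    rewrite [X in _ = _ - X](_ : _ = (c *: T x + T y) - (c *: T0 m a + T0 m b)).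
      by rewrite [in RHS]opprB subrKA.
    by rewrite scalerBr addrACA -opprD.
  apply: le_trans (nmB sc _ _) _.
  have h5 : nm (c *: (T x - T0 m a) + (T y - T0 m b)) <= modulus c * (C * d) + C * d.
    apply: le_trans (nmD sc _ _) _; rewrite nmZ //; apply: lerD.
      rewrite ler_wpM2l ?mod_ge0 //; apply: le_trans h2 _.
      by rewrite ler_wpM2l // ltW.
    by apply: le_trans h3 _; rewrite ler_wpM2l // ltW.
  have := ler_wpM2l C0 h4; lra.
- move=> x; apply: (le_eps (c := 2 * C)) => d d0.
  have [k [a [ha xa]]] := radmx_dense x d0.
  have h1 := hT x k a ha; have h2 := T0bd k a ha.
  have h3 := nm_leB sc (T x) (T0 k a).
  have h4 := nm_leB sc (radmx k a) x; rewrite nmBC in h4.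
  have := ler_wpM2l C0 (ltW xa); have := ler_wpM2l C0 h4; lra.
- move=> k a ha; apply/eqP; rewrite -subr_eq0; apply/eqP/(nm_eq0 sc).
  apply/eqP; rewrite eq_le nm_ge0 // andbT.
  by have := hT (radmx k a) k a ha; rewrite subrr nm0 // mulr0.
Qed.

End RadSpace.

(** * Projections *)

Section Complement.
Context {R : realType} {K : numFieldType} {re : K -> R} (sc : scalar_parts re).
Local Notation nm := (nm re).
Local Notation modulus := (modulus re).

Lemma linear_subspaceP (Z : normedModType K) (Y : set Z) : linear_subspace Y <->
  Y 0 /\ forall a x y, Y x -> Y y -> Y (a *: x + y).
Proof.
split=> [[Y0 Ylin]|[Y0 Ylin]].
  split; first by rewrite inE in Y0.
  move=> a x y /mem_set Yx /mem_set Yy.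
  by have := Ylin a x y Yx Yy; rewrite inE.
split; first by rewrite inE.
by move=> a x y; rewrite !inE => Yx Yy; exact: Ylin.
Qed.

Lemma linear_of (V W : normedModType K) (f : V -> W) :
  (forall a x y, f (a *: x + y) = a *: f x + f y) -> exists g : {linear V -> W}, g =1 f.
Proof.
move=> h; pose m := GRing.isLinear.Build K V W _ f h.
pose g : {linear V -> W} := HB.pack f m.
by exists g.
Qed.

Lemma complemented_by (Z : normedModType K) (Y : set Z) (P : Z -> Z) (C : R) :
  (forall a x y, P (a *: x + y) = a *: P x + P y) ->
  (forall x, nm (P x) <= C * nm x) ->
  (forall x, Y (P x)) -> (forall y, Y y -> P y = y) -> complemented Y.
Proof.
move=> /linear_of [p pE] Pb YP PY; exists p; split.
- by apply: (bounded_continuous sc (C := C)) => x; rewrite pE.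
- by move=> x; rewrite !pE PY.
- apply/seteqP; split=> [_ [x _ <-]|y Yy]; first by rewrite pE.
  by exists y => //; rewrite pE PY.
Qed.

(** Orthogonal projection for a quadratic form Q that is equivalent to the squared
    norm on Y but only dominated by it on Z.  The form is used only through its
    polarization [B], four times the real inner product; the conclusion is linear
    over K because u is orthogonal to Y exactly when Q(u+z) = Q(u) + Q(z) on Y,
    a condition invariant under scalar multiplication. *)
Section HilbertProjection.
Context {Z : completeNormedModType K} (Q : Z -> R) (C : R).
Let B x y : R := Q (x + y) - Q (x - y).
Context (C0 : 0 <= C) (Q0 : forall x, 0 <= Q x).
Context (QZ : forall a x, Q (a *: x) = modulus a ^+ 2 * Q x).
Context (BD : forall x x' y, B (x + x') y = B x y + B x' y :> R).
Context (BZ : forall t x y, B (ofr sc t *: x) y = t * B x y :> R).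
Context (Qle : forall x, Q x <= C * nm x ^+ 2).
Context (Y : set Z) (Y_sub : linear_subspace Y) (Y_cl : closed Y).
Context (Y_low : forall y, Y y -> nm y ^+ 2 <= C * Q y).

Let QN x : Q (- x) = Q x.
Proof. by rewrite -scaleN1r QZ modN mod1 // expr1n mul1r. Qed.

Let BC x y : B x y = B y x.
Proof. by rewrite /B [y + x]addrC -[y - x]opprB QN. Qed.

Let BN x y : B x (- y) = - B x y.
Proof. by rewrite /B opprK opprB. Qed.

Let QD x y : Q (x + y) = Q x + Q y + B x y / 2 :> R.
Proof.
have Q00 : Q 0 = 0 by rewrite -(scale0r 0) QZ mod0 // expr0n mul0r.
have Bxx z : B z z = 4 * Q z.
  rewrite /B subrr Q00 subr0 -[z + z]mulr2n -scaler_nat QZ -(rmorph_nat (ofr sc)) mod_ofr.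
  by rewrite ger0_norm // expr2; lra.
have := Bxx (x + y); rewrite BD (BC x) (BC y) !BD !Bxx (BC y x); lra.
Qed.

Let BQ x y : `|B x y| / 2 <= Q x + Q y.
Proof.
have := Q0 (x + y); have := Q0 (x - y); rewrite !QD BN QN.
by case: (ger0P (B x y)) => _; lra.
Qed.

Let Y0 : Y 0. Proof. by have /linear_subspaceP [] := Y_sub. Qed.
Let YZD a x y : Y x -> Y y -> Y (a *: x + y).
Proof. have /linear_subspaceP [_ h] := Y_sub; exact: h. Qed.
Let YZ a x : Y x -> Y (a *: x).
Proof. by move=> Yx; rewrite -[_ *: _]addr0; apply: YZD. Qed.
Let YD x y : Y x -> Y y -> Y (x + y).
Proof. by move=> Yx Yy; rewrite -[x]scale1r; apply: YZD. Qed.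
Let YN x : Y x -> Y (- x).
Proof. by rewrite -scaleN1r; exact: YZ. Qed.

(** A minimizing sequence for Q(F - y) is Cauchy by the parallelogram law.  Its limit
    is shown to be orthogonal directly from the almost minimality of the
    sequence. *)
Lemma orthogonal_projection_ex F : exists y, Y y /\ forall z, Y z -> B (F - y) z = 0.
Proof.
pose S := [set Q (F - y) | y in Y]; pose d := inf S.
have Sinf : has_inf S.
  split; first by exists (Q (F - 0)), 0.
  by exists 0 => _ [y _ <-].
have dle y : Y y -> d <= Q (F - y).
  by move=> Yy; apply: ge_inf; [exact: Sinf.2|exists y].
have H (k : nat) : exists y, Y y /\ Q (F - y) < d + k.+1%:R^-1.
  have [|_ [y Yy <-] h] := @inf_adherent _ S k.+1%:R^-1 _ Sinf; first by rewrite invr_gt0.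
  by exists y.
have [u hu] := choice H.
have para j k : Q (u j - u k) <= 2 * (j.+1%:R^-1 + k.+1%:R^-1).
  have [Yj _] := hu j; have [Yk _] := hu k.
  have hj : Q (F - u j) < d + j.+1%:R^-1 := proj2 (hu j).
  have hk : Q (F - u k) < d + k.+1%:R^-1 := proj2 (hu k).
  have h1 : Q (u j - u k) = Q (F - u k) + Q (F - u j) - B (F - u k) (F - u j) / 2.
    have -> : u j - u k = (F - u k) + (- (F - u j)).
      by rewrite opprB [RHS]addrC subrKA.
    by rewrite QD BN QN mulNr.
  have h2 : 4 * Q (F - ofr sc 2^-1 *: (u k + u j)) =
      Q (F - u k) + Q (F - u j) + B (F - u k) (F - u j) / 2 :> R.
    rewrite -QD -addrACA -opprD.
    have -> : F + F - (u k + u j) = ofr sc 2 *: (F - ofr sc 2^-1 *: (u k + u j)).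
      rewrite scalerBr scalerA -rmorphM mulfV // rmorph1 scale1r rmorph_nat.
      by rewrite scaler_nat mulr2n.
    by rewrite QZ mod_ofr ger0_norm // expr2; congr (_ * _); lra.
  have h3 : d <= Q (F - ofr sc 2^-1 *: (u k + u j)).
    exact: dle _ (YZ (ofr sc 2^-1) (YD Yk Yj)).
  move: hj hk; move: (j.+1%:R^-1) (k.+1%:R^-1) => rj rk; lra.
have [|y hy] := nm_complete sc (u := u).
  move=> r r0; have c1 : 0 < C * 4 + 1 by rewrite ltr_wpDl // mulr_ge0.
  have [|N hN] := inv_small (r := r ^+ 2 / (C * 4 + 1)); first by rewrite divr_gt0 // exprn_gt0.
  exists N => m n Nm Nn.
  rewrite -(@ltr_pXn2r _ 2) // ?nnegrE ?nm_ge0 ?(ltW r0) //.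
  have [Ym _] := hu m; have [Yn _] := hu n.
  apply: le_lt_trans (Y_low (YD Ym (YN Yn))) _.
  have hmn := ler_wpM2l C0 (para m n).
  have := hN m Nm; have := hN n Nn; rewrite !ltr_pdivlMr //.
  have : 0 <= (m.+1%:R : R)^-1 by rewrite invr_ge0.
  have : 0 <= (n.+1%:R : R)^-1 by rewrite invr_ge0.
  move: hmn; move: (m.+1%:R^-1) (n.+1%:R^-1) => rm rn; lra.
have Yy : Y y.
  apply: (proj1 (closed_nmP sc Y) Y_cl) => r r0; have [N hN] := hy r r0.
  by exists (u N); [exact: (proj1 (hu N))|rewrite nmBC; exact: hN].
exists y; split=> //.
have half z : Y z -> - B (F - y) z <= 0.
  move=> Yz; apply: (le_eps (c := 4 * Q z)) => s s0; rewrite add0r.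
  (* Perturb the minimizing sequence by s z, then let s tend to 0. *)
  suff : - (s * B (F - y) z) / 2 <= 2 * s ^+ 2 * Q z.
    move=> h; rewrite -(ler_pM2l s0) -(ler_pM2r (x := 2^-1)) ?invr_gt0 //; move: h; nra.
  apply: (le_eps (c := 1 + C)) => r r0.
  have [N1 h1] := inv_small r0.
  have [N2 h2] : exists N, forall n, (N <= n)%N -> nm (u n - y) ^+ 2 < r.
    have [|N hN] := hy (Num.min 1 r); first by rewrite lt_min ltr01.
    exists N => n /hN; rewrite lt_min => /andP [n1 nr].
    have := nm_ge0 sc (u n - y); nra.
  pose k := maxn N1 N2.
  have g1 := h1 k (leq_maxl _ _); have g2 := h2 k (leq_maxr _ _).
  have [Yk hk] := hu k.
  have e1 : B (F - y) z = B (F - u k) z + B (u k - y) z by rewrite -BD subrKA.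
  pose w := ofr sc s *: z.
  have Qw : Q w = s ^+ 2 * Q z by rewrite QZ mod_ofr real_normK ?num_real.
  have Bw x : B x w = s * B x z by rewrite BC BZ BC.
  have g3 := dle _ (YD Yk (YN (YZ (ofr sc s) Yz))).
  rewrite -/w opprD opprK addrA QD Bw Qw in g3.
  have g4 := BQ (u k - y) w; rewrite Bw Qw in g4.
  have g5 := Qle (u k - y).
  have g6 : - (s * B (u k - y) z) <= `|s * B (u k - y) z| by rewrite -normrN ler_norm.
  have g7 := ler_wpM2l C0 (ltW g2).
  rewrite e1; move: hk g1; move: (k.+1%:R^-1) => rk; lra.
move=> z Yz; have h1 := half z Yz; have := half _ (YN Yz); rewrite BN; lra.
Qed.

Lemma hilbert_complemented : complemented Y.
Proof.
have [P hP] := choice orthogonal_projection_ex.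
have uniq F y : Y y -> (forall z, Y z -> B (F - y) z = 0) -> P F = y.
  move=> Yy hy; have [YP hPF] := hP F.
  have Yd : Y (P F - y) := YD YP (YN Yy).
  have : B (P F - y) (P F - y) = 0.
    by rewrite -[LHS]add0r -{1}(hPF _ Yd) -BD subrKA hy.
  move=> h; apply/eqP; rewrite -subr_eq0; apply/eqP/(nm_eq0 sc).
  have QQ : Q (P F - y) = 0.
    have := QD (P F - y) (- (P F - y)); rewrite subrr BN QN h.
    have -> : Q 0 = 0 by rewrite -(scale0r 0) QZ mod0 // expr0n mul0r.
    lra.
  have := Y_low Yd; rewrite QQ mulr0 => h2.
  by apply/eqP; rewrite -sqrf_eq0 eq_le h2 sqr_ge0.
have perpZ a x : (forall z, Y z -> B x z = 0) -> forall z, Y z -> B (a *: x) z = 0.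
  move=> hx z Yz; have [->|a0] := eqVneq a 0.
    by rewrite scale0r /B add0r sub0r QN subrr.
  have -> : z = a *: (a^-1 *: z) by rewrite scalerA mulfV // scale1r.
  rewrite /B -scalerDr -scalerBr !QZ -mulrBr -/(B _ _) hx ?mulr0 //; exact: YZ.
apply: (complemented_by (P := P) (C := C)).
- move=> a x y; apply: uniq; first exact: YZD (proj1 (hP x)) (proj1 (hP y)).
  move=> z Yz; rewrite opprD addrACA -scalerBr BD perpZ ?add0r //.
    exact: (proj2 (hP y)).
  exact: (proj2 (hP x)).
- move=> x; have [YP hPx] := hP x.
  rewrite -(@ler_pXn2r _ 2) // ?nnegrE ?nm_ge0 ?mulr_ge0 ?nm_ge0 //.
  apply: le_trans (Y_low YP) _; rewrite exprMn expr2 -mulrA ler_wpM2l //.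
  apply: le_trans (Qle x).
  have := QD (x - P x) (P x); rewrite subrK hPx // mul0r addr0 => ->.
  by rewrite lerDr.
- by move=> x; exact: (proj1 (hP x)).
- by move=> y Yy; apply: uniq => // z Yz; rewrite subrr /B add0r sub0r QN subrr.
Qed.

End HilbertProjection.
End Complement.

(** * Transfer of complemented subspaces *)

Section Transfer.
Context {R : realType} {K : numFieldType} {re : K -> R} (sc : scalar_parts re).
Local Notation nm := (nm re).
Local Notation modulus := (modulus re).

(** If n vectors spanned Y, the coefficients of n+1 of the [v j] would form a matrix with
    a nonzero row vector in its kernel, that is, a linear relation. *)
Lemma independent_infinite_dim (V : normedModType K) (Y : set V) (v : nat -> V) :
  (forall j, Y (v j)) ->
  (forall J (a : nat -> K), \sum_(j < J) a j *: v j = 0 -> forall j, (j < J)%N -> a j = 0) ->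
  infinite_dim Y.
Proof.
move=> Yv vfree [n [b hb]].
have [A hA] := choice (fun j => hb (v j) (Yv j)).
pose M : 'M[K]_(n.+1, n) := \matrix_(j, i) A j i.
have : kermx M != 0.
  rewrite kermx_eq0; apply/negP => /eqP h.
  by have := rank_leq_col M; rewrite h ltnn.
move=> /rowV0Pn [u /sub_kermxP uM u0].
pose a j := if insub j is Some o then u 0 o else 0.
have aE (j : 'I_n.+1) : a j = u 0 j by rewrite /a valK.
have av : \sum_(j < n.+1) a j *: v j = 0.
  under eq_bigr => j _ do rewrite hA scaler_sumr.
  rewrite exchange_big big1 // => i _.
  under eq_bigr => j _ do rewrite scalerA.
  rewrite -scaler_suml; have := congr1 (fun B : 'rV_n => B 0 i) uM.
  rewrite !mxE => h; rewrite (_ : \sum_(j < _) _ = 0) ?scale0r // -[RHS]h.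
  by apply: eq_bigr => j _; rewrite aE mxE.
move/negP: u0; apply; apply/eqP/rowP => j; rewrite mxE -aE.
exact: vfree av _ (ltn_ord j).
Qed.

Lemma lin0 (V W : normedModType K) (f : V -> W) :
  (forall a x y, f (a *: x + y) = a *: f x + f y) -> f 0 = 0.
Proof. by move=> h; have := h (-1) 0 0; rewrite scaler0 add0r scaleN1r addNr. Qed.

Lemma linZ (V W : normedModType K) (f : V -> W) :
  (forall a x y, f (a *: x + y) = a *: f x + f y) -> forall a x, f (a *: x) = a *: f x.
Proof. by move=> h a x; rewrite -[a *: x]addr0 h (lin0 h) addr0. Qed.

Lemma linB (V W : normedModType K) (f : V -> W) :
  (forall a x y, f (a *: x + y) = a *: f x + f y) -> forall x y, f (x - y) = f x - f y.
Proof. by move=> h x y; rewrite addrC -scaleN1r h scaleN1r addrC. Qed.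

Lemma lin_sum (V W : normedModType K) (f : V -> W) :
  (forall a x y, f (a *: x + y) = a *: f x + f y) ->
  forall (I : Type) (r : seq I) (a : I -> K) (v : I -> V),
    f (\sum_(j <- r) a j *: v j) = \sum_(j <- r) a j *: f (v j).
Proof.
move=> h I r a v; elim: r => [|j r IH]; first by rewrite !big_nil (lin0 h).
by rewrite !big_cons h IH.
Qed.

(** B is an isomorphism of Y onto a closed subspace of X, which contains a subspace
    complemented in X by some P.  With S the inverse of B on that subspace,
    S P B is a projection of Z onto its preimage in Y. *)
Lemma subprojective_transfer (Z X : completeNormedModType K) (B : Z -> X) (CB c : R) (Y : set Z) :
  subprojective X ->
  (forall a x y, B (a *: x + y) = a *: B x + B y) ->
  0 <= CB -> (forall x, nm (B x) <= CB * nm x) ->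
  linear_subspace Y -> closed Y ->
  0 <= c -> (forall y, Y y -> nm y <= c * nm (B y)) ->
  infinite_dim (B @` Y) ->
  exists Z1 : set Z,
    [/\ linear_subspace Z1, closed Z1, infinite_dim Z1, Z1 `<=` Y & complemented Z1].
Proof.
move=> Xsub Blin CB0 Bbd /linear_subspaceP [Y0 Ylin] Ycl c0 low Vinf.
have B0 := lin0 Blin; have BB := linB Blin.
have YB x y : Y x -> Y y -> Y (x - y).
  by move=> Yx Yy; rewrite addrC -scaleN1r; apply: Ylin.
have inj x y : Y x -> Y y -> B x = B y -> x = y.
  move=> Yx Yy e; apply/eqP; rewrite -subr_eq0; apply/eqP/(nm_eq0 sc)/eqP.
  rewrite eq_le nm_ge0 // andbT; apply: le_trans (low _ (YB _ _ Yx Yy)) _.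
  by rewrite BB e subrr nm0 // mulr0.
have [||//|W1 [W1sub W1cl W1inf W1V [P [Pcont PP Prange]]]] := Xsub (B @` Y).
- apply/linear_subspaceP; split; first by exists 0.
  by move=> a _ _ [x Yx <-] [y Yy <-]; exists (a *: x + y) => //; exact: Ylin.
- apply/(closed_nmP sc) => v hv.
  have H k : exists y, Y y /\ nm (v - B y) < k.+1%:R^-1.
    have [|_ [y Yy <-] h] := hv k.+1%:R^-1; first by rewrite invr_gt0.
    by exists y.
  have [u hu] := choice H.
  have [|y hy] := nm_complete sc (u := u).
    move=> r r0; have c1 : 0 < 2 * c + 1 by rewrite ltr_wpDl // mulr_ge0.
    have [|N hN] := inv_small (r := r / (2 * c + 1)); first by rewrite divr_gt0.
    exists N => m n Nm Nn.
    have [Ym gm] := hu m; have [Yn gn] := hu n.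
    apply: le_lt_trans (low _ (YB _ _ Ym Yn)) _; rewrite BB.
    have h1 := nm_tri sc v (B (u m)) (B (u n)); rewrite (nmBC _ v) in h1.
    have h2 := lt_trans gm (hN m Nm); have h3 := lt_trans gn (hN n Nn).
    rewrite ltr_pdivlMr // in h2; rewrite ltr_pdivlMr // in h3.
    have h4 := ler_wpM2l c0 h1.
    have := nm_ge0 sc (v - B (u m)); have := nm_ge0 sc (v - B (u n)).
    lra.
  have Yy : Y y.
    apply: (proj1 (closed_nmP sc Y) Ycl) => r r0; have [N hN] := hy r r0.
    by exists (u N); [exact: (proj1 (hu N))|rewrite nmBC; exact: hN].
  exists y => //; apply/esym/eqP; rewrite -subr_eq0; apply/eqP/(nm_eq0 sc)/eqP.
  rewrite eq_le nm_ge0 // andbT; apply: (le_eps (c := 1 + CB)) => d d0; rewrite add0r.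
  have [N1 h1] := inv_small d0; have [N2 h2] := hy d d0.
  have h3 := h1 _ (leq_maxl N1 N2); have h4 := h2 _ (leq_maxr N1 N2).
  have h5 := lt_trans (proj2 (hu (maxn N1 N2))) h3.
  have h6 := Bbd (u (maxn N1 N2) - y); rewrite BB in h6.
  have h7 := ler_wpM2l CB0 (ltW h4).
  have := nm_tri sc (B (u (maxn N1 N2))) v (B y); lra.
- have [W10 W1lin] := proj1 (linear_subspaceP W1) W1sub.
have [CP CP0 Pbd] := continuous_bounded sc Pcont.
have PW w : W1 w -> P w = w by rewrite -Prange => -[x _ <-].
have WP x : W1 (P x) by rewrite -Prange; exists x.
have WS z : exists y, Y y /\ B y = P (B z).
  by have [y Yy By] := W1V _ (WP (B z)); exists y.
have [S hS] := choice WS.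
pose Z1 := [set y | Y y /\ W1 (B y)].
have SP z : B (S z) = P (B z) by have [_ ->] := hS z.
have SY z : Y (S z) by have [] := hS z.
exists Z1; split.
- apply/linear_subspaceP; split; first by split; rewrite ?B0.
  move=> a x y [Yx Wx] [Yy Wy]; split; first exact: Ylin.
  by rewrite Blin; exact: W1lin.
- apply/(closed_nmP sc) => x hx; split.
    by apply: (proj1 (closed_nmP sc Y) Ycl) => r r0; have [y [Yy _] h] := hx r r0; exists y.
  apply: (proj1 (closed_nmP sc W1) W1cl) => r r0.
  have c1 : 0 < CB + 1 by rewrite ltr_wpDl.
  have [|y [_ Wy] h] := hx (r / (CB + 1)); first by rewrite divr_gt0.
  exists (B y) => //; rewrite -BB; apply: le_lt_trans (Bbd _) _.
  rewrite ltr_pdivlMr // in h; have := nm_ge0 sc (x - y); lra.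
- move=> [n [b hb]]; apply: W1inf; exists n, (fun i => B (b i)) => w Ww.
  have [z Yz zw] := W1V _ Ww.
  have [|a za] := hb z; first by split; rewrite ?zw.
  by exists a; rewrite -zw za (lin_sum Blin).
- by move=> x [].
- apply: (complemented_by sc (P := S) (C := c * (CP * CB))).
  + move=> a x y; apply: inj => //; first exact: Ylin.
    by rewrite Blin !SP Blin linearP.
  + move=> x; apply: le_trans (low _ (SY x)) _.
    rewrite SP -!mulrA ler_wpM2l //; apply: le_trans (Pbd _) _.
    by rewrite ler_wpM2l.
  + by move=> x; split; rewrite ?SP.
  + by move=> y [Yy Wy]; apply: inj => //; rewrite SP PW.
Qed.

End Transfer.

(** * Operators on Rad(X) *)

Lemma cauchy_schwarz1 (R : realType) N (x y : nat -> R) :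
  (forall n, 0 <= x n) -> (forall n, 0 <= y n) -> \sum_(n < N) x n ^+ 2 <= 1 ->
  \sum_(n < N) x n * y n <= Num.sqrt (\sum_(n < N) y n ^+ 2).
Proof.
move=> x0 y0 x1; set s := Num.sqrt _.
have S0 : 0 <= \sum_(n < N) y n ^+ 2 by apply: sumr_ge0 => n _; exact: sqr_ge0.
have s2 : s ^+ 2 = \sum_(n < N) y n ^+ 2 by rewrite sqr_sqrtr.
have s0 : 0 <= s by exact: sqrtr_ge0.
have h (t : R) : 0 < t -> \sum_(n < N) x n * y n <= (t + t^-1 * s ^+ 2) / 2.
  move=> t0; apply: (@le_trans _ _ (\sum_(n < N) (t * x n ^+ 2 + t^-1 * y n ^+ 2) / 2)).
    apply: ler_sum => n _; have := sqr_ge0 (t * x n - y n) => sq.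
    rewrite ler_pdivlMr // -(ler_pM2l t0).
    have -> : t * (t * x n ^+ 2 + t^-1 * y n ^+ 2) = t ^+ 2 * x n ^+ 2 + y n ^+ 2.
      by field; rewrite gt_eqF.
    lra.
  rewrite -mulr_suml big_split /= -!mulr_sumr -s2 ler_pM2r ?invr_gt0 // lerD2r.
  by rewrite ler_piMr // ltW.
have [sz|sn] := eqVneq s 0.
  apply: (le_eps (c := 1)) => d d0; rewrite sz add0r mul1r.
  apply: le_trans (h d d0) _; rewrite sz expr0n mulr0; lra.
have sp : 0 < s by rewrite lt_neqAle eq_sym sn.
apply: le_trans (h s sp) _; rewrite expr2 mulrA mulVf // mul1r; lra.
Qed.

(** The hypotheses [hlow] and [hup] say that Rad(X) is the space X(l_2): the norm of a
    matrix is equivalent to that of the element of X whose coefficients are the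
    l_2 norms of the rows. *)
Section RadOperators.
Context {R : realType} {K : numFieldType} {re : K -> R} (sc : scalar_parts re).
Local Notation nm := (nm re).
Local Notation modulus := (modulus re).
Context {X Z : completeNormedModType K} (e : nat -> X).
Context (e_dense : forall x d, 0 < d -> exists M (a : nat -> K),
   nm (x - \sum_(i < M) a i *: e i) < d).
Context (e_neq0 : forall i, e i != 0).
Context (J : (R -> X) -> Z).
Context (J_lin : forall (a : K) (f g : R -> X), @rad_sums R K X f -> @rad_sums R K X g ->
           J (a *: f + g) = a *: J f + J g).
Context (J_norm : forall f : R -> X, @rad_sums R K X f -> nm (J f) = L1norm re f).
Context (J_dense : dense (J @` @rad_sums R K X)).
Context (Cu Cl Cs : R) (Cu1 : 1 <= Cu) (hU : lattice_const (re := re) e Cu).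
Context (Cl0 : 0 <= Cl) (Cs0 : 0 <= Cs).
Context (hlow : forall M N (g : nat -> nat -> K),
  nm (\sum_(i < M) ofr sc (Num.sqrt (\sum_(n < N) modulus (g i n) ^+ 2)) *: e i) <=
  Cl * avg N (fun k => nm (\sum_(i < M) (\sum_(n < N) sgn K N k n * g i n) *: e i))).
Context (hup : forall M N (g : nat -> nat -> K) (b : nat -> K),
  (forall i, (i < M)%N -> \sum_(n < N) modulus (g i n) ^+ 2 <= modulus (b i) ^+ 2) ->
  avg N (fun k => nm (\sum_(i < M) (\sum_(n < N) sgn K N k n * g i n) *: e i)) <=
  Cs * nm (\sum_(i < M) b i *: e i)).

Local Notation radmx := (radmx e J).

Let Cu0 : 0 <= Cu. Proof. exact: le_trans Cu1. Qed.

Definition rownorm k (a : nat -> nat -> K) i : R := Num.sqrt (\sum_(n < k) modulus (a i n) ^+ 2).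

Lemma rownorm_sq k a i : rownorm k a i ^+ 2 = \sum_(n < k) modulus (a i n) ^+ 2.
Proof. by rewrite sqr_sqrtr // sumr_ge0 // => n _; exact: sqr_ge0. Qed.

Lemma rownorm_ge0 k a i : 0 <= rownorm k a i.
Proof. exact: sqrtr_ge0. Qed.

Lemma mod_le_rownorm k a i n : (n < k)%N -> modulus (a i n) <= rownorm k a i.
Proof.
move=> nk; rewrite -(@ler_pXn2r _ 2) // ?nnegrE ?mod_ge0 ?rownorm_ge0 // rownorm_sq.
by rewrite (bigD1 (Ordinal nk)) //= lerDl sumr_ge0 // => j _; exact: sqr_ge0.
Qed.

Lemma radmx_lower k a : nm (\sum_(i < k) ofr sc (rownorm k a i) *: e i) <= Cl * nm (radmx k a).
Proof. by rewrite (nm_radmx e J_norm); exact: hlow. Qed.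

Lemma radmx_upper k a b : (forall i, (i < k)%N -> rownorm k a i <= modulus (b i)) ->
  nm (radmx k a) <= Cs * nm (\sum_(i < k) b i *: e i).
Proof.
move=> h; rewrite (nm_radmx e J_norm); apply: hup => i ik; rewrite -rownorm_sq.
by rewrite lerXn2r ?nnegrE ?rownorm_ge0 ?mod_ge0 // h.
Qed.

Lemma radmx_rows k a (p : pred nat) :
  nm (radmx k (fun i n => if p i then a i n else 0)) <= Cu * nm (radmx k a).
Proof.
rewrite !(nm_radmx e J_norm) -avgZ; apply: le_avg => j.
apply: (hU (b := fun i => \sum_(n < k) sgn K k j n * (if p i then a i n else 0))
  (a := fun i => \sum_(n < k) sgn K k j n * a i n)) => i ik.
case: (p i) => //; rewrite big1 ?mod0 ?mod_ge0 // => n _; by rewrite mulr0.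
Qed.

Lemma row_bound k a i : (i < k)%N -> rownorm k a i * nm (e i) <= Cu * Cl * nm (radmx k a).
Proof.
move=> ik; have -> : rownorm k a i * nm (e i) =
    nm (\sum_(j < k) (if (j : nat) == i then ofr sc (rownorm k a i) else 0) *: e j).
  rewrite (bigD1 (Ordinal ik)) //= eqxx big1 ?addr0 => [|j ji].
    by rewrite nmZ // mod_ofr ger0_norm // rownorm_ge0.
  by rewrite (_ : (j : nat) == i = false) ?scale0r //; apply: contraNF ji.
rewrite -mulrA; apply: le_trans (ler_wpM2l Cu0 (radmx_lower k a)).
apply: (hU (b := fun j => if j == i then _ else 0)
  (a := fun j => ofr sc (rownorm k a j))) => j _.
by case: eqP => [->|_]; rewrite // ?mod0 // mod_ge0.
Qed.

(** Pairing each row with a vector of the unit ball of l_2 maps Rad(X) to X boundedly, by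
    the Cauchy-Schwarz inequality and the lower square function estimate. *)
Lemma pairing_operator (u : nat -> nat -> K) :
  (forall i k, \sum_(n < k) modulus (u i n) ^+ 2 <= 1) ->
  exists B : Z -> X, [/\ forall c x y, B (c *: x + y) = c *: B x + B y,
    forall x, nm (B x) <= Cu * Cl * nm x &
    forall k a, supported k a -> B (radmx k a) = \sum_(i < k) (\sum_(n < k) u i n * a i n) *: e i].
Proof.
move=> u1; apply: (bounded_extension sc e_dense J_lin J_norm J_dense (@nm_complete _ _ _ sc X)
  (T0 := fun k a => \sum_(i < k) (\sum_(n < k) u i n * a i n) *: e i)).
- exact: mulr_ge0.
- move=> k c a b _ _; rewrite scaler_sumr -big_split; apply: eq_bigr => i _ /=.
  rewrite scalerA -scalerDl mulr_sumr -big_split; congr (_ *: _).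
  by apply: eq_bigr => n _ /=; ring.
- move=> k l a kl ha.
  rewrite [RHS](big_ord_widen l (fun i => (\sum_(n < k) u i n * a i n) *: e i)) //.
  rewrite [RHS]big_mkcond; apply: eq_bigr => i _; case: ltnP => ik; last first.
    by rewrite big1 ?scale0r // => n _; rewrite ha ?ik // mulr0.
  congr (_ *: _); rewrite [RHS](big_ord_widen l (fun n => u i n * a i n)) //.
  rewrite [RHS]big_mkcond; apply: eq_bigr => n _; case: ltnP => // nk.
  by rewrite ha ?nk ?orbT // mulr0.
- move=> k a _; rewrite -mulrA; apply: le_trans (ler_wpM2l Cu0 (radmx_lower k a)).
  apply: (hU (b := fun i => \sum_(n < k) u i n * a i n)
     (a := fun i => ofr sc (rownorm k a i))) => i _.
  rewrite mod_ofr ger0_norm ?rownorm_ge0 //; apply: le_trans (mod_sum sc _ _ _) _.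
  under eq_bigr => n _ do rewrite (modM sc).
  by apply: (cauchy_schwarz1 (x := fun n => modulus (u i n)) (y := fun n => modulus (a i n)));
    rewrite ?u1 // => n; exact: mod_ge0.
Qed.

Lemma row_projection m :
  exists P : Z -> Z, [/\ forall c x y, P (c *: x + y) = c *: P x + P y,
    forall x, nm (P x) <= Cu * nm x &
    forall k a, supported k a ->
      P (radmx k a) = radmx k (fun i n => if (i < m)%N then a i n else 0)].
Proof.
apply: (bounded_extension sc e_dense J_lin J_norm J_dense (@nm_complete _ _ _ sc Z)
  (T0 := fun k a => radmx k (fun i n => if (i < m)%N then a i n else 0))) => //.
- move=> k c a b _ _; rewrite -(radmx_lin e J_lin); congr (radmx k _).
  by apply/funext => i; apply/funext => n; case: ifP; rewrite // mulr0 addr0.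
- move=> k l a kl ha; rewrite (radmx_widen e J kl) // => i n h.
  by rewrite ha // if_same.
- by move=> k a _; exact: radmx_rows.
Qed.

Lemma coordinate_functional i n :
  exists f : Z -> K^o, [/\ forall c x y, f (c *: x + y) = c *: f x + f y,
    forall x, modulus (f x) <= Cu * Cl / nm (e i) * nm x &
    forall k a, supported k a -> f (radmx k a) = a i n].
Proof.
have ei := nm_gt0 sc (e_neq0 i).
have D0 : 0 <= Cu * Cl / nm (e i) by rewrite !mulr_ge0 ?invr_ge0 // ltW.
have cK : forall u : nat -> K^o, nm_cauchy re u -> exists l, nm_lim re u l.
  exact: (@mod_complete _ _ _ sc).
apply: (bounded_extension sc e_dense J_lin J_norm J_dense cK
  (T0 := fun k a => a i n)) => // k a ha.
have [ik|ik] := ltnP i k; last first.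
  by rewrite ha ?ik // nm0 // mulr_ge0 ?nm_ge0.
have [nk|nk] := ltnP n k; last first.
  by rewrite ha ?nk ?orbT // nm0 // mulr_ge0 ?nm_ge0.
apply: le_trans (mod_le_rownorm a i nk) _.
rewrite mulrAC ler_pdivlMr //; exact: row_bound.
Qed.

(** * Subspaces whose norm is controlled by finitely many rows *)

Lemma sq_mod_polar (x y : K) :
  modulus (x + y) ^+ 2 - modulus (x - y) ^+ 2 = 4 * (re x * re y + im sc x * im sc y) :> R.
Proof.
have reN z : re (- z) = - re z.
  by rewrite -mulN1r -(rmorph1 (ofr sc)) -rmorphN (reZ sc) mulN1r.
have imN z : im sc (- z) = - im sc z.
  by rewrite -mulN1r -(rmorph1 (ofr sc)) -rmorphN (imZ sc) mulN1r.
rewrite !(mod_sq sc) !(reD sc) !(imD sc) reN imN; ring.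
Qed.

Lemma mod_sq_add (x y : K) : modulus (x + y) ^+ 2 <= 2 * modulus x ^+ 2 + 2 * modulus y ^+ 2.
Proof.
have h := modD sc x y; have := mod_ge0 sc (x + y); have := sqr_ge0 (modulus x - modulus y).
nra.
Qed.

(** Finitely many rows form a Hilbert space up to isomorphism, so Y is itself a
    Hilbert space, and the orthogonal projection for the sum Q of the squared
    entries of the first m rows maps Rad(X) onto it.  On finite matrices Q is
    elementary; on the completion it is the supremum of the partial sums [q N],
    and the estimates for Q are obtained by approximation by matrices. *)
Lemma bounded_below_rows_complemented (Y : set Z) (P : Z -> Z) (m : nat) (c : R) :
  (forall k a, supported k a ->
    P (radmx k a) = radmx k (fun i n => if (i < m)%N then a i n else 0)) ->
  (forall x y, P (x - y) = P x - P y) ->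
  (forall x, nm (P x) <= Cu * nm x) ->
  linear_subspace Y -> closed Y -> 0 < c -> (forall y, Y y -> c * nm y <= nm (P y)) ->
  complemented Y.
Proof.
move=> PE PB Pbd Ysub Ycl c0 Plow.
have [phi hphi] := choice (fun s : nat * nat => coordinate_functional s.1 s.2).
pose f i n := phi (i, n).
have flin i n : forall c x y, f i n (c *: x + y) = c *: f i n x + f i n y.
  by have [] := hphi (i, n).
have fbd i n x : modulus (f i n x) <= Cu * Cl / nm (e i) * nm x.
  by have [_ h _] := hphi (i, n); exact: h.
have fE i n k a : supported k a -> f i n (radmx k a) = a i n.
  by have [_ _ h] := hphi (i, n); exact: h.
have fB i n := linB (flin i n); have fZ i n := linZ (flin i n).
have fD i n x y : f i n (x + y) = f i n x + f i n y.
  by rewrite -[x]scale1r flin !scale1r.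
pose q N x : R := \sum_(i < m) \sum_(n < N) modulus (f i n x) ^+ 2.
pose b N x y : R := \sum_(i < m) \sum_(n < N)
  4 * (re (f i n x) * re (f i n y) + im sc (f i n x) * im sc (f i n y)).
have qb N x y : q N (x + y) - q N (x - y) = b N x y.
  rewrite /q -sumrB; apply: eq_bigr => i _; rewrite -sumrB; apply: eq_bigr => n _.
  by rewrite fD fB sq_mod_polar.
have q0 N x : 0 <= q N x.
  by apply: sumr_ge0 => i _; apply: sumr_ge0 => n _; exact: sqr_ge0.
have qmono x N N' : (N <= N')%N -> q N x <= q N' x.
  move=> NN; apply: ler_sum => i _.
  rewrite (big_ord_widen N' (fun n => modulus (f i n x) ^+ 2)) // big_mkcond.
  by apply: ler_sum => n _; case: ifP => // _; exact: sqr_ge0.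
have qZ N a x : q N (a *: x) = modulus a ^+ 2 * q N x.
  rewrite mulr_sumr; apply: eq_bigr => i _; rewrite mulr_sumr; apply: eq_bigr => n _.
  by rewrite fZ -exprMn -modM.
have qadd N x y : q N (x + y) <= 2 * q N x + 2 * q N y.
  rewrite !mulr_sumr -big_split; apply: ler_sum => i _ /=.
  rewrite !mulr_sumr -big_split; apply: ler_sum => n _ /=.
  by rewrite fD mod_sq_add.
pose D N : R := \sum_(i < m) \sum_(n < N) (Cu * Cl / nm (e i)) ^+ 2.
pose D0 : R := \sum_(i < m) (Cu * Cl / nm (e i)) ^+ 2.
have DN0 N : 0 <= D N by apply: sumr_ge0 => i _; apply: sumr_ge0 => n _; exact: sqr_ge0.
have D00 : 0 <= D0 by apply: sumr_ge0 => i _; exact: sqr_ge0.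
have qcrude N x : q N x <= D N * nm x ^+ 2.
  rewrite mulr_suml; apply: ler_sum => i _; rewrite mulr_suml; apply: ler_sum => n _.
  rewrite -exprMn lerXn2r ?nnegrE ?mod_ge0 ?fbd //.
  exact: le_trans (mod_ge0 sc _) (fbd i n x).
pose S k a : R := \sum_(i < m) rownorm k a i ^+ 2.
have qel N k a : supported k a -> (k <= N)%N -> q N (radmx k a) = S k a.
  move=> ha kN; apply: eq_bigr => i _; rewrite rownorm_sq.
  rewrite [RHS](big_ord_widen N (fun n => modulus (a i n) ^+ 2)) // [RHS]big_mkcond.
  apply: eq_bigr => n _; rewrite (fE _ _ _ _ ha); case: ltnP => // kn.
  by rewrite ha ?kn ?orbT // mod0 // expr0n.
have Sle k a : supported k a -> S k a <= D0 * nm (radmx k a) ^+ 2.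
  move=> ha; rewrite mulr_suml; apply: ler_sum => i _.
  have ei := nm_gt0 sc (e_neq0 i).
  have cl0 : 0 <= Cu * Cl / nm (e i) * nm (radmx k a).
    by rewrite !mulr_ge0 ?nm_ge0 // invr_ge0 ltW.
  rewrite -exprMn lerXn2r ?nnegrE ?rownorm_ge0 //.
  have [ik|ik] := ltnP i k.
    by rewrite mulrAC ler_pdivlMr //; exact: row_bound.
  rewrite /rownorm big1 ?sqrtr0 // => n _; by rewrite ha ?ik // mod0 // expr0n.
have approx x d : 0 < d -> exists k a, [/\ supported k a, (m <= k)%N &
    nm (x - radmx k a) <= 1 /\ nm (x - radmx k a) <= d].
  move=> d0; have [|k [a [ha]]] := @radmx_dense _ _ _ sc _ _ _ e_dense _ J_lin J_norm J_dense x (Num.min 1 d).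
    by rewrite lt_min ltr01.
  rewrite lt_min => /andP [h1 h2]; exists (maxn k m), a.
  rewrite (radmx_widen e J (leq_maxl k m) ha); split; [|exact: leq_maxr|by rewrite !ltW].
  exact: supported_widen (leq_maxl _ _) ha.
have qbd N x : q N x <= 2 * D0 * nm x ^+ 2.
  apply: (le_eps (c := 2 * D0 * (2 * nm x + 1) + 2 * D N)) => d d0.
  have [k [a [ha mk [h1 h2]]]] := approx x d d0.
  have g0 := qadd N (x - radmx k a) (radmx k a); rewrite subrK in g0.
  have g1 := qcrude N (x - radmx k a).
  have g2 : q N (radmx k a) <= S k a by rewrite -(qel (maxn k N)) // ?leq_maxl // qmono // leq_maxr.
  have g3 := Sle k a ha.
  have g4 : nm (radmx k a) <= nm x + nm (x - radmx k a).
    by have := nm_leB sc (radmx k a) x; rewrite nmBC addrC.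
  have nx := nm_ge0 sc x; have nd := nm_ge0 sc (x - radmx k a); have ne := nm_ge0 sc (radmx k a).
  have g5 : nm (x - radmx k a) ^+ 2 <= d by nra.
  have g6 : nm (radmx k a) ^+ 2 <= nm x ^+ 2 + (2 * nm x + 1) * d by nra.
  have := ler_wpM2l D00 g6; have := ler_wpM2l (DN0 N) g5; lra.
pose Q x : R := limn (fun N => q N x).
have Qcvg x : (fun N => q N x) @ \oo --> Q x.
  apply: nondecreasing_is_cvgn; first by move=> N N' /(qmono x).
  by exists (2 * D0 * nm x ^+ 2) => _ [N _ <-]; exact: qbd.
have qQ N x : q N x <= Q x.
  by apply: (nondecreasing_cvgn_le (u_ := fun N => q N x)); [move=> ? ? /(qmono x)|exact: (cvgP _ (@Qcvg x))].
have Qle x c' : (forall N, q N x <= c') -> Q x <= c'.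
  by move=> h; apply: limr_le; [exact: (cvgP _ (@Qcvg x))|exact: nearW].
have Q0 x : 0 <= Q x := le_trans (q0 0 x) (qQ 0 x).
have Qb x y : (fun N => b N x y) @ \oo --> Q (x + y) - Q (x - y).
  have -> : (fun N => b N x y) = (fun N => q N (x + y) - q N (x - y)).
    by apply/funext => N; rewrite qb.
  by apply: cvgB; exact: Qcvg.
pose G := Cs * \sum_(i < m) nm (e i).
have G0 : 0 <= G by rewrite mulr_ge0 // sumr_ge0 // => i _; exact: nm_ge0.
have Pel k a : supported k a -> (m <= k)%N -> nm (P (radmx k a)) ^+ 2 <= G ^+ 2 * S k a.
  move=> ha mk; have S0 : 0 <= S k a by apply: sumr_ge0 => i _; exact: sqr_ge0.
  rewrite -(sqr_sqrtr S0) -exprMn lerXn2r ?nnegrE ?nm_ge0 ?(mulr_ge0 G0 (sqrtr_ge0 _)) //.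
  rewrite PE // /G -mulrA.
  apply: le_trans (radmx_upper (b := fun i => if (i < m)%N then ofr sc (rownorm k a i) else 0) _) _.
    move=> i ik; case: ifP => im.
      by rewrite mod_ofr ger0_norm ?rownorm_ge0 // /rownorm im.
    by rewrite /rownorm im big1 ?sqrtr0 ?mod_ge0 // => n _; rewrite mod0 // expr0n.
  rewrite ler_wpM2l //; apply: le_trans (nm_sum sc _ _ _) _.
  rewrite mulr_suml (big_ord_widen k (fun i => nm (e i) * Num.sqrt (S k a))) // [leRHS]big_mkcond.
  apply: ler_sum => i _; case: ifP => im; last by rewrite scale0r nm0.
  rewrite nmZ // mod_ofr ger0_norm ?rownorm_ge0 // mulrC ler_wpM2l ?nm_ge0 //.
  rewrite -[leLHS]ger0_norm ?rownorm_ge0 // -sqrtr_sqr ler_wsqrtr //.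
  by rewrite /S (bigD1 (Ordinal im)) //= lerDl sumr_ge0 // => j _; exact: sqr_ge0.
have PQ x : nm (P x) ^+ 2 <= 4 * G ^+ 2 * Q x.
  apply: (le_eps (c := 8 * G ^+ 2 * D0 + 2 * Cu ^+ 2)) => d d0.
  have [k [a [ha mk [h1 h2]]]] := approx x d d0.
  have g0 := Pel k a ha mk; have g1 : S k a <= 2 * Q x + 4 * D0 * nm (x - radmx k a) ^+ 2.
    rewrite -(qel k k a) //.
    have -> : q k (radmx k a) = q k (x + - (x - radmx k a)) by rewrite subKr.
    apply: le_trans (qadd k x (- (x - radmx k a))) _.
    have qN y : q k (- y) = q k y :> R.
      by rewrite -scaleN1r qZ modN (mod1 sc) expr1n mul1r.
    by have := qQ k x; have := qbd k (x - radmx k a); rewrite qN; lra.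
  have g2 : nm (P x) <= nm (P (radmx k a)) + Cu * nm (x - radmx k a).
    by have := nm_leB sc (P x) (P (radmx k a)); have := Pbd (x - radmx k a); rewrite PB; lra.
  have nd := nm_ge0 sc (x - radmx k a).
  have g5 : nm (x - radmx k a) ^+ 2 <= d by nra.
  have g6 : nm (P x) ^+ 2 <= 2 * nm (P (radmx k a)) ^+ 2 + 2 * Cu ^+ 2 * nm (x - radmx k a) ^+ 2.
    apply: (@le_trans _ _ ((nm (P (radmx k a)) + Cu * nm (x - radmx k a)) ^+ 2)).
      by rewrite lerXn2r ?nnegrE ?nm_ge0 // (le_trans _ g2) ?nm_ge0.
    have := sqr_ge0 (nm (P (radmx k a)) - Cu * nm (x - radmx k a)); lra.
  have GG : 0 <= G ^+ 2 by exact: sqr_ge0.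
  have CC : 0 <= Cu ^+ 2 by exact: sqr_ge0.
  have k1 := ler_wpM2l GG g1; have k2 := ler_wpM2l CC g5.
  have k3 : 0 <= G ^+ 2 * D0 by exact: mulr_ge0.
  have k4 := ler_wpM2l k3 g5; lra.
have lim_uniq (u : nat -> R) (x y : R) : u @ \oo --> x -> u @ \oo --> y -> x = y.
  by move=> h1 h2; rewrite -(cvg_lim (@Rhausdorff R) h1) (cvg_lim (@Rhausdorff R) h2).
pose C := 2 * D0 + 4 * G ^+ 2 / c ^+ 2.
have cc : 0 < c ^+ 2 by rewrite exprn_gt0.
have GG : 0 <= 4 * G ^+ 2 / c ^+ 2 by apply: divr_ge0; [apply: mulr_ge0 => //; exact: sqr_ge0|exact: ltW].
have C0 : 0 <= C by rewrite addr_ge0 // mulr_ge0.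
apply: (hilbert_complemented (sc := sc) (Q := Q) (C := C)) => //.
- move=> a x; apply: (lim_uniq (fun N => q N (a *: x))).
    exact: Qcvg.
  rewrite (_ : (fun N => q N (a *: x)) = (fun N => modulus a ^+ 2 * q N x)).
    by apply: cvgM; [exact: cvg_cst|exact: Qcvg].
  by apply/funext => N; rewrite qZ.
- move=> x x' y; apply: (lim_uniq (fun N => b N (x + x') y)).
    exact: Qb.
  rewrite (_ : (fun N => b N (x + x') y) = (fun N => b N x y + b N x' y)).
    by apply: cvgD; exact: Qb.
  apply/funext => N; rewrite -big_split; apply: eq_bigr => i _; rewrite -big_split.
  by apply: eq_bigr => n _; rewrite fD (reD sc) (imD sc) /=; ring.
- move=> t x y; apply: (lim_uniq (fun N => b N (ofr sc t *: x) y)).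
    exact: Qb.
  rewrite (_ : (fun N => b N (ofr sc t *: x) y) = (fun N => t * b N x y)).
    by apply: cvgM; [exact: cvg_cst|exact: Qb].
  apply/funext => N; rewrite mulr_sumr; apply: eq_bigr => i _; rewrite mulr_sumr.
  by apply: eq_bigr => n _; rewrite fZ (reZ sc) (imZ sc); ring.
- move=> x; apply: Qle => N; apply: le_trans (qbd N x) _.
  by rewrite ler_wpM2r ?sqr_ge0 // lerDl.
- move=> y Yy; apply: (@le_trans _ _ (4 * G ^+ 2 / c ^+ 2 * Q y)); last first.
    by rewrite ler_wpM2r // lerDr mulr_ge0.
  rewrite mulrAC ler_pdivlMr //; apply: le_trans (PQ y).
  rewrite -exprMn mulrC lerXn2r ?nnegrE ?nm_ge0 // ?Plow //.
  by rewrite mulr_ge0 ?nm_ge0 // ltW.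
Qed.

(** * Subspaces with almost block-disjoint vectors *)

Lemma radmx0 k : radmx k (fun _ _ => 0) = 0.
Proof.
have h : radmx k (fun _ _ => 0) = -1 *: radmx k (fun _ _ => 0) + radmx k (fun _ _ => 0).
  rewrite -(radmx_lin e J_lin); congr (radmx k _).
  by apply/funext => i; apply/funext => n; rewrite mulr0 addr0.
by rewrite h scaleN1r addNr.
Qed.

Lemma radmx_sum k I (r : seq I) (b : I -> K) (a : I -> nat -> nat -> K) :
  radmx k (fun i n => \sum_(j <- r) b j * a j i n) = \sum_(j <- r) b j *: radmx k (a j).
Proof.
elim: r => [|j r IH].
  rewrite big_nil -[RHS](radmx0 k); congr (radmx k _).
  by apply/funext => i; apply/funext => n; rewrite big_nil.
rewrite big_cons -IH -(radmx_lin e J_lin); congr (radmx k _).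
by apply/funext => i; apply/funext => n; rewrite big_cons.
Qed.

Context (P : nat -> Z -> Z)
  (Plin : forall m c x y, P m (c *: x + y) = c *: P m x + P m y)
  (Pbd : forall m x, nm (P m x) <= Cu * nm x)
  (PE : forall m k a, supported k a ->
    P m (radmx k a) = radmx k (fun i n => if (i < m)%N then a i n else 0)).

Context (Y : set Z).
Context (Y_small : forall m d, 0 < d -> exists y, [/\ Y y, nm y = 1 & nm (P m y) < d]).

Let Cu_gt0 : 0 < Cu. Proof. exact: lt_le_trans Cu1. Qed.

(** A unit vector of Y with small first m rows is close to a finite matrix, hence to the
    same matrix with its first m rows deleted. *)
Lemma hump m (d : R) : 0 < d -> exists t : Z * nat * (nat -> nat -> K),
  [/\ Y t.1.1, nm t.1.1 = 1, (m < t.1.2)%N, supported t.1.2 t.2 /\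
    (forall i n, (i < m)%N -> t.2 i n = 0) & nm (t.1.1 - radmx t.1.2 t.2) < d].
Proof.
(* The error is at most h from the approximation of y by a matrix, plus (1 + Cu) h
   from the first m rows of that matrix. *)
move=> d0; pose h := d / (2 + Cu).
have c0 : 0 < 2 + Cu by rewrite addr_gt0.
have h0 : 0 < h by rewrite divr_gt0.
have [y [Yy y1 Py]] := Y_small m h0.
have [k0 [a [ha0 yk0]]] := radmx_dense sc e_dense J_lin J_norm J_dense y h0.
pose k := maxn k0 m.+1.
have ha : supported k a := supported_widen (leq_maxl _ _) ha0.
have yk : nm (y - radmx k a) < h by rewrite (radmx_widen e J (leq_maxl _ _) ha0).
pose a' i n := if (i < m)%N then 0 else a i n.
have Ea' : radmx k a' = radmx k a - P m (radmx k a).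
  rewrite PE // addrC -scaleN1r -(radmx_lin e J_lin); congr (radmx k _).
  apply/funext => i; apply/funext => n; rewrite /a'; case: ifP => _; ring.
exists (y, k, a'); split=> //=; first by rewrite leq_maxr.
  split=> i n; first by move=> hin; rewrite /a' ha // if_same.
  by rewrite /a' => ->.
have -> : y - radmx k a' = (y - radmx k a) + P m (radmx k a).
  by rewrite Ea' opprB addrCA addrC.
apply: le_lt_trans (nmD sc _ _) _.
have g1 : nm (P m (radmx k a)) <= nm (P m y) + Cu * nm (y - radmx k a).
  have := Pbd m (y - radmx k a); rewrite (linB (Plin m)).
  have := nm_leB sc (P m (radmx k a)) (P m y); rewrite (nmBC (P m (radmx k a))); lra.
have g2 : Cu * nm (y - radmx k a) < Cu * h by rewrite ltr_pM2l.
have -> : d = (2 + Cu) * h by rewrite mulrC divfK // gt_eqF.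
lra.
Qed.

Context (X_sub : subprojective X) (Y_sub : linear_subspace Y) (Y_cl : closed Y).

(** Vectors [y j] of Y are close to matrices [U j] supported in successive blocks of rows,
    so each row i is nonzero in a single [U j]; let A be the matrix that carries all
    these rows.  Pairing each row with the normalized conjugate row of A maps
    sum_j b_j [U j] to the element of X with coefficients b_j |row i of U j|_2, where
    j is the block of i.  By the upper square function estimate this
    operator is bounded below on the span of the [U j], and by perturbation on the
    closed span of the [y j]; the complemented subspace then comes from X. *)
Lemma gliding_hump : exists Z1 : set Z,
    [/\ linear_subspace Z1, closed Z1, infinite_dim Z1, Z1 `<=` Y & complemented Z1].
Proof.
have Cl0' := Cl0; have Cs0' := Cs0; have Cu_gt0' := Cu_gt0; have Cu1' := Cu1.
pose CB := Cu * Cl; have CB0 : 0 <= CB by rewrite mulr_ge0 // ltW.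
(* The total error of the approximations: small enough that the span of the
   [y j] inherits the lower bound for B from the span of the [U j]. *)
pose eta := (4 * Cu * (1 + Cs * CB))^-1.
have t0 : 0 <= Cs * CB by rewrite mulr_ge0.
have den0 : 0 < 4 * Cu * (1 + Cs * CB) by rewrite !mulr_gt0 // ltr_wpDr.
have eta0 : 0 < eta by rewrite invr_gt0.
have etaE : 4 * Cu * eta + 4 * Cu * eta * (Cs * CB) = 1.
  by rewrite /eta; field; rewrite !gt_eqF // ltr_wpDr.
have etaC0 : 0 <= 4 * Cu * eta * (Cs * CB) by rewrite !mulr_ge0 // ltW.
have eta1 : 4 * Cu * eta <= 1 by lra.
have eta2 : 4 * Cu * eta * (Cs * CB) <= 1 by have := mulr_ge0 (ltW Cu_gt0) (ltW eta0); lra.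
pose eps j : R := eta * 2^-1 ^+ j.+1.
have eps0 j : 0 < eps j by rewrite mulr_gt0 // exprn_gt0.
have eps_sum N : \sum_(j < N) eps j <= eta.
  have : \sum_(j < N) eps j <= eta * (1 - 2^-1 ^+ N).
    elim: N => [|N IH]; first by rewrite big_ord0 expr0 subrr mulr0.
    rewrite big_ord_recr /= /eps exprS; lra.
  move=> h; apply: le_trans h _; rewrite ler_piMr ?(ltW eta0) // gerBl exprn_ge0 //.
have eps_half j : eps j <= 1 / 2.
  have h1 : 2^-1 ^+ j.+1 <= 1 :> R by rewrite exprn_ile1 // invf_le1 // ler1n.
  have h2 : eps j <= eta by rewrite ler_piMr // ltW.
  have h3 : eta <= Cu * eta by rewrite ler_peMl // ltW.
  lra.
have H (s : nat * nat) := hump s.1 (eps0 s.2).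
have [st hst] := choice H.
pose fix kk j := if j is i.+1 then (st (kk i, i)).1.2 else 0%N.
pose y j := (st (kk j, j)).1.1.
pose a j := (st (kk j, j)).2.
have Yy j : Y (y j) by have [] := hst (kk j, j).
have y1 j : nm (y j) = 1 :> R by have [] := hst (kk j, j).
have kS j : (kk j < kk j.+1)%N by have [] := hst (kk j, j).
have fa j : supported (kk j.+1) (a j) by have [_ _ _ []] := hst (kk j, j).
have a0 j i n : (i < kk j)%N -> a j i n = 0.
  by move=> ij; have [_ _ _ [_ h] _] := hst (kk j, j); exact: (h i n ij).
have yu j : nm (y j - radmx (kk j.+1) (a j)) < eps j by have [] := hst (kk j, j).
have kmono i j : (i <= j)%N -> (kk i <= kk j)%N.
  move=> /subnK <-; elim: (j - i)%N => // m IH; rewrite addSn.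
  exact: leq_trans IH (ltnW (kS _)).
have kge j : (j <= kk j)%N by elim: j => // j IH; exact: leq_ltn_trans IH (kS j).
have block i : exists j, (kk j <= i < kk j.+1)%N.
  suff Hm m : (i < kk m)%N -> exists j, (kk j <= i < kk j.+1)%N by exact: (Hm i.+1 (kge _)).
  elim: m => [|m IH] //= h; have [im|im] := ltnP i (kk m); first exact: IH.
  by exists m; rewrite im.
have aoff (j j0 i n : nat) : (kk j0 <= i < kk j0.+1)%N -> j != j0 -> a j i n = 0.
  move=> /andP [h1 h2]; rewrite neq_ltn => /orP [h|h].
    by apply: fa; rewrite (leq_trans _ h1) // kmono.
  by apply: a0; apply: leq_trans h2 _; exact: kmono.
(* Since j <= kk j, row i can only belong to a block of index at most i. *)
pose A i n := \sum_(j < i.+1) a j i n.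
have AE i j0 n : (kk j0 <= i < kk j0.+1)%N -> A i n = a j0 i n.
  move=> hj; have ji : (j0 < i.+1)%N.
    by rewrite ltnS (leq_trans (kge j0)) //; case/andP: hj.
  rewrite /A (bigD1 (Ordinal ji)) //= big1 ?addr0 // => j jj.
  exact: aoff hj jj.
pose l i := rownorm (kk i.+1) A i.
have Aoff i n : (kk i.+1 <= n)%N -> A i n = 0.
  move=> hn; have [j0 hj] := block i; rewrite (AE _ _ _ hj); apply: fa; apply/orP; right.
  apply: leq_trans hn; apply: kmono; rewrite ltnS (leq_trans (kge j0)) //.
  by case/andP: hj.
have Aw i w : (kk i.+1 <= w)%N -> \sum_(n < w) modulus (A i n) ^+ 2 = l i ^+ 2.
  move=> hw; rewrite rownorm_sq [RHS](big_ord_widen w (fun n => modulus (A i n) ^+ 2)) //.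
  rewrite [RHS]big_mkcond; apply: eq_bigr => n _; case: ltnP => // h.
  by rewrite Aoff // mod0 // expr0n.
have Awle i w : \sum_(n < w) modulus (A i n) ^+ 2 <= l i ^+ 2.
  rewrite -(Aw i (maxn w (kk i.+1))) ?leq_maxr //.
  rewrite (big_ord_widen (maxn w (kk i.+1)) (fun n => modulus (A i n) ^+ 2)) ?leq_maxl //.
  by rewrite big_mkcond; apply: ler_sum => n _; case: ifP => // _; exact: sqr_ge0.
have l0 i : 0 <= l i by exact: rownorm_ge0.
(* |z|^2 / z is the conjugate of z, and is 0 for z = 0. *)
pose u i n := ofr sc (modulus (A i n) ^+ 2) / (A i n * ofr sc (l i)).
have uA i n : u i n * A i n = ofr sc (modulus (A i n) ^+ 2 / l i).
  rewrite /u rmorphM fmorphV; have [->|An] := eqVneq (A i n) 0.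
    by rewrite mod0 // expr0n rmorph0 !mul0r.
  by rewrite invfM mulrA mulrAC divfK.
have umod i n : modulus (u i n) ^+ 2 = modulus (A i n) ^+ 2 / l i ^+ 2.
  rewrite /u (modM sc) (modV sc) (modM sc) !mod_ofr (ger0_norm (l0 i)) ger0_norm ?sqr_ge0 //.
  have [->|An] := eqVneq (modulus (A i n)) 0; first by rewrite expr0n !mul0r expr0n.
  have [->|ln] := eqVneq (l i) 0; first by rewrite mulr0 expr0n /= invr0 !mulr0 expr0n.
  by field; rewrite An ln.
have u1 i k : \sum_(n < k) modulus (u i n) ^+ 2 <= 1.
  under eq_bigr => n _ do rewrite umod.
  rewrite -mulr_suml; have [->|ln] := eqVneq (l i) 0.
    by rewrite expr0n invr0 mulr0 ler01.
  rewrite ler_pdivrMr ?mul1r ?Awle // exprn_gt0 // lt_neqAle eq_sym ln; exact: l0.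
have [B [Blin Bbd BE]] := pairing_operator u1.
rewrite -/CB in Bbd; have BB := linB Blin.
pose U j := radmx (kk j.+1) (a j).
have main J0 (b : nat -> K) :
    nm (\sum_(j < J0) b j *: U j) <= Cs * nm (B (\sum_(j < J0) b j *: U j)) /\
    forall j, (j < J0)%N -> modulus (b j) <= 2 * Cu * nm (\sum_(j < J0) b j *: U j).
  (* A window containing every nonzero entry of A in its first kk J0 rows. *)
  pose w := kk (kk J0).
  pose g i n := \sum_(j < J0) b j * a j i n.
  have kw : (kk J0 <= w)%N by apply: kmono; exact: kge.
  have aw j : (j < J0)%N -> supported w (a j).
    by move=> jJ; apply: supported_widen (fa j); apply: leq_trans kw; exact: kmono.
  have Uw j : (j < J0)%N -> U j = radmx w (a j).
    by move=> jJ; rewrite /U (@radmx_widen _ _ _ _ e J (kk j.+1) w) //; apply: leq_trans kw; exact: kmono.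
  have GE : \sum_(j < J0) b j *: U j = radmx w g.
    rewrite /g (radmx_sum w _ (fun j : 'I_J0 => b j) (fun j : 'I_J0 => a j)).
    by apply: eq_bigr => j _; rewrite Uw.
  have fg : supported w g.
    by move=> i n h; rewrite /g big1 // => j _; rewrite (aw _ (ltn_ord j)) // mulr0.
  have row i : exists c, (forall n, g i n = c * A i n) /\ (c = 0 \/ (kk i.+1 <= w)%N).
    have [iJ|iJ] := ltnP i (kk J0); last first.
      exists 0; split; last by left.
      move=> n; rewrite mul0r /g big1 // => j _; rewrite fa ?mulr0 //.
      by rewrite (leq_trans _ iJ) // kmono.
    have [j0 hj] := block i; have jJ : (j0 < J0)%N.
      rewrite ltnNge; apply/negP => h; case/andP: hj => h1 _.
      by have := leq_trans (leq_ltn_trans h1 iJ) (kmono _ _ h); rewrite ltnn.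
    exists (b j0); split; last by right; exact: kmono.
    move=> n; rewrite /g (bigD1 (Ordinal jJ)) //= big1 ?addr0 ?(AE _ _ _ hj) // => j jj.
    by rewrite (aoff _ _ _ _ hj jj) mulr0.
  have [c hc] := choice row.
  rewrite GE; split.
    rewrite BE //.
    have -> : \sum_(i < w) (\sum_(n < w) u i n * g i n) *: e i =
        \sum_(i < w) (c i * ofr sc (l i)) *: e i.
      apply: eq_bigr => i _; congr (_ *: _); have [gc cw] := hc i.
      under eq_bigr => n _ do rewrite gc mulrCA uA.
      rewrite -mulr_sumr -rmorph_sum -mulr_suml; case: cw => [->|cw]; first by rewrite !mul0r.
      rewrite Aw //; congr (c i * ofr sc _).
      have [->|ln] := eqVneq (l i) 0; first by rewrite invr0 mulr0.
      by rewrite expr2 mulfK.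
    apply: (radmx_upper (b := fun i => c i * ofr sc (l i))) => i _.
    rewrite (modM sc) mod_ofr (ger0_norm (l0 i)).
    have [gc _] := hc i.
    have lc0 : 0 <= modulus (c i) * l i by rewrite mulr_ge0 // mod_ge0.
    rewrite -(@ler_pXn2r _ 2) ?nnegrE ?rownorm_ge0 // rownorm_sq.
    under eq_bigr => n _ do rewrite gc (modM sc) exprMn.
    by rewrite -mulr_sumr exprMn ler_wpM2l ?sqr_ge0.
  move=> j jJ.
  have h1 := radmx_rows w g (fun i => (kk j <= i < kk j.+1)%N).
  have E : radmx w (fun i n => if (kk j <= i < kk j.+1)%N then g i n else 0) = b j *: U j.
    rewrite Uw // -[b j *: _]addr0.
    have := radmx_lin e J_lin w (b j) (a j) (fun _ _ => 0).
    rewrite radmx0.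
    move=> <-; congr (radmx w _); apply/funext => i; apply/funext => n; rewrite addr0.
    case: ifP => hj.
      rewrite /g (bigD1 (Ordinal jJ)) //= big1 ?addr0 // => j' jj.
      by rewrite (aoff _ _ _ _ hj jj) mulr0.
    move/negbT: hj; rewrite negb_and -leqNgt -ltnNge => /orP [h|h].
      by rewrite a0 // mulr0.
    by rewrite fa ?h // mulr0.
  rewrite E nmZ // in h1.
  have h2 : 1 / 2 <= nm (U j).
    have := nm_leB sc (y j) (U j); rewrite y1; have := yu j; rewrite -/(U j).
    have := eps_half j; lra.
  have := ler_wpM2l (mod_ge0 sc (b j)) h2; lra.
have main2 J0 (b : nat -> K) :
    nm (\sum_(j < J0) b j *: y j) <= 4 * Cs * nm (B (\sum_(j < J0) b j *: y j)) /\
    forall j, (j < J0)%N -> modulus (b j) <= 4 * Cu * Cs * nm (B (\sum_(j < J0) b j *: y j)).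
  have [m1 m2] := main J0 b.
  set G := \sum_(j < J0) b j *: U j in m1 m2; set S := \sum_(j < J0) b j *: y j.
  have G0 := nm_ge0 sc G.
  have SG : nm (S - G) <= 2 * Cu * eta * nm G.
    rewrite /S /G -sumrB; apply: le_trans (nm_sum sc _ _ _) _.
    apply: (@le_trans _ _ (\sum_(j < J0) (2 * Cu * nm G) * eps j)).
      apply: ler_sum => j _; rewrite -scalerBr nmZ //.
      by apply: ler_pM; rewrite ?mod_ge0 ?nm_ge0 ?m2 // ltW // yu.
    rewrite -mulr_sumr [leRHS]mulrAC; apply: ler_wpM2l (eps_sum J0).
    by rewrite !mulr_ge0 // ltW.
  have B1 : nm (B G) <= nm (B S) + CB * nm (S - G).
    have := Bbd (S - G); rewrite BB; have := nm_leB sc (B G) (B S); rewrite (nmBC (B G)); lra.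
  have B2 := ler_wpM2l Cs0 B1.
  have B3 := ler_wpM2l t0 SG.
  have B4 := ler_wpM2r G0 eta2.
  have B5 := ler_wpM2r G0 eta1.
  have h1 : nm G <= 2 * Cs * nm (B S) by lra.
  have h2 := nm_leB sc S G.
  split; first lra.
  move=> j jJ; apply: le_trans (m2 j jJ) _.
  have := ler_wpM2l (ltW Cu_gt0) h1; lra.
pose Y1 := [set z : Z | forall d, 0 < d -> exists J0 (b : nat -> K),
  nm (z - \sum_(j < J0) b j *: y j) < d].
have [Y00 Ylin] := proj1 (linear_subspaceP Y) Y_sub.
have Yspan J0 (b : nat -> K) : Y (\sum_(j < J0) b j *: y j).
  by elim: J0 => [|J0 IH]; rewrite ?big_ord0 // big_ord_recr /= addrC; exact: Ylin.
have Y1y j : Y1 (y j).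
  move=> d d0; exists j.+1, (fun i => (i == j)%:R).
  rewrite big_ord_recr /= eqxx scale1r big1 ?add0r ?subrr ?nm0 // => i _.
  by rewrite ltn_eqF ?scale0r.
have Y1Y : Y1 `<=` Y.
  move=> z hz; apply: (proj1 (closed_nmP sc Y) Y_cl) => d /hz [J0 [b hb]].
  by exists (\sum_(j < J0) b j *: y j).
have [|||||Z1 [s1 s2 s3 s4 s5]] := subprojective_transfer sc (B := B) (CB := CB) (c := 4 * Cs) (Y := Y1)
  X_sub Blin CB0 Bbd.
- apply/linear_subspaceP; split.
    by move=> d d0; exists 0%N, (fun=> 0); rewrite big_ord0 subrr nm0.
  move=> c z z' hz hz' d d0.
  have d2 : 0 < d / 2 by rewrite divr_gt0.
  have cd : 0 < d / 2 / (modulus c + 1) by rewrite divr_gt0 // ltr_wpDl // mod_ge0.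
  have [J1 [b1 h1]] := hz _ cd; have [J2 [b2 h2]] := hz' _ d2.
  pose w := maxn J1 J2.
  have pad J0 (b : nat -> K) : (J0 <= w)%N -> \sum_(j < J0) b j *: y j =
      \sum_(j < w) (if (j < J0)%N then b j else 0) *: y j.
    move=> h; rewrite (big_ord_widen w (fun j => b j *: y j)) // big_mkcond.
    by apply: eq_bigr => j _; case: ifP; rewrite ?scale0r.
  rewrite (pad J1) ?leq_maxl // in h1; rewrite (pad J2) ?leq_maxr // in h2.
  exists w, (fun j => c * (if (j < J1)%N then b1 j else 0) + (if (j < J2)%N then b2 j else 0)).
  under eq_bigr => j _ do rewrite scalerDl -scalerA.
  rewrite big_split /= -scaler_sumr opprD addrACA -scalerBr.
  apply: le_lt_trans (nmD sc _ _) _; rewrite nmZ //.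
  move: h1; rewrite ltr_pdivlMr ?ltr_wpDl ?mod_ge0 // => h1.
  have := nm_ge0 sc (z - \sum_(j < w) (if (j < J1)%N then b1 j else 0) *: y j); lra.
- apply/(closed_nmP sc) => z hz d d0; have d2 : 0 < d / 2 by rewrite divr_gt0.
  have [z' hz' zz'] := hz _ d2; have [J0 [b hb]] := hz' _ d2.
  exists J0, b; rewrite (splitr d); apply: le_lt_trans (nm_tri sc z' _ _) _.
  exact: ltrD.
- exact: mulr_ge0.
- move=> z hz; apply: (le_eps (c := 1 + 4 * Cs * CB)) => d d0.
  have [J0 [b hb]] := hz d d0; have [m1 _] := main2 J0 b.
  set S := \sum_(j < J0) b j *: y j in hb m1.
  have h1 := nm_leB sc z S; have h2 := Bbd (S - z); rewrite BB in h2.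
  have h3 := nm_leB sc (B S) (B z); rewrite (nmBC S) in h2.
  have h4 := ler_wpM2l CB0 (ltW hb).
  have c0 : 0 <= 4 * Cs by exact: mulr_ge0.
  have h5 : nm (B S) <= nm (B z) + CB * d by lra.
  have := ler_wpM2l c0 h5; lra.
- apply: (independent_infinite_dim (v := fun j => B (y j))).
    by move=> j; exists (y j).
  move=> J0 b; rewrite -(lin_sum Blin) => h j jJ; apply: (mod_eq0 sc); apply/eqP.
  rewrite eq_le mod_ge0 // andbT; have [_ /(_ j jJ)] := main2 J0 b.
  by rewrite h nm0 // mulr0.
- exists Z1; split=> //; exact: subset_trans s4 Y1Y.
Qed.

End RadOperators.

(** * Subprojectivity of Rad(X) *)

Theorem proposition7p3 (R : realType) (K : numFieldType) (re : K -> R)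
    (hK : real_or_complex re)
    (X : completeNormedModType K)
    (X_infinite : infinite_dim [set: X])
    (X_subprojective : subprojective X)
    (X_basis : exists e : nat -> X, unconditional_basis e)
    (X_cotype : nontrivial_cotype re X)
    (RadX : completeNormedModType K)
    (hRadX : is_Rad re X RadX) :
  subprojective RadX.
Proof.
have [sc] := scalar_partsP hK; have [e he] := X_basis.
have [q [q2 [Cq hq]]] := X_cotype; have [J [J_lin J_norm J_dense]] := hRadX.
have [Cu Cu1 hU] := unconditional_lattice sc he.
have e_dense := basis_dense sc he.1; have e_neq0 := basis_neq0 sc he.1.
have [Cs Cs0 hup] := square_function_upper sc Cu1 hU q2 hq.
have hlow := square_function_lower sc Cu1 hU.
have Cl0 : 0 <= 320 * Cu ^+ 2 by rewrite mulr_ge0 // sqr_ge0.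
have [P hP] := choice (row_projection sc e_dense J_lin J_norm J_dense Cu1 hU).
move=> Y Ysub Ycl Yinf.
have [[m [c [c0 low]]]|small] := pselect
  (exists m c, 0 < c /\ forall y, Y y -> c * nm re y <= nm re (P m y)).
  exists Y; split=> //; have [Plin Pbd PE] := hP m.
  exact: (bounded_below_rows_complemented e_dense e_neq0 J_lin J_norm J_dense Cu1 hU Cl0 Cs0 hlow hup
    PE (linB Plin) Pbd Ysub Ycl c0 low).
apply: (gliding_hump e_dense J_lin J_norm J_dense Cu1 hU Cl0 Cs0 hlow hup (P := P)) => //.
- by move=> m; have [] := hP m.
- by move=> m; have [] := hP m.
- by move=> m; have [] := hP m.
move=> m d d0; apply: contrapT => hn; apply: small; exists m, d; split=> // y Yy.
have [->|y0] := eqVneq y 0; first by rewrite nm0 // mulr0 nm_ge0.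
have ny := nm_gt0 sc y0; have [Plin _ _] := hP m.
rewrite leNgt; apply/negP => hy; apply: hn.
have v0 : 0 <= (nm re y)^-1 by rewrite invr_ge0 ltW.
exists (ofr sc (nm re y)^-1 *: y); split.
- have [Y0 Ylin] := proj1 (linear_subspaceP Y) Ysub.
  by rewrite -[_ *: y]addr0; exact: Ylin.
- by rewrite nmZ // mod_ofr ger0_norm // mulVf // gt_eqF.
- by rewrite (linZ Plin) nmZ // mod_ofr ger0_norm // mulrC ltr_pdivrMr.
Qed.
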